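(* Let $s\in\tfrac12\mathbb{Z}_{>0}$, and for integers $0\le a,c\le 2s$ let $$n(a,c)=\begin{cases}2\min\{a,c\},& \text{if } a+c\le 2s,\\ 2s-|a-c|,&\text{if } a+c>2s.\end{cases}$$ Then the set $$\{\,e_1^{(a)}g_2^{|a-c|}e_1^{(c)}\kappa^p \ :\ a,c,p\in\mathbb{Z},\ 0\le a,c\le 2s,\ 0\le p\le n(a,c)\,\}$$ is a basis of the algebra $\mathcal{A}_s$.
   Context: Here $q$ is an indeterminate; all algebras are unital associative over the field $\mathbb{C}(q)$. Notation: $[A,B]_q=qAB-q^{-1}BA$; $q_p=(-1)^pq^{p(p+1)}$ for integers $p$; $\chi_p=q^{2p+1}+q^{-2p-1}$ for $p\in\frac12\mathbb{Z}$. The algebra $B_3^s(q)$ is generated by $\sigma_1,\sigma_2$ subject to $\sigma_1\sigma_2\sigma_1=\sigma_2\sigma_1\sigma_2$ and $\prod_{p=0}^{2s}(\sigma_i-q_p)=0$ for $i=1,2$ (so the $\sigma_i$ are invertible). In it, for $i=1,2$ and $r=0,1,\dots,2s$, define the idempotents $$e_i^{(r)}=\prod_{0\le p\le 2s,\ p\ne r}\frac{\sigma_i-q_p}{q_r-q_p},\qquad\text{and}\qquad g_i=\sum_{r=0}^{2s}\chi_r e_i^{(r)}.$$ The Askey--Wilson braid algebra $AW\!B_3^{s}(q)$ is the quotient of $B_3^s(q)$ by the relations stating that the three elements $$\frac{[g_1,g_2]_q}{q^2-q^{-2}}+\sigma_1g_2\sigma_1^{-1},\qquad \frac{[g_2,\sigma_1g_2\sigma_1^{-1}]_q}{q^2-q^{-2}}+g_1,\qquad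 \frac{[\sigma_1g_2\sigma_1^{-1},g_1]_q}{q^2-q^{-2}}+g_2$$ are equal to one and the same central element, which is written $\frac{\chi_s(\kappa+\chi_s)}{q+q^{-1}}$; this defines the central element $\kappa$. In $AW\!B_3^s(q)$ set $$\Omega=\chi_s(\kappa+\chi_s)(qg_1+q^{-1}g_2+q\sigma_1g_2\sigma_1^{-1})-q^2g_1^2-q^{-2}g_2^2-q^2\sigma_1g_2^2\sigma_1^{-1}-q\,g_1g_2\sigma_1g_2\sigma_1^{-1}.$$ The algebra $\mathcal{A}_s$ is the quotient of $AW\!B_3^s(q)$ by the relations $\Omega=\kappa(\kappa+\chi_s^3)+3\chi_s^2-\chi_0^2$ and $e_1^{(0)}g_2e_1^{(0)}=\frac{\chi_s^2}{\chi_0}e_1^{(0)}$. The same symbols denote the images of the elements in $\mathcal{A}_s$. *)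

(* Defs.v *)
From HB Require Import structures.
From mathcomp Require Import all_boot all_order all_algebra generic_quotient.
From mathcomp Require Import boolp classical_sets reals complex monalg.

Set Implicit Arguments.
Unset Strict Implicit.
Unset Printing Implicit Defensive.

Import GRing.Theory.
Local Open Scope ring_scope.
Local Open Scope quotient_scope.

Section Presentation.
Variables (K : comNzRingType) (I : choiceType).

(* Noncommutative polynomials in the letters I: the algebra over K of the free
   monoid of words in I. *)
Definition freeAlg : Type := malg (fmonom I) K.

HB.instance Definition _ := GRing.NzRing.on freeAlg.
HB.instance Definition _ := GRing.Lalgebra.on freeAlg.

Definition gen (i : I) : freeAlg := mkmalgU (fmu i) 1.

Lemma freeAlg_scaleAr (k : K) (x y : freeAlg) : k *: (x * y) = x * (k *: y).
Proof.
rewrite [x * y]malgME [RHS](@malgMEw _ _ (msupp x) (msupp y)) //; last first.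
  exact: msuppZ_le.
rewrite scaler_sumr; apply: eq_bigr => a _.
rewrite scaler_sumr; apply: eq_bigr => b _.
apply/malgP => w; rewrite mcoeffZ !mcoeffU mcoeffZ.
by rewrite mulrnAr mulrCA.
Qed.

Section Quotient.
Variable S : set freeAlg.

(* As freeAlg is unital, a two-sided ideal is stable under scaling. *)
Definition two_sided_ideal (J : set freeAlg) : Prop :=
  [/\ J 0,
      forall x y, J x -> J y -> J (x - y),
      forall a x, J x -> J (a * x)
    & forall a x, J x -> J (x * a)].

Definition ideal_gen : set freeAlg :=
  [set x | forall J : set freeAlg,
     two_sided_ideal J -> (S `<=` J)%classic -> J x].

Lemma ideal_genP : two_sided_ideal ideal_gen.
Proof.
split=> [J [] //|x y Jx Jy J HJ SJ|a x Jx J HJ SJ|a x Jx J HJ SJ];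
  have [_ JB JMl JMr] := HJ.
- by apply: JB; [apply: Jx | apply: Jy].
- by apply: JMl; apply: Jx.
- by apply: JMr; apply: Jx.
Qed.

Definition ideal_pred : pred freeAlg := fun x => `[< ideal_gen x >].

Lemma ideal_zmod_closed : zmod_closed ideal_pred.
Proof.
have [J0 JB _ _] := ideal_genP.
split; first exact/asboolP.
by move=> x y /asboolP Jx /asboolP Jy; apply/asboolP; apply: JB.
Qed.

HB.instance Definition _ :=
  GRing.isZmodClosed.Build freeAlg ideal_pred ideal_zmod_closed.

Definition ideal_zmod : zmodClosed freeAlg :=
  GRing.ZmodClosed.clone freeAlg ideal_pred _.

(* The algebra generated by I subject to the relations x = 0 for x in S. It
   carries a ring and a module structure, and the algebra axioms are
   quot_scalerAl and quot_scalerAr; the structure GRing.Algebra would require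
   1 != 0, which depends on S. *)
Definition quotAlg : Type := Quotient.quot ideal_zmod.

HB.instance Definition _ := GRing.Zmodule.on quotAlg.
HB.instance Definition _ := Quotient.on quotAlg.

Definition toQuot (x : freeAlg) : quotAlg := \pi_(Quotient.quot ideal_zmod) x.

Lemma toQuotP (x y : freeAlg) : toQuot x = toQuot y <-> ideal_gen (x - y).
Proof.
split; first by move/eqP; rewrite /toQuot -Quotient.idealrBE => /asboolP.
by move=> Jxy; apply/eqP; rewrite /toQuot -Quotient.idealrBE; apply/asboolP.
Qed.

Definition ofQuot (x : quotAlg) : freeAlg := repr (x : Quotient.quot ideal_zmod).

Lemma ofQuotK (x : quotAlg) : toQuot (ofQuot x) = x.
Proof. exact: reprK. Qed.

Lemma toQuotD x y : toQuot (x + y) = toQuot x + toQuot y.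
Proof. exact: (@pi_addr _ _ _ _ _ (Quotient.quot ideal_zmod)). Qed.

Lemma ofQuot_rep x : ideal_gen (ofQuot (toQuot x) - x).
Proof. by apply/toQuotP; rewrite ofQuotK. Qed.

(* The operations are locked so that conversion does not unfold them to
   representatives. *)
Definition quot_one : quotAlg := locked (toQuot 1).
Definition quot_mul : quotAlg -> quotAlg -> quotAlg :=
  locked (fun x y => toQuot (ofQuot x * ofQuot y)).
Definition quot_scale : K -> quotAlg -> quotAlg :=
  locked (fun k x => toQuot (k *: ofQuot x)).

Lemma toQuot1 : toQuot 1 = quot_one.
Proof. by rewrite /quot_one -lock. Qed.

Lemma toQuotM x y : toQuot (x * y) = quot_mul (toQuot x) (toQuot y).
Proof.
rewrite /quot_mul -lock.
have [J0 JB JMl JMr] := ideal_genP.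
apply/esym/toQuotP.
have -> : ofQuot (toQuot x) * ofQuot (toQuot y) - x * y =
    (ofQuot (toQuot x) - x) * ofQuot (toQuot y)
    - (0 - x * (ofQuot (toQuot y) - y)).
  by rewrite sub0r opprK mulrBl mulrBr addrA addrNK.
apply: (JB); first by apply: JMr; apply: ofQuot_rep.
by apply: JB => //; apply: JMl; apply: ofQuot_rep.
Qed.

Lemma toQuotZ k x : toQuot (k *: x) = quot_scale k (toQuot x).
Proof.
rewrite /quot_scale -lock.
have [J0 JB JMl JMr] := ideal_genP.
apply/esym/toQuotP; rewrite -scalerBr -[_ - x]mul1r GRing.scalerAl.
by apply: JMl; apply: ofQuot_rep.
Qed.

Lemma quot_mulA : associative quot_mul.
Proof.
move=> x y z; rewrite -[x]ofQuotK -[y]ofQuotK -[z]ofQuotK.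
by rewrite -!toQuotM mulrA.
Qed.

Lemma quot_mul1l : left_id quot_one quot_mul.
Proof. by move=> x; rewrite -[x]ofQuotK -toQuot1 -toQuotM mul1r. Qed.

Lemma quot_mul1r : right_id quot_one quot_mul.
Proof. by move=> x; rewrite -[x]ofQuotK -toQuot1 -toQuotM mulr1. Qed.

Lemma quot_mulDl : left_distributive quot_mul +%R.
Proof.
move=> x y z; rewrite -[x]ofQuotK -[y]ofQuotK -[z]ofQuotK.
by rewrite -toQuotD -!toQuotM -toQuotD mulrDl.
Qed.

Lemma quot_mulDr : right_distributive quot_mul +%R.
Proof.
move=> x y z; rewrite -[x]ofQuotK -[y]ofQuotK -[z]ofQuotK.
by rewrite -toQuotD -!toQuotM -toQuotD mulrDr.
Qed.

HB.instance Definition _ := GRing.Zmodule_isPzRing.Build quotAlg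
  quot_mulA quot_mul1l quot_mul1r quot_mulDl quot_mulDr.

Lemma quot_scaleA k l x :
  quot_scale k (quot_scale l x) = quot_scale (k * l) x.
Proof. by rewrite -[x]ofQuotK -!toQuotZ scalerA. Qed.

Lemma quot_scale1 : left_id 1 quot_scale.
Proof. by move=> x; rewrite -[x]ofQuotK -toQuotZ scale1r. Qed.

Lemma quot_scaleDr : right_distributive quot_scale +%R.
Proof.
move=> k x y; rewrite -[x]ofQuotK -[y]ofQuotK.
by rewrite -toQuotD -!toQuotZ -toQuotD scalerDr.
Qed.

Lemma quot_scaleDl x : {morph quot_scale^~ x : k l / k + l}.
Proof.
by move=> k l; rewrite -[x]ofQuotK -!toQuotZ -toQuotD scalerDl.
Qed.

HB.instance Definition _ := GRing.Zmodule_isLmodule.Build K quotAlg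
  quot_scaleA quot_scale1 quot_scaleDr quot_scaleDl.

Lemma quot_scalerAl (k : K) (x y : quotAlg) : k *: (x * y) = (k *: x) * y.
Proof.
rewrite -[x]ofQuotK -[y]ofQuotK.
change (quot_scale k (quot_mul (toQuot (ofQuot x)) (toQuot (ofQuot y))) =
  quot_mul (quot_scale k (toQuot (ofQuot x))) (toQuot (ofQuot y))).
by rewrite -toQuotM -!toQuotZ -toQuotM GRing.scalerAl.
Qed.

Lemma quot_scalerAr (k : K) (x y : quotAlg) : k *: (x * y) = x * (k *: y).
Proof.
rewrite -[x]ofQuotK -[y]ofQuotK.
change (quot_scale k (quot_mul (toQuot (ofQuot x)) (toQuot (ofQuot y))) =
  quot_mul (toQuot (ofQuot x)) (quot_scale k (toQuot (ofQuot y)))).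
by rewrite -toQuotM -!toQuotZ -toQuotM freeAlg_scaleAr.
Qed.

End Quotient.

(* The further quotient of quotAlg S by a set T of relations is presented as
   the quotient of the free algebra by S and all the lifts of T. *)
Definition add_relations (S : set freeAlg) (T : set (quotAlg S)) : set freeAlg :=
  (S `|` @toQuot S @^-1` T)%classic.

End Presentation.

Definition two_sided_inverse (A : pzRingType) (x : A) : set A :=
  [set y | x * y = 1 /\ y * x = 1].

(* The inverse of x when x is invertible, and 0 otherwise. *)
Definition pzinv (A : pzRingType) (x : A) : A := xget 0 (two_sided_inverse x).

Definition is_basis (K : nzRingType) (V : lmodType K) (I : finType)
    (v : I -> V) : Prop :=
  (forall c : I -> K, \sum_i c i *: v i = 0 -> forall i, c i = 0) /\
  (forall x : V, exists c : I -> K, x = \sum_i c i *: v i).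

(* The spin s is encoded by N = 2s, and a half-integer p by the integer 2p. *)

Section Elements.
Variables (K : fieldType) (q : K) (N : nat).

Definition qpar (p : int) : K := (-1) ^ p * q ^ (p * (p + 1)).

(* chi m is chi_p for m = 2p. *)
Definition chi (m : int) : K := q ^ (m + 1) + q ^ (- m - 1).

Local Notation chi_s := (chi N).

(* In each of the algebras B3, AWB3 and As, whose relations are successive
   choices of S, sigma_1 and sigma_2 are the images of the two generators. *)
Section InAlgebra.
Variable S : set (freeAlg K bool).

Local Notation A := (quotAlg S).

Definition sigma1 : A := toQuot S (gen K false).
Definition sigma2 : A := toQuot S (gen K true).

Local Notation s1 := sigma1.
Local Notation s2 := sigma2.

Definition qcomm (x y : A) : A := q *: (x * y) - q^-1 *: (y * x).

Definition idem (x : A) (r : nat) : A :=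
  \prod_(p < N.+1 | (p : nat) != r)
    ((qpar r - qpar p)^-1 *: (x - qpar p *: (1 : A))).

Definition gelt (x : A) : A := \sum_(r < N.+1) chi (2 * r)%N *: idem x r.

Local Notation g1 := (gelt s1).
Local Notation g2 := (gelt s2).
Local Notation g13 := (s1 * g2 * pzinv s1).

Definition aw1 : A := (q ^+ 2 - q ^- 2)^-1 *: qcomm g1 g2 + g13.
Definition aw2 : A := (q ^+ 2 - q ^- 2)^-1 *: qcomm g2 g13 + g1.
Definition aw3 : A := (q ^+ 2 - q ^- 2)^-1 *: qcomm g13 g1 + g2.

(* Solves aw1 = chi_s (kappa + chi_s) / (q + q^-1). *)
Definition kappa : A := ((q + q^-1) / chi_s) *: aw1 - chi_s *: (1 : A).

Definition Omega : A :=
  chi_s *: (kappa + chi_s *: (1 : A)) * (q *: g1 + q^-1 *: g2 + q *: g13)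
  - q ^+ 2 *: g1 ^+ 2 - q ^- 2 *: g2 ^+ 2
  - q ^+ 2 *: (s1 * g2 ^+ 2 * pzinv s1)
  - q *: (g1 * g2 * s1 * g2 * pzinv s1).

(* In a set of relations, the elements are those to be sent to 0. *)
Definition AWB3_relations : set A :=
  [set x | [\/ x = aw1 - aw2,
               x = aw1 - aw3
             | exists y : A, x = aw1 * y - y * aw1]].

Definition As_relations : set A :=
  [set x | x = Omega - (kappa * (kappa + chi_s ^+ 3 *: (1 : A))
                        + (3 * chi_s ^+ 2 - chi 0 ^+ 2) *: (1 : A)) \/
           x = idem s1 0 * g2 * idem s1 0 - (chi_s ^+ 2 / chi 0) *: idem s1 0].

End InAlgebra.

Definition B3_presentation : set (freeAlg K bool) :=
  let s1 := gen K false in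
  let s2 := gen K true in
  [set x | [\/ x = s1 * s2 * s1 - s2 * s1 * s2,
               x = \prod_(p < N.+1) (s1 - qpar p *: (1 : freeAlg K bool))
             | x = \prod_(p < N.+1) (s2 - qpar p *: (1 : freeAlg K bool))]].

Definition AWB3_presentation : set (freeAlg K bool) :=
  add_relations (@AWB3_relations B3_presentation).

Definition As_presentation : set (freeAlg K bool) :=
  add_relations (@As_relations AWB3_presentation).

Definition B3 : Type := quotAlg B3_presentation.
Definition AWB3 : Type := quotAlg AWB3_presentation.
Definition As : Type := quotAlg As_presentation.

(* n(a,c), for a, c <= N. *)
Definition maxpow (a c : nat) : nat :=
  if (a + c <= N)%N then (2 * minn a c)%N else (N - `|a - c|)%N.

(* The triples (a, c, p) with 0 <= a, c <= N and 0 <= p <= n(a,c). *)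
Definition basis_index : finType :=
  {ac : 'I_N.+1 * 'I_N.+1 & 'I_(maxpow ac.1 ac.2).+1}.

Definition basis_elt (i : basis_index) : As :=
  let a : nat := (tag i).1 in
  let c : nat := (tag i).2 in
  let p : nat := tagged i in
  idem (sigma1 _) a * gelt (sigma2 _) ^+ `|a - c|%N * idem (sigma1 _) c
  * kappa _ ^+ p.

End Elements.

(* The field C(q), with C the complex numbers over a model R of the reals. *)
Definition Cq (R : realType) : fieldType := {fraction {poly R[i]}}.
Definition qvar (R : realType) : Cq R := tofrac ('X : {poly R[i]}).

(* Main.v *)
Require Import Defs.
From HB Require Import structures.
From mathcomp Require Import all_boot all_order all_algebra reals.
From mathcomp Require Import classical_sets complex monalg.
From mathcomp Require Import ring zify.

(** Write N = 2s, E a = e_1^(a), M a c = E a * g2 ^+ |a - c| * E c and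
    th a = chi_a, so that g1 * E a = th a *: E a. Everything holds over a field K
    in which 2 is invertible, with q nonzero and not a root of unity (generic).

    The product of an Askey-Wilson relation with E a on the left and E c on the
    right is a linear equation for E a * g2 * E c. It follows that g2 is tridiagonal
    with respect to the E a (G_far), with polynomials in kappa on the diagonal
    (G_diag). The second relation and the Casimir relation then give two equations
    for the loops E a * g2 * E (a+1) * g2 * E a and E a * g2 * E (a-1) * g2 * E a,
    and each loop is a polynomial in kappa times E a: up to a nonzero constant, the
    weight of the edge from b to b+1 is (kappa - chi_(s+b+1)) (kappa - chi_(s-b-1))
    (loop_up, loop_dn). Hence the paths M a c span the algebra over the polynomials
    in kappa (span_all).

    Spanning. Some polynomial of degree n(a,c) + 1 in kappa kills M a c. The last
    defining relation says that kappa - chi_s kills E 0, so that climbing from 0 to c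
    the product of kappa - chi_s with the weights of the edges passed kills E c.
    From the top there is a second bound: sigma_1 sigma_2 conjugates sigma_1 into
    sigma_2, so the product of the g2 - th r over r >= c annihilates every z such that
    E r * y * z = 0 for all y and all r < c (spectral_kill). The component of this
    product at level c is governed by the difference between the diagonal entries of
    g2 and its eigenvalues, summed over the levels from c to N, which is a nonzero
    multiple of kappa - chi_(s+c) (trace_step, trace_sum). Comparing the
    roots of both annihilators leaves n(a,c) + 1 of them (path_killed), and division
    with remainder gives the spanning half (basis_spans).

    Independence. For levels m, ..., l let G1 be lower and G2 upper bidiagonal, with
    eigenvalues th m, ..., th l and explicit entries off the diagonal. These
    matrices satisfy the Askey-Wilson and Casimir relations with kappa a scalar, in
    two cases: l = N with kappa = chi_(s+m), and l = N - m with kappa = chi_(s-m)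
    (up_triple, dn_triple). If sigma_i acts by the polynomial in G_i that sends
    th r to q_r, then sigma_1 conjugates G2 into G3, and sigma_2 conjugates G3 into
    G1 (aw_sigma), which gives the braid relation and a representation of the
    algebra (rep0_As). The path M a c is nonzero in it as soon as both a and c occur
    among the levels. This happens for n(a,c) + 1 different scalars kappa, so that no
    nonzero polynomial of degree at most n(a,c) in kappa kills M a c
    (corner_faithful); multiplication by idempotents on both sides separates the
    pairs (a, c) (basis_free). *)

Set Implicit Arguments.
Unset Strict Implicit.
Unset Printing Implicit Defensive.

Import GRing.Theory.
Local Open Scope ring_scope.

(** * Algebras given by generators and relations *)

HB.instance Definition _ (K : comNzRingType) (I : choiceType) :=
  GRing.Lalgebra_isAlgebra.Build K (freeAlg K I) (@freeAlg_scaleAr K I).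

Section QuotientMorphisms.
Variables (K : fieldType) (I : choiceType).
Local Notation F := (freeAlg K I).

Section ToQuot.
Variable S : set F.

Lemma toQuot_is_zmod_morphism : zmod_morphism (@toQuot K I S).
Proof.
move=> x y; apply: (addIr (toQuot S y)).
by rewrite -toQuotD !subrK.
Qed.

Lemma toQuot_is_monoid_morphism : monoid_morphism (@toQuot K I S).
Proof. by split; [exact: toQuot1 | exact: toQuotM]. Qed.

HB.instance Definition _ := GRing.isZmodMorphism.Build F (quotAlg S)
  (@toQuot K I S) toQuot_is_zmod_morphism.
HB.instance Definition _ := GRing.isMonoidMorphism.Build F (quotAlg S)
  (@toQuot K I S) toQuot_is_monoid_morphism.

Lemma toQuotZE k x : toQuot S (k *: x) = k *: toQuot S x.
Proof. exact: toQuotZ. Qed.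

Lemma quotZl k (x y : quotAlg S) : k *: x * y = k *: (x * y).
Proof. by rewrite quot_scalerAl. Qed.

Lemma quotZr k (x y : quotAlg S) : x * (k *: y) = k *: (x * y).
Proof. by rewrite quot_scalerAr. Qed.

Lemma toQuot_rel x : S x -> toQuot S x = 0.
Proof.
by move=> Sx; rewrite -[RHS](rmorph0 (@toQuot K I S)); apply/toQuotP => J _; rewrite subr0; apply.
Qed.

(** horner_alg asks for a nontrivial algebra, which a quotient need not be;
    hence the detour through a representative. *)
Definition evq (x : quotAlg S) (p : {poly K}) : quotAlg S :=
  toQuot S (horner_alg (ofQuot x) p).

Lemma evq_is_zmod_morphism x : zmod_morphism (evq x).
Proof. by move=> p p'; rewrite /evq !rmorphB. Qed.

Lemma evq_is_monoid_morphism x : monoid_morphism (evq x).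
Proof. by split=> [|p p']; rewrite /evq ?rmorph1 // !rmorphM. Qed.

HB.instance Definition _ x := GRing.isZmodMorphism.Build {poly K} (quotAlg S)
  (evq x) (evq_is_zmod_morphism x).
HB.instance Definition _ x := GRing.isMonoidMorphism.Build {poly K} (quotAlg S)
  (evq x) (evq_is_monoid_morphism x).

Lemma evqX x : evq x 'X = x.
Proof. by rewrite /evq horner_algX ofQuotK. Qed.

Lemma evqC x c : evq x c%:P = c *: (1 : quotAlg S).
Proof. by rewrite /evq horner_algC toQuotZE rmorph1. Qed.

Lemma evqZ x c p : evq x (c *: p) = c *: evq x p.
Proof. by rewrite -mul_polyC rmorphM /= evqC quotZl mul1r. Qed.

Lemma evq_comm x y p : x * y = y * x -> evq x p * y = y * evq x p.
Proof.
move=> xy; elim/poly_ind: p => [|p c IH]; first by rewrite rmorph0 mul0r mulr0.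
rewrite rmorphD rmorphM /= evqX evqC mulrDl mulrDr quotZl quotZr mul1r mulr1.
by rewrite -mulrA xy mulrA IH mulrA.
Qed.

Lemma evq_intertwine x y w p : w * x = y * w -> w * evq x p = evq y p * w.
Proof.
move=> xy; elim/poly_ind: p => [|p c IH]; first by rewrite !rmorph0 mul0r mulr0.
rewrite !rmorphD !rmorphM /= !evqX !evqC mulrDl mulrDr quotZl quotZr mul1r mulr1.
by rewrite mulrA IH -mulrA xy mulrA.
Qed.

Lemma evq_comp x p p' : evq (evq x p) p' = evq x (p' \Po p).
Proof.
elim/poly_ind: p' => [|p' c IH]; first by rewrite comp_poly0 !rmorph0.
by rewrite rmorphD rmorphM /= evqX evqC IH comp_polyD comp_polyM comp_polyX
   comp_polyC rmorphD rmorphM /= evqC.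
Qed.

End ToQuot.

Section Lift.
Variables (S : set F) (T : pzRingType) (f : {rmorphism F -> T}).
Hypothesis fS : forall x, S x -> f x = 0.

Definition qlift (x : quotAlg S) : T := f (ofQuot x).

Lemma qlift_ideal x : ideal_gen S x -> f x = 0.
Proof.
move=> Jx; pose J : set F := [set y | f y = 0]%classic.
suff: J x by [].
apply: Jx => //; split; rewrite /J /=.
- exact: rmorph0.
- by move=> a b fa fb; rewrite rmorphB fa fb subr0.
- by move=> a b fb; rewrite rmorphM fb mulr0.
- by move=> a b fb; rewrite rmorphM fb mul0r.
Qed.

Lemma qliftE x : qlift (toQuot S x) = f x.
Proof.
apply/eqP; rewrite -subr_eq0 /qlift -(rmorphB f); apply/eqP.
by apply: qlift_ideal; exact: ofQuot_rep.
Qed.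

Lemma qlift_is_zmod_morphism : zmod_morphism qlift.
Proof.
move=> x y; rewrite -[x]ofQuotK -[y]ofQuotK.
by rewrite -(rmorphB (@toQuot K I S)) !qliftE rmorphB.
Qed.

Lemma qlift_is_monoid_morphism : monoid_morphism qlift.
Proof.
split; first by rewrite -(rmorph1 (@toQuot K I S)) qliftE rmorph1.
move=> x y; rewrite -[x]ofQuotK -[y]ofQuotK.
by rewrite -(rmorphM (@toQuot K I S)) !qliftE rmorphM.
Qed.

End Lift.

End QuotientMorphisms.
Arguments qlift : simpl never.
Arguments evq : simpl never.

Section FreeEval.
Variables (K : fieldType) (I : choiceType) (T : algType K) (v : I -> T).

Definition wordval (w : fmonom I) : T := \prod_(i <- (w : seq I)) v i.

Lemma wordval_mmorphism : mmorphism wordval.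
Proof.
split=> [x y|]; rewrite /wordval ?fm1 ?big_nil //.
by rewrite fmM big_cat.
Qed.

HB.instance Definition _ := isMultiplicative.Build (fmonom I) T wordval
  wordval_mmorphism.

Definition freeval : freeAlg K I -> T := mmap (in_alg T) wordval.

Lemma freeval_is_zmod_morphism : zmod_morphism freeval.
Proof. by move=> x y; rewrite /freeval mmapB. Qed.

Lemma freeval_is_monoid_morphism : monoid_morphism freeval.
Proof.
have [|mM m1] := @commr_mmap_is_multiplicative (fmonom I) K T (in_alg T) wordval.
  by move=> g m m'; rewrite /GRing.comm /= -scalerAl -scalerAr mul1r mulr1.
by split.
Qed.

HB.instance Definition _ := GRing.isZmodMorphism.Build (freeAlg K I) T
  freeval freeval_is_zmod_morphism.
HB.instance Definition _ := GRing.isMonoidMorphism.Build (freeAlg K I) T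
  freeval freeval_is_monoid_morphism.

Lemma freevalZ k x : freeval (k *: x) = k *: freeval x.
Proof. by rewrite /freeval mmapZ /= -scalerAl mul1r. Qed.

Lemma freeval_gen i : freeval (gen K i) = v i.
Proof.
rewrite /freeval /gen mmapU /wordval /= scale1r mul1r fmuE.
by rewrite big_seq1.
Qed.

(** Induction by letters multiplied on the left: it is how a subspace stable
    under left multiplication by the generators is shown to be everything. *)
Lemma free_ind (P : freeAlg K I -> Prop) :
  P 1 -> (forall x y, P x -> P y -> P (x + y)) ->
  (forall k x, P x -> P (k *: x)) ->
  (forall i x, P x -> P (gen K i * x)) -> forall x, P x.
Proof.
move=> P1 PD PZ PM x.
have P0 : P 0 by rewrite -(scale0r 1); apply: PZ.
rewrite [x]monalgE; apply: (@big_ind _ P) => // w _.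
have -> : << x@_w *g w >> = x@_w *: (<< 1 *g w >> : freeAlg K I).
  by apply/malgP => u; rewrite mcoeffZ !mcoeffU; case: eqP; rewrite ?mulr1 ?mulr0.
apply: PZ; case: w => s; elim: s => [|i s IH].
  suff -> : << 1 *g FMonom [::] >> = 1 :> freeAlg K I by [].
  by congr (mkmalgU _ _); apply/val_inj; rewrite /= fm1.
suff -> : << 1 *g FMonom (i :: s) >> = gen K i * << 1 *g FMonom s >> :> freeAlg K I.
  exact: PM.
rewrite /gen [RHS]malgM_def fgmulUU mulr1.
congr (mkmalgU _ _); apply/val_inj; rewrite /= fmM fmuE //.
Qed.

End FreeEval.
Arguments freeval : simpl never.

(** * Quantum numbers and interpolation *)

(** The argument is carried out over any field with such a parameter; qvar_generic
    covers the indeterminate. *)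
Definition generic (K : fieldType) (q : K) : Prop :=
  [/\ q != 0, forall n, (0 < n)%N -> q ^+ n != 1 & (2%:R : K) != 0].

Section NonzeroFactors.
Variable K : fieldType.
Implicit Type z : K.

Lemma sqr_neq1 z : z != 0 -> z - z^-1 != 0 -> z * z - 1 != 0.
Proof.
move=> z0; rewrite (_ : z - z^-1 = (z * z - 1) / z); last by field.
by rewrite mulf_eq0 negb_or => /andP[].
Qed.

Lemma sqr_neqN1 z : z != 0 -> z + z^-1 != 0 -> z * z + 1 != 0.
Proof.
move=> z0; rewrite (_ : z + z^-1 = (z * z + 1) / z); last by field.
by rewrite mulf_eq0 negb_or => /andP[].
Qed.

End NonzeroFactors.

Section QuantumNumbers.
Variables (K : fieldType) (q : K).
Hypothesis gq : generic q.
Let q0 : q != 0. Proof. by case: gq. Qed.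
Let q1 n : (0 < n)%N -> q ^+ n != 1. Proof. by case: gq => _ h _; apply: h. Qed.
Let two0 : (2%:R : K) != 0. Proof. by case: gq. Qed.

Definition br (n : int) : K := q ^ n - q ^ (- n).
Definition co (n : int) : K := q ^ n + q ^ (- n).

Lemma qz0 (n : int) : q ^ n != 0. Proof. exact: expfz_neq0. Qed.

Lemma qzD (m n : int) : q ^ (m + n) = q ^ m * q ^ n.
Proof. exact: expfzDr. Qed.

Lemma qzN (m : int) : q ^ (- m) = (q ^ m)^-1.
Proof. by rewrite -invr_expz. Qed.

Lemma qz_eq1 (n : int) : q ^ n = 1 -> n = 0.
Proof.
case: n => [[|n]|n] // e.
  by have := q1 (ltn0Sn n); rewrite exprnP e eqxx.
move: e; rewrite NegzE qzN => /eqP; rewrite invr_eq1 => /eqP e.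
by have := q1 (ltn0Sn n); rewrite exprnP e eqxx.
Qed.

Lemma br_neq0 (n : int) : n != 0 -> br n != 0.
Proof.
apply: contraNneq => /eqP; rewrite subr_eq0 => /eqP e.
have /qz_eq1 : q ^ (n + n) = 1 by rewrite qzD {1}e qzN mulVf ?qz0.
by move=> ?; apply/eqP; lia.
Qed.

Lemma co_neq0 (n : int) : co n != 0.
Proof.
apply/eqP => /eqP; rewrite addr_eq0 => /eqP e.
have e2 : q ^ (n + n) = -1 by rewrite qzD {1}e qzN mulNr mulVf ?qz0.
have /qz_eq1 n0 : q ^ (n + n + (n + n)) = 1 by rewrite qzD e2 mulrNN mulr1.
have {}n0 : n = 0 by lia.
move: e2; rewrite n0 expr0z => /eqP; rewrite -subr_eq0 opprK -[_ + _]/(2%:R).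
by rewrite (negPf two0).
Qed.

Lemma chi_co (m : int) : chi q m = co (m + 1).
Proof. by rewrite /chi /co opprD. Qed.

Lemma chi_neq0 (m : int) : chi q m != 0.
Proof. by rewrite chi_co co_neq0. Qed.

Lemma chi_add (x y : int) : chi q (x + y) + chi q (x - y) = co y * co (x + 1).
Proof.
rewrite !chi_co /co !(opprD, qzD, qzN, opprK).
by field; rewrite ?qz0 ?q0.
Qed.

(** q^m + q^-m determines m up to sign, and chi is centred at -1. *)
Lemma chi_eq (m n : int) : chi q m = chi q n -> m = n \/ m + n + 2 = 0.
Proof.
move=> e.
have : (q ^ (m - n) - 1) * (q ^ (m + n + 1 + 1) - 1) = 0.
  have : (chi q m - chi q n) * (q * q ^ m) = 0 by rewrite e subrr mul0r.
  rewrite /chi !(opprD, qzD, qzN, opprK) => <-.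
  by rewrite expr1z; field; rewrite ?qz0 ?q0.
move/eqP; rewrite mulf_eq0 !subr_eq0 => /orP[] /eqP /qz_eq1 h; [left|right]; lia.
Qed.

Lemma chi_neq (m n : int) : m != n -> m + n + 2 != 0 -> chi q m - chi q n != 0.
Proof.
by move=> mn mn2; rewrite subr_eq0; apply/eqP => /chi_eq[] /eqP; rewrite ?(negPf mn) ?(negPf mn2).
Qed.

Lemma qpar_neq0 (p : int) : qpar q p != 0.
Proof. by rewrite /qpar mulf_neq0 ?qz0 // expfz_neq0 // oppr_eq0 oner_eq0. Qed.

Lemma qparS (a : int) : qpar q (a + 1) = - q ^ (a + a + 1 + 1) * qpar q a.
Proof.
rewrite /qpar (_ : (a + 1) * (a + 1 + 1) = (a + a + 1 + 1) + a * (a + 1)); last by ring.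
have n10 : (-1 : K) != 0 by rewrite oppr_eq0 oner_eq0.
by rewrite expfzDr // qzD expr1z; ring.
Qed.

Lemma qpar_sqr (a : nat) : qpar q a ^+ 2 = q ^+ (a * (a + 1) * 2).
Proof.
have e : (a : int) * (a + 1) = Posz (a * (a + 1))%N by lia.
rewrite /qpar e -!exprnP exprMn -exprM mulnC exprM sqrrN expr1n expr1n mul1r.
by rewrite -exprM.
Qed.

Lemma qpar_inj (a c : nat) : qpar q a = qpar q c -> a = c.
Proof.
move=> e; have e2 : q ^+ (a * (a + 1) * 2) = q ^+ (c * (c + 1) * 2).
  by rewrite -!qpar_sqr e.
have /qz_eq1 : q ^ ((Posz (a * (a + 1) * 2)) - (Posz (c * (c + 1) * 2))) = 1.
  by rewrite qzD qzN -!exprnP e2 mulfV // expf_neq0.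
by nia.
Qed.

End QuantumNumbers.

(** Over distinct nodes lam 0, ..., lam N, an element killed by the nodal
    polynomial behaves like a diagonal matrix with these eigenvalues. *)
Section Lagrange.
Variables (K : fieldType) (N : nat) (lam : nat -> K).

Definition lag (r : nat) : {poly K} :=
  \prod_(p < N.+1 | (p : nat) != r) ((lam r - lam p)^-1 *: ('X - (lam p)%:P)).

Definition nodal : {poly K} := \prod_(p < N.+1) ('X - (lam p)%:P).

Hypothesis lam_inj : forall a c, (a <= N)%N -> (c <= N)%N -> lam a = lam c -> a = c.

Lemma lagE r p : (p <= N)%N -> (lag r).[lam p] = (p == r)%:R.
Proof.
move=> pN; rewrite /lag horner_prod.
have [<-|npr] := eqVneq p r; last first.
  have pE : (inord p : 'I_N.+1) = p :> nat by rewrite inordK.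
  by rewrite (bigD1 (inord p)) ?pE //= hornerZ !hornerE ?pE subrr mulr0 mul0r.
apply: big1 => i ir; rewrite hornerZ !hornerE mulVf // subr_eq0.
by apply: contra_neq ir => /lam_inj -> //; rewrite -ltnS.
Qed.

Lemma nodal_dvd (f : {poly K}) :
  (forall p, (p <= N)%N -> f.[lam p] = 0) -> nodal %| f.
Proof.
move=> f0.
have -> : nodal = \prod_(z <- [seq lam p | p <- iota 0 N.+1]) ('X - z%:P).
  by rewrite big_map -{1}[N.+1]subn0 -[iota _ _]/(index_iota 0 N.+1) big_mkord.
apply: uniq_roots_dvdp.
  by apply/allP => z /mapP[p]; rewrite mem_iota ltnS => /f0 e ->; rewrite rootE e.
rewrite uniq_rootsE map_inj_in_uniq ?iota_uniq // => a c.
by rewrite !mem_iota !add0n !ltnS /=; apply: lam_inj.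
Qed.

End Lagrange.

Lemma pzinvE (A : pzRingType) (x y : A) : x * y = 1 -> y * x = 1 -> pzinv x = y.
Proof.
move=> xy yx; have : two_sided_inverse x (pzinv x).
  by rewrite /pzinv; apply: (@xgetPex _ 0 (two_sided_inverse x)); exists y.
by case=> _ e; rewrite -[LHS]mulr1 -xy mulrA e mul1r.
Qed.

(** * The defining relations of the braid algebras *)

Section Elements.
Variables (K : fieldType) (q : K) (N : nat).
Hypothesis gq : generic q.

Definition qp (r : nat) : K := qpar q r.
Definition th (r : nat) : K := chi q (2 * r)%N.

Definition sum_lag (lam : nat -> K) (f : nat -> K) : {poly K} :=
  \sum_(r < N.+1) f r *: lag N lam r.

Lemma qp_inj a c : (a <= N)%N -> (c <= N)%N -> qp a = qp c -> a = c.
Proof. by move=> _ _; apply: qpar_inj. Qed.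

Lemma th_neq a c : a <> c -> th a - th c != 0.
Proof. by move=> ac; apply: chi_neq => //; lia. Qed.

Lemma th_inj a c : (a <= N)%N -> (c <= N)%N -> th a = th c -> a = c.
Proof. by move=> _ _ e; have [|/eqP/th_neq] := eqVneq a c => //; rewrite e subrr eqxx. Qed.

Lemma sum_lagE lam f p :
  (forall a c, (a <= N)%N -> (c <= N)%N -> lam a = lam c -> a = c) ->
  (p <= N)%N -> (sum_lag lam f).[lam p] = f p.
Proof.
move=> lam_inj pN; rewrite /sum_lag horner_sum.
have pE : (inord p : 'I_N.+1) = p :> nat by rewrite inordK.
rewrite (bigD1 (inord p)) //= hornerZ lagE // pE eqxx mulr1 big1 ?addr0 // => i ip.
rewrite hornerZ lagE // (_ : p == i = false) ?mulr0 //.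
by apply: contra_neqF ip => /eqP pi; apply/val_inj; rewrite /= pE.
Qed.

Section InQuotient.
Variable S : set (freeAlg K bool).
Local Notation A := (quotAlg S).

Lemma idemE (x : A) r : idem q N x r = evq x (lag N qp r).
Proof.
rewrite /idem /lag rmorph_prod /=; apply: eq_bigr => p _.
by rewrite evqZ rmorphB /= evqX evqC.
Qed.

Lemma geltE (x : A) : gelt q N x = evq x (sum_lag qp th).
Proof.
rewrite /gelt /sum_lag rmorph_sum /=; apply: eq_bigr => r _.
by rewrite evqZ idemE.
Qed.

(** Polynomials in an element with nodal relation only depend on their values
    at the nodes. *)
Lemma evq_agree (lam : nat -> K) (x : A) (f g : {poly K}) :
  (forall a c, (a <= N)%N -> (c <= N)%N -> lam a = lam c -> a = c) ->
  evq x (nodal N lam) = 0 ->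
  (forall p, (p <= N)%N -> f.[lam p] = g.[lam p]) -> evq x f = evq x g.
Proof.
move=> lam_inj x0 fg; apply/eqP; rewrite -subr_eq0 -rmorphB; apply/eqP.
have /dvdpP[h ->] : nodal N lam %| f - g.
  by apply: nodal_dvd => // p pN; rewrite hornerD hornerN fg // subrr.
by rewrite rmorphM /= x0 mulr0.
Qed.

Hypothesis BS : forall x, B3_presentation q N x -> S x.
Local Notation s1 := (sigma1 S).
Local Notation s2 := (sigma2 S).

Lemma braid : s1 * s2 * s1 = s2 * s1 * s2.
Proof.
apply/eqP; rewrite -subr_eq0; apply/eqP.
rewrite /sigma1 /sigma2 -!rmorphM -rmorphB; apply: toQuot_rel; apply: BS.
by apply: Or31.
Qed.

Lemma nodalE (i : bool) :
  evq (toQuot S (gen K i)) (nodal N qp) =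
  toQuot S (\prod_(p < N.+1) (gen K i - qp p *: (1 : freeAlg K bool))).
Proof.
rewrite /nodal !rmorph_prod /=; apply: eq_bigr => p _.
by rewrite !rmorphB /= evqX evqC toQuotZE rmorph1.
Qed.

Lemma nodal_s1 : evq s1 (nodal N qp) = 0.
Proof. by rewrite nodalE; apply: toQuot_rel; apply: BS; apply: Or32. Qed.

Lemma nodal_s2 : evq s2 (nodal N qp) = 0.
Proof. by rewrite nodalE; apply: toQuot_rel; apply: BS; apply: Or33. Qed.

Definition evq_qp (x : A) x0 f g := @evq_agree qp x f g qp_inj x0.

Definition iota_poly := sum_lag qp (fun r => (qp r)^-1).

Lemma qp_neq0 r : qp r != 0. Proof. exact: qpar_neq0. Qed.

Lemma mul_inv (x : A) : evq x (nodal N qp) = 0 -> x * evq x iota_poly = 1.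
Proof.
move=> x0; rewrite -{1}(evqX x) -rmorphM -(rmorph1 (evq x)).
apply: evq_qp => // p pN; rewrite hornerM hornerX (sum_lagE _ qp_inj) //.
by rewrite hornerE mulfV // qp_neq0.
Qed.

Lemma inv_mul (x : A) : evq x (nodal N qp) = 0 -> evq x iota_poly * x = 1.
Proof. by move=> x0; rewrite (evq_comm _ (erefl (x * x))) mul_inv. Qed.

(** sigma_i is invertible because no node vanishes, and its inverse is a
    polynomial in it. *)
Lemma pzinv_s (x : A) : evq x (nodal N qp) = 0 -> pzinv x = evq x iota_poly.
Proof. by move=> x0; apply: pzinvE; [exact: mul_inv|exact: inv_mul]. Qed.

End InQuotient.

(** The elements of B3, AWB3 and As are given by the same formulas, so the
    projections between these algebras carry each one to its namesake; this turns
    the lifted relations of the presentation into identities in As. *)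
Section Transfer.
Variables S S' : set (freeAlg K bool).
Hypothesis SS' : forall x, S x -> S' x.
Hypothesis BS : forall x, B3_presentation q N x -> S x.

Local Notation A := (@quotAlg K bool).
Local Notation h := (qlift (S := S) (@toQuot K bool S')).

Let hS x : S x -> toQuot S' x = 0. Proof. by move/SS'/toQuot_rel. Qed.

HB.instance Definition _ := GRing.isZmodMorphism.Build (quotAlg S) (quotAlg S')
  h (qlift_is_zmod_morphism hS).
HB.instance Definition _ := GRing.isMonoidMorphism.Build (quotAlg S) (quotAlg S')
  h (qlift_is_monoid_morphism hS).

Lemma transB x y : h (x - y) = h x - h y. Proof. exact: rmorphB. Qed.
Lemma transD x y : h (x + y) = h x + h y. Proof. exact: rmorphD. Qed.
Lemma transM x y : h (x * y) = h x * h y. Proof. exact: rmorphM. Qed.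
Lemma trans1 : h 1 = 1. Proof. exact: rmorph1. Qed.

Lemma transZ k x : h (k *: x) = k *: h x.
Proof. by rewrite -[x]ofQuotK -toQuotZE !(qliftE hS) /= toQuotZE. Qed.

Lemma trans_evq x p : h (evq x p) = evq (h x) p.
Proof.
elim/poly_ind: p => [|p c IH]; first by rewrite !rmorph0.
by rewrite !rmorphD !rmorphM /= !evqX !evqC IH transZ trans1.
Qed.

Lemma trans_sigma1 : h (sigma1 S) = sigma1 S'. Proof. exact: qliftE hS _. Qed.
Lemma trans_sigma2 : h (sigma2 S) = sigma2 S'. Proof. exact: qliftE hS _. Qed.

Lemma trans_gelt x : h (gelt q N x) = gelt q N (h x).
Proof. by rewrite !geltE trans_evq. Qed.

Lemma trans_idem x r : h (idem q N x r) = idem q N (h x) r.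
Proof. by rewrite !idemE trans_evq. Qed.

Lemma trans_pzinv : h (pzinv (sigma1 S)) = pzinv (sigma1 S').
Proof. by rewrite !pzinv_s ?trans_evq ?trans_sigma1 //;
  apply: nodal_s1 => // x Bx; apply/SS'/BS. Qed.

Let transE := (transB, transD, transM, transZ, trans1).

(* Once the atoms are variables, a failing match is detected at once; otherwise
   unification unfolds the quotient operations. *)
Let atoms (P : A S -> A S -> A S -> A S -> A S' -> A S' -> A S' -> A S' -> Prop) :
  (forall x y s i, P x y s i (h x) (h y) (h s) (h i)) ->
  P (gelt q N (sigma1 S)) (gelt q N (sigma2 S)) (sigma1 S) (pzinv (sigma1 S))
    (gelt q N (sigma1 S')) (gelt q N (sigma2 S')) (sigma1 S') (pzinv (sigma1 S')).
Proof.
by rewrite -trans_pzinv -{1}trans_sigma1 -trans_sigma2 -!trans_gelt -trans_sigma1; apply.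
Qed.

Lemma trans_aw1 : h (aw1 q N S) = aw1 q N S'.
Proof.
apply: (atoms (P := fun x y s i x' y' s' i' => h (_ *: qcomm q x y + s * y * i) =
  _ *: qcomm q x' y' + s' * y' * i')) => x y s i.
by rewrite /qcomm !transE.
Qed.

Lemma trans_aw2 : h (aw2 q N S) = aw2 q N S'.
Proof.
apply: (atoms (P := fun x y s i x' y' s' i' => h (_ *: qcomm q y (s * y * i) + x) =
  _ *: qcomm q y' (s' * y' * i') + x')) => x y s i.
by rewrite /qcomm !transE.
Qed.

Lemma trans_aw3 : h (aw3 q N S) = aw3 q N S'.
Proof.
apply: (atoms (P := fun x y s i x' y' s' i' => h (_ *: qcomm q (s * y * i) x + y) =
  _ *: qcomm q (s' * y' * i') x' + y')) => x y s i.
by rewrite /qcomm !transE.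
Qed.

Lemma trans_kappa : h (kappa q N S) = kappa q N S'.
Proof. by rewrite /kappa transB !transZ trans_aw1 trans1. Qed.

Lemma trans_Omega : h (Omega q N S) = Omega q N S'.
Proof.
rewrite /Omega -[kappa q N S']trans_kappa; move: (kappa q N S) => k; rewrite !expr2.
apply: (atoms (P := fun x y s i x' y' s' i' =>
  h (_ * (q *: x + q^-1 *: y + q *: (s * y * i)) - _ *: (x * x) - _ *: (y * y)
     - _ *: (s * (y * y) * i) - q *: (x * y * s * y * i)) =
  _ * (q *: x' + q^-1 *: y' + q *: (s' * y' * i')) - _ *: (x' * x') - _ *: (y' * y')
     - _ *: (s' * (y' * y') * i') - q *: (x' * y' * s' * y' * i'))) => x y s i.
by rewrite !transE.
Qed.

End Transfer.

Section Relations.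

Lemma B3_AWB3 x : B3_presentation q N x -> AWB3_presentation q N x.
Proof. by move=> ?; left. Qed.

Lemma AWB3_As x : AWB3_presentation q N x -> As_presentation q N x.
Proof. by move=> ?; left. Qed.

Lemma B3_As x : B3_presentation q N x -> As_presentation q N x.
Proof. by move/B3_AWB3/AWB3_As. Qed.

Local Notation S := (As_presentation q N).
Local Notation A := (quotAlg S).

Lemma As_AWB3_rel (x : quotAlg (B3_presentation q N)) :
  AWB3_relations q N x -> qlift (@toQuot K bool S) x = 0.
Proof.
by move=> Rx; apply: toQuot_rel; left; right; rewrite /preimage /= ofQuotK.
Qed.

Lemma As_As_rel (x : quotAlg (AWB3_presentation q N)) :
  As_relations q N x -> qlift (@toQuot K bool S) x = 0.
Proof.
by move=> Rx; apply: toQuot_rel; right; rewrite /preimage /= ofQuotK.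
Qed.

Lemma As_aw12 : aw1 q N S = aw2 q N S.
Proof.
apply/eqP; rewrite -subr_eq0; apply/eqP.
rewrite -(trans_aw1 B3_As) // -(trans_aw2 B3_As) // -(transB B3_As).
by apply: As_AWB3_rel; apply: Or31.
Qed.

Lemma As_aw13 : aw1 q N S = aw3 q N S.
Proof.
apply/eqP; rewrite -subr_eq0; apply/eqP.
rewrite -(trans_aw1 B3_As) // -(trans_aw3 B3_As) // -(transB B3_As).
by apply: As_AWB3_rel; apply: Or32.
Qed.

Lemma As_aw1C (y : A) : aw1 q N S * y = y * aw1 q N S.
Proof.
apply/eqP; rewrite -subr_eq0; apply/eqP.
rewrite -[y]ofQuotK -(qliftE (S := B3_presentation q N) (f := @toQuot K bool S)); last first.
  by move=> z /B3_As /toQuot_rel.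
rewrite -(trans_aw1 B3_As) // -!(transM B3_As) -(transB B3_As).
by apply: As_AWB3_rel; apply: Or33; eexists.
Qed.

Lemma As_idem : let e := idem q N (sigma1 S) 0 in
  e * gelt q N (sigma2 S) * e = (chi q N ^+ 2 / chi q 0) *: e.
Proof.
apply/eqP; rewrite -subr_eq0; apply/eqP => /=.
rewrite -(trans_sigma1 AWB3_As) -(trans_sigma2 AWB3_As) // -!(trans_idem AWB3_As).
rewrite -!(trans_gelt AWB3_As) -!(transZ AWB3_As) -!(transM AWB3_As) -(transB AWB3_As).
by apply: As_As_rel; right.
Qed.

Lemma As_Omega : let k := kappa q N S in
  Omega q N S = k * (k + chi q N ^+ 3 *: (1 : A)) +
    (3 * chi q N ^+ 2 - chi q 0 ^+ 2) *: (1 : A).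
Proof.
apply/eqP; rewrite -subr_eq0; apply/eqP => /=.
rewrite -(trans_Omega AWB3_As) ?(trans_kappa AWB3_As); try exact: B3_AWB3.
rewrite -(trans_kappa AWB3_As); last exact: B3_AWB3.
rewrite -(trans1 AWB3_As) -!(transZ AWB3_As)
  -!(transD AWB3_As) -(transM AWB3_As) -(transD AWB3_As) -(transB AWB3_As).
by apply: As_As_rel; left.
Qed.

End Relations.
End Elements.

(** * Corners of the first and third relations *)

Section Chain.
Variables (K : fieldType) (q : K) (N : nat).
Hypothesis gq : generic q.
Let q0 : q != 0. Proof. by case: gq. Qed.

(** K is infinite, as it contains all powers of q; polynomial identities may
    thus be checked by field at each point. *)
Lemma poly_ext (p p' : {poly K}) : (forall k, p.[k] = p'.[k]) -> p = p'.
Proof.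
move=> pp'; apply/eqP; rewrite -subr_eq0; apply/negPn/negP => d0.
pose s := [seq q ^+ i | i <- iota 0 (size (p - p'))].
suff: (size s < size (p - p')%R)%N by rewrite size_map size_iota ltnn.
apply: max_poly_roots => //.
  by apply/allP => z _; rewrite rootE !hornerE pp' subrr.
rewrite map_inj_in_uniq ?iota_uniq // => i j _ _ e.
have /qz_eq1 : q ^ (i%:Z - j%:Z) = 1.
  by rewrite qzD // qzN // -!exprnP e mulfV // expf_neq0.
by move=> h; by have := h gq; lia.
Qed.

Definition chs : K := chi q N.
Definition hw : K := (q ^+ 2 - q ^- 2)^-1.

(** Polynomials in kappa: zeta is the common value of the three Askey-Wilson
    expressions, tpol a is the diagonal entry of g2 at e_1^(a), and upol a is the
    weight of the loop from e_1^(a) through e_1^(a+1) and back. The latter vanishes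
    at kappa = chi_(s+a+1) and kappa = chi_(s-a-1), which are up_root a.+1 and
    dn_root a.+1. *)
Definition zeta : {poly K} := (chs / (q + q^-1)) *: ('X + chs%:P).
Definition tpol (a : nat) : {poly K} := (chs / (chi q 0 + th q a)) *: ('X + chs%:P).
Definition ucst (a : nat) : K :=
  - (br q (N%:Z - a%:Z) * br q (N%:Z + a%:Z + 1 + 1) /
     (br q (a%:Z + a%:Z + 1) * br q (a%:Z + a%:Z + 1 + 1 + 1) *
      co q (a%:Z + 1) ^+ 2)).
Definition up_root (b : nat) : K := chi q (N%:Z + b%:Z + b%:Z).
Definition dn_root (b : nat) : K := chi q (N%:Z - b%:Z - b%:Z).
Definition rpol (b : nat) : {poly K} := ('X - (up_root b)%:P) * ('X - (dn_root b)%:P).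
Definition upol (a : nat) : {poly K} := ucst a *: rpol a.+1.

(** Determinant of the two equations for a corner e_1^(a) g2 e_1^(c) off the
    diagonal: it vanishes only for neighbours. *)
Lemma w_det (a c : int) :
  (q * chi q (a + a) - q^-1 * chi q (c + c)) * (q * chi q (c + c) - q^-1 * chi q (a + a))
  - (q ^+ 2 - q ^- 2) ^+ 2 =
  - (br q (a - c - 1) * br q (a - c + 1) * br q (a + c) * br q (a + c + 1 + 1)).
Proof.
rewrite /chi /br !(opprD, opprK, qzD gq, qzN, expr1z).
by field; rewrite ?qz0 ?q0.
Qed.

Local Notation qa a := (q ^ a%:Z).

Lemma qaS a : qa a.+1 = qa a * q.
Proof. by rewrite -addn1 PoszD (qzD gq) expr1z. Qed.

Lemma qp_ratio a : qp q a.+1 / qp q a = - (qa a * qa a * q * q).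
Proof.
have -> : qp q a.+1 = - q ^ (a%:Z + a%:Z + 1 + 1) * qp q a.
  by rewrite /qp -qparS // -addn1 PoszD.
by rewrite mulfK ?(qp_neq0 gq) // !(qzD gq) expr1z.
Qed.

Lemma qp_ratioV a : qp q a / qp q a.+1 = - (qa a * qa a * q * q)^-1.
Proof. by rewrite -[LHS]invf_div qp_ratio invrN. Qed.

(** Reasoning in an arbitrary quotient S that satisfies these relations keeps the
    presentation of As from being unfolded. *)
Record As_quotient (S : set (freeAlg K bool)) : Prop := AsQuotient {
  quot_B3 : forall x, B3_presentation q N x -> S x;
  quot_aw12 : aw1 q N S = aw2 q N S;
  quot_aw13 : aw1 q N S = aw3 q N S;
  quot_aw1C : forall y, aw1 q N S * y = y * aw1 q N S;
  quot_idem : let e := idem q N (sigma1 S) 0 in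
    e * gelt q N (sigma2 S) * e = (chi q N ^+ 2 / chi q 0) *: e;
  quot_Omega : let k := kappa q N S in
    Omega q N S = k * (k + chi q N ^+ 3 *: (1 : quotAlg S)) +
    (3 * chi q N ^+ 2 - chi q 0 ^+ 2) *: (1 : quotAlg S) }.

Lemma As_is_quotient : As_quotient (As_presentation q N).
Proof.
split; [exact: B3_As | exact: As_aw12 | exact: As_aw13 | exact: As_aw1C
  | exact: As_idem | exact: As_Omega].
Qed.

Section Algebra.
Variable S : set (freeAlg K bool).
Local Notation A := (quotAlg S).
Local Notation s1 := (sigma1 S).
Local Notation s2 := (sigma2 S).
Local Notation g1 := (gelt q N s1).
Local Notation g2 := (gelt q N s2).
Local Notation g13 := (s1 * g2 * pzinv s1).
Local Notation kap := (kappa q N S).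
Local Notation E := (idem q N s1).
Hypothesis rS : As_quotient S.
Let BS := quot_B3 rS.
Let R13 := quot_aw13 rS.
Let R1C := quot_aw1C rS.

Local Notation kp := (evq kap).
Local Opaque gelt idem pzinv sigma1 sigma2 evq toQuot.

Lemma q2q2 : q ^+ 2 - q ^- 2 != 0.
Proof. have n2 : (2%N : int) != 0 by []. by have := br_neq0 gq n2; rewrite /br qzN -exprnP. Qed.

Lemma chs0 : chs != 0. Proof. exact: chi_neq0. Qed.
Lemma qq0 : q + q^-1 != 0.
Proof. by have := chi_neq0 gq 0; rewrite /chi sub0r add0r qzN expr1z. Qed.

Lemma chi0E : chi q 0 = q + q^-1.
Proof. by rewrite /chi sub0r add0r qzN expr1z. Qed.

Lemma aw1E : aw1 q N S = kp zeta.
Proof.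
rewrite /zeta evqZ rmorphD /= evqX evqC /kappa subrK -/chs.
by rewrite scalerA mulrA divfK ?qq0 // mulfV ?chs0 // scale1r.
Qed.

Lemma kapC (y : A) : kap * y = y * kap.
Proof. by rewrite /kappa mulrBl mulrBr !quotZl !quotZr R1C mul1r mulr1. Qed.

Local Opaque kappa.

Lemma kpC p (y : A) : kp p * y = y * kp p.
Proof. by apply: evq_comm; apply: kapC. Qed.

Lemma kpZ c p : kp (c *: p) = c *: kp p. Proof. exact: evqZ. Qed.
Lemma E_poly f a : evq s1 f * E a = f.[qp q a] *: E a.
Proof.
rewrite idemE -rmorphM -evqZ; apply: (evq_qp gq (nodal_s1 BS)) => p pN.
rewrite hornerM hornerZ (lagE (qp_inj gq)) //.
by case: eqP => [->|_]; rewrite ?mulr1 ?mulr0.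
Qed.

Lemma poly_E f a : E a * evq s1 f = f.[qp q a] *: E a.
Proof.
by rewrite -E_poly; apply/esym/evq_comm; rewrite idemE; apply/esym/evq_comm.
Qed.

Lemma EE a : E a * E a = E a.
Proof.
rewrite !idemE -rmorphM; apply: (evq_qp gq (nodal_s1 BS)) => p pN.
rewrite hornerM !(lagE (qp_inj gq)) //.
by case: eqP; rewrite ?mulr1 ?mulr0.
Qed.

Lemma EE0 a c : a <> c -> E a * E c = 0.
Proof.
move=> ac; rewrite !idemE -rmorphM -(rmorph0 (evq s1)).
apply: (evq_qp gq (nodal_s1 BS)) => p pN.
rewrite hornerM !(lagE (qp_inj gq)) // horner0.
by case: eqP => [->|_]; rewrite ?mul0r //; case: eqP => // _; rewrite mulr0.
Qed.

Lemma E_gt a : (N < a)%N -> E a = 0.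
Proof.
move=> aN; rewrite idemE -(rmorph0 (evq s1)).
apply: (evq_qp gq (nodal_s1 BS)) => p pN.
rewrite (lagE (qp_inj gq)) // horner0; case: eqP => // pa.
by move: pN; rewrite pa leqNgt aN.
Qed.

Lemma sumE : \sum_(a < N.+1) E a = 1.
Proof.
under eq_bigr do rewrite idemE; rewrite -rmorph_sum -(rmorph1 (evq s1)).
apply: (evq_qp gq (nodal_s1 BS)) => p pN.
have := @sum_lagE _ N (qp q) (fun=> 1) p (qp_inj gq) pN.
rewrite /sum_lag !horner_sum hornerC => <-.
by apply: eq_bigr => i _; rewrite scale1r.
Qed.

Lemma g1E a : g1 * E a = th q a *: E a.
Proof.
have [aN|aN] := leqP a N; last by rewrite E_gt // mulr0 scaler0.
by rewrite geltE E_poly (sum_lagE _ (qp_inj gq)).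
Qed.

Lemma Eg1 a : E a * g1 = th q a *: E a.
Proof.
have [aN|aN] := leqP a N; last by rewrite E_gt // mul0r scaler0.
by rewrite geltE poly_E (sum_lagE _ (qp_inj gq)).
Qed.

Lemma Es1 a : E a * s1 = qp q a *: E a.
Proof. by rewrite -{2}(evqX s1) poly_E hornerX. Qed.

Lemma s1E a : s1 * E a = qp q a *: E a.
Proof. by rewrite -{1}(evqX s1) E_poly hornerX. Qed.

Lemma s1iE a : pzinv s1 * E a = (qp q a)^-1 *: E a.
Proof.
have [aN|aN] := leqP a N; last by rewrite E_gt // mulr0 scaler0.
by rewrite (pzinv_s gq (nodal_s1 BS)) E_poly (sum_lagE _ (qp_inj gq)).
Qed.

Definition G (a c : nat) : A := E a * g2 * E c.

Lemma Eg13E a c : E a * g13 * E c = (qp q a / qp q c) *: G a c.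
Proof.
rewrite !mulrA Es1 -!mulrA s1iE !quotZr !quotZl scalerA mulrC.
by congr (_ *: _); rewrite /G !mulrA.
Qed.

(** The first Askey-Wilson relation between e_1^(a) and e_1^(c); g1 and sigma_1
    act by scalars on both sides, and a single unknown G a c remains. *)
Lemma Gdiag_eq a c : E a * kp zeta * E c =
  (hw * (q * th q a - q^-1 * th q c) + qp q a / qp q c) *: G a c.
Proof.
rewrite -aw1E /aw1 mulrDr mulrDl Eg13E scalerDl; congr (_ + _).
rewrite quotZr quotZl -/hw /qcomm mulrBr mulrBl !quotZr !quotZl.
rewrite !mulrA Eg1 -[_ * g1 * E c]mulrA g1E !quotZr !quotZl !scalerA -scalerBl.
by rewrite scalerA.
Qed.

(** The same corner of the third relation. *)
Lemma Gdiag_eq3 a c : E a * kp zeta * E c =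
  (hw * (qp q a / qp q c) * (q * th q c - q^-1 * th q a) + 1) *: G a c.
Proof.
rewrite -aw1E R13 /aw3 mulrDr mulrDl scalerDl scale1r; congr (_ + _).
rewrite quotZr quotZl -/hw /qcomm mulrBr mulrBl !quotZr !quotZl.
rewrite [E a * (g13 * g1)]mulrA -[_ * g1 * E c]mulrA g1E quotZr Eg13E.
rewrite [E a * (g1 * g13)]mulrA Eg1 !quotZl Eg13E !scalerA -scalerBl scalerA.
by congr (_ *: _); ring.
Qed.

Lemma G_far a c : (a.+1 < c)%N || (c.+1 < a)%N -> G a c = 0.
Proof.
move=> far; have ac : a <> c by lia.
have Z0 : E a * kp zeta * E c = 0 by rewrite -kpC -mulrA EE0 ?mulr0.
have e1 := Gdiag_eq a c; have e3 := Gdiag_eq3 a c; rewrite Z0 in e1 e3.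
pose D := (q * th q a - q^-1 * th q c) * (q * th q c - q^-1 * th q a)
  - (q ^+ 2 - q ^- 2) ^+ 2.
have D0 : D != 0.
  have := w_det a%:Z c%:Z; rewrite -!PoszD !addnn -!mul2n -/(th q a) -/(th q c) -/D => ->.
  by rewrite oppr_eq0 !mulf_neq0 // (br_neq0 gq) //; lia.
have {e1 e3} : (hw ^+ 2 * D) *: G a c = 0.
  have -> : hw ^+ 2 * D = hw * (q * th q c - q^-1 * th q a) *
     (hw * (q * th q a - q^-1 * th q c) + qp q a / qp q c) -
     (hw * (qp q a / qp q c) * (q * th q c - q^-1 * th q a) + 1).
    rewrite /D /hw.
    have := q2q2; move: (q ^+ 2 - q ^- 2) => v v0.
    by field; rewrite v0 q0 qp_neq0.
  by rewrite scalerBl -scalerA -e1 -e3 scaler0 subr0.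
move/(congr1 (fun x => (hw ^+ 2 * D)^-1 *: x)); rewrite scaler0 scalerA mulVf ?scale1r //.
by rewrite mulf_neq0 // expf_neq0 // invr_eq0 q2q2.
Qed.

Lemma th_chi0 a : chi q 0 + th q a != 0.
Proof.
have := chi_add gq a%:Z a%:Z; rewrite subrr addrC /th -PoszD addnn -mul2n => ->.
by rewrite mulf_neq0 ?(co_neq0 gq).
Qed.

Lemma G_diag a : G a a = kp (tpol a) * E a.
Proof.
have := Gdiag_eq a a; rewrite -kpC -mulrA EE mulfV ?qp_neq0 // => e.
have -> : tpol a = ((chi q 0) / (chi q 0 + th q a)) *: zeta.
  by rewrite /tpol /zeta scalerA -chi0E; congr (_ *: _); field; rewrite th_chi0 chi_neq0.
rewrite kpZ quotZl e scalerA -[LHS]scale1r; congr (_ *: _).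
have := th_chi0 a; rewrite chi0E /hw; move: (th q a) => t t0.
have v0 : q - q^-1 != 0 by have := br_neq0 gq (oner_neq0 int); rewrite /br qzN expr1z.
have -> : q ^+ 2 - q ^- 2 = (q - q^-1) * (q + q^-1) by field.
have := qq0; move: (q + q^-1) t0 => u t0 u0.
have -> : q * t - q^-1 * t = (q - q^-1) * t by ring.
by move: (q - q^-1) v0 => v v0; field; rewrite v0 t0 u0.
Qed.

End Algebra.
End Chain.

(** * Tridiagonal elements and their loops *)

(** In use, L is the ring of polynomials in kappa and E a is e_1^(a). Everything
    that does not depend on the actual weights is proved from these axioms. *)
Record tridiagonal (L : comNzRingType) (A : pzRingType) (kp : {rmorphism L -> A})
    (N : nat) (E : nat -> A) (g : A) (t : nat -> L) : Prop := Tridiagonal {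
  tri_central : forall p y, kp p * y = y * kp p;
  tri_idem : forall a, E a * E a = E a;
  tri_ortho : forall a c, a <> c -> E a * E c = 0;
  tri_out : forall a, (N < a)%N -> E a = 0;
  tri_sum : \sum_(a < N.+1) E a = 1;
  tri_far : forall a c, (a.+1 < c)%N || (c.+1 < a)%N -> E a * g * E c = 0;
  tri_diag : forall a, E a * g * E a = kp (t a) * E a }.

Section Tridiagonal.
Variables (L : comNzRingType) (A : pzRingType) (kp : {rmorphism L -> A}).
Variables (N : nat) (E : nat -> A) (g : A) (t : nat -> L).
Hypothesis tri : tridiagonal kp N E g t.
Let kpC := tri_central tri.
Let EE := tri_idem tri.
Let E_gt := tri_out tri.
Let sumE := tri_sum tri.
Let G_far := tri_far tri.
Let G_diag := tri_diag tri.

Lemma kpMM p p' (x y : A) : kp p * x * (kp p' * y) = kp (p * p') * (x * y).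
Proof. by rewrite rmorphM -!mulrA [x * (_ * y)]mulrA -kpC !mulrA. Qed.

Lemma kpR p (x y : A) : x * (kp p * y) = kp p * (x * y).
Proof. by rewrite mulrA -kpC mulrA. Qed.

Definition pr (a : nat) : A := if a is b.+1 then E b else 0.

(** Only the indices a-1, a and a+1 contribute to such a sum. *)
Lemma near_sum (F : nat -> A) a : (forall b, (N < b)%N -> F b = 0) ->
  (forall b, (a.+1 < b)%N || (b.+1 < a)%N -> F b = 0) ->
  \sum_(b < N.+1) F b = (if a is a'.+1 then F a' else 0) + F a + F a.+1.
Proof.
move=> FN Fa; rewrite -(big_mkord xpredT F).
have far m n : (forall b, (m <= b)%N -> F b = 0) -> (m <= n)%N ->
    \sum_(0 <= b < n) F b = \sum_(0 <= b < m) F b.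
  move=> F0 mn; rewrite (big_cat_nat (n := m)) //= [X in _ + X]big1_seq ?addr0 // => b.
  by rewrite mem_index_iota => /andP[_ /andP[/F0]].
rewrite -(far N.+1 (a.+2 + N)%N) //; last by lia.
rewrite (far a.+2) //; [|by move=> b ab; apply: Fa; rewrite ab|by lia].
rewrite !big_nat_recr //=; congr (_ + _ + _).
case: a Fa {far} => [|a] Fa; first by rewrite big_nil.
rewrite big_nat_recr //= big1_seq ?add0r // => b.
by rewrite mem_index_iota => /andP[_ /= ba]; apply: Fa; lia.
Qed.

Lemma Eg_split a : E a * g = E a * g * pr a + E a * g * E a + E a * g * E a.+1.
Proof.
rewrite -[LHS]mulr1 -sumE mulr_sumr (@near_sum (fun b => E a * g * E b) a).
- by case: a => [|a] /=; rewrite ?mulr0.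
- by move=> b bN; rewrite (E_gt bN) mulr0.
- exact: G_far.
Qed.

Lemma gE_split a : g * E a = pr a * g * E a + E a * g * E a + E a.+1 * g * E a.
Proof.
rewrite -[LHS]mul1r -sumE mulr_suml.
under eq_bigr do rewrite mulrA.
rewrite (@near_sum (fun b => E b * g * E a) a).
- by case: a => [|a] /=; rewrite ?mul0r ?mul0r.
- by move=> b bN; rewrite (E_gt bN) !mul0r.
- by move=> b ?; apply: G_far; rewrite orbC.
Qed.

(** The loops at a through a+1 and through a-1. *)
Definition Wp a := E a * g * E a.+1 * g * E a.
Definition Wm a := E a * g * pr a * g * E a.

Lemma Tdiag a : E a * g * E a * g * E a = kp (t a ^+ 2) * E a.
Proof.
have -> : E a * g * E a * g * E a = (E a * g * E a) * (E a * g * E a).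
  by rewrite !mulrA -[E a * g * E a * E a]mulrA EE.
by rewrite G_diag kpMM EE -expr2.
Qed.

Lemma gg_diag a : E a * (g * g) * E a = Wm a + kp (t a ^+ 2) * E a + Wp a.
Proof. by rewrite mulrA {1}Eg_split !mulrDl Tdiag. Qed.

Lemma sandwich_gl a x : E a * (g * x) * E a =
  E a * g * (pr a * x * E a) + E a * g * (E a * x * E a)
  + E a * g * (E a.+1 * x * E a).
Proof. by rewrite mulrA {1}Eg_split 2!mulrDl 2!mulrDl !mulrA. Qed.

Lemma sandwich_gr a x : E a * (x * g) * E a =
  (E a * x * pr a) * (g * E a) + (E a * x * E a) * (g * E a)
  + (E a * x * E a.+1) * (g * E a).
Proof. by rewrite -!mulrA {1}gE_split 2!mulrDr 2!mulrDr !mulrA. Qed.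

(** Each of two relations, compressed by E a on both sides, is a linear equation
    between Wp a, Wm a and E a; al, ali, be and bei are the ratios by which
    conjugation by sigma_1 rescales the neighbouring corners of g. *)
Variables (g1 g13 h : A) (th : nat -> L) (al be ali bei : nat -> L) (a : nat).
Hypotheses (dn13 : pr a * g13 * E a = kp (be a) * (pr a * g * E a))
  (dn13V : E a * g13 * pr a = kp (bei a) * (E a * g * pr a))
  (up13 : E a.+1 * g13 * E a = kp (al a) * (E a.+1 * g * E a))
  (up13V : E a * g13 * E a.+1 = kp (ali a) * (E a * g * E a.+1))
  (diag13 : E a * g13 * E a = E a * g * E a)
  (hE : E a * h * E a = E a * (g * g) * E a)
  (g1E : g1 * E a = kp (th a) * E a) (Eg1 : E a * g1 = kp (th a) * E a).

Definition loops (x y z : L) : A := kp x * Wp a + kp y * Wm a + kp z * E a.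

Lemma loopsD x y z x' y' z' :
  loops x y z + loops x' y' z' = loops (x + x') (y + y') (z + z').
Proof. by rewrite /loops !rmorphD !mulrDl addrACA; congr (_ + _); rewrite addrACA. Qed.

Lemma loopsZ p x y z : kp p * loops x y z = loops (p * x) (p * y) (p * z).
Proof. by rewrite /loops !mulrDr !rmorphM !mulrA. Qed.

Lemma loopsN x y z : - loops x y z = loops (- x) (- y) (- z).
Proof. by rewrite /loops !rmorphN !mulNr !opprD. Qed.

Definition corner (x : A) : A := E a * x * E a.

Lemma cornerD x y : corner (x + y) = corner x + corner y.
Proof. by rewrite /corner mulrDr mulrDl. Qed.

Lemma cornerN x : corner (- x) = - corner x.
Proof. by rewrite /corner mulrN mulNr. Qed.

Lemma cornerZ p x : corner (kp p * x) = kp p * corner x.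
Proof. by rewrite /corner kpR -mulrA. Qed.

Lemma corner_kp z : corner (kp z) = loops 0 0 z.
Proof. by rewrite /corner -kpC -mulrA EE /loops !rmorph0 !mul0r !add0r. Qed.

Lemma corner_g1 : corner g1 = loops 0 0 (th a).
Proof. by rewrite /corner Eg1 -mulrA EE /loops !rmorph0 !mul0r !add0r. Qed.

Lemma corner_g : corner g = loops 0 0 (t a).
Proof. by rewrite /corner G_diag /loops !rmorph0 !mul0r !add0r. Qed.

Lemma corner_g13 : corner g13 = loops 0 0 (t a).
Proof. by rewrite /corner diag13 -corner_g. Qed.

Lemma corner_gg : corner (g * g) = loops 1 1 (t a ^+ 2).
Proof. by rewrite /corner gg_diag /loops !rmorph1 !mul1r addrC addrA. Qed.

Lemma corner_g1g1 : corner (g1 * g1) = loops 0 0 (th a ^+ 2).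
Proof.
by rewrite /corner mulrA Eg1 -[RHS](mulr1) -(mulrA (kp (th a) * E a)) g1E kpMM EE -expr2
   /loops !rmorph0 !mul0r !add0r mulr1.
Qed.

Lemma corner_h : corner h = loops 1 1 (t a ^+ 2).
Proof. by rewrite -corner_gg. Qed.

Lemma corner_gg13 : corner (g * g13) = loops (al a) (be a) (t a ^+ 2).
Proof.
rewrite /corner sandwich_gl dn13 diag13 up13 !kpR /loops -Tdiag /Wm /Wp !mulrA.
by rewrite addrC addrA.
Qed.

Lemma corner_g13g : corner (g13 * g) = loops (ali a) (bei a) (t a ^+ 2).
Proof.
rewrite /corner sandwich_gr dn13V diag13 up13V /loops -Tdiag /Wm /Wp !mulrA.
by rewrite addrC addrA.
Qed.

Lemma corner_g1gg13 : corner (g1 * (g * g13)) = kp (th a) * loops (al a) (be a) (t a ^+ 2).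
Proof. by rewrite -corner_gg13 /corner mulrA Eg1 -!mulrA. Qed.

Definition cornerE := (cornerD, cornerN, cornerZ, corner_kp, corner_g1gg13, corner_gg13,
  corner_g13g, corner_gg, corner_g1g1, corner_h, corner_g1, corner_g, corner_g13).

(** Compression of the second Askey-Wilson relation. *)
Lemma loop_aw (u v z : L) : kp u * (g * g13) - kp v * (g13 * g) + g1 = kp z ->
  loops (u * al a - v * ali a) (u * be a - v * bei a)
        ((u - v) * t a ^+ 2 + th a - z) = 0.
Proof.
move/(congr1 corner); rewrite !cornerE !(loopsZ, loopsN, loopsD) => /eqP.
rewrite -subr_eq0 !(loopsZ, loopsN, loopsD) => /eqP <-.
by congr loops; ring.
Qed.

(** Compression of the Casimir relation; h stands for the conjugate of g2 ^ 2,
    whose corner is that of g2 ^ 2. *)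
Lemma loop_casimir (c q z y : L) :
  kp c * (kp q * g1 + kp y * g + kp q * g13) - kp (q ^+ 2) * (g1 * g1)
  - kp (y ^+ 2) * (g * g) - kp (q ^+ 2) * h - kp q * (g1 * (g * g13)) = kp z ->
  loops (- (y ^+ 2 + q ^+ 2) - q * th a * al a)
        (- (y ^+ 2 + q ^+ 2) - q * th a * be a)
        (c * (q * th a + (y + q) * t a) - q ^+ 2 * th a ^+ 2
         - (y ^+ 2 + q ^+ 2 + q * th a) * t a ^+ 2 - z) = 0.
Proof.
move/(congr1 corner); rewrite !cornerE !(loopsZ, loopsN, loopsD) => /eqP.
rewrite -subr_eq0 !(loopsZ, loopsN, loopsD) => /eqP <-.
by congr loops; ring.
Qed.

Lemma loops_elimWp x y z x' y' z' : loops x y z = 0 -> loops x' y' z' = 0 ->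
  kp (y' * x - y * x') * Wp a + kp (y' * z - y * z') * E a = 0.
Proof.
move=> e e'; have : kp y' * loops x y z - kp y * loops x' y' z' = 0.
  by rewrite e e' !mulr0 subrr.
rewrite !(loopsZ, loopsN, loopsD) => <-.
rewrite /loops (_ : y' * y + - (y * y') = 0); last by ring.
by rewrite rmorph0 mul0r addr0.
Qed.

Lemma loops_elimWm x y z x' y' z' : loops x y z = 0 -> loops x' y' z' = 0 ->
  kp (x' * y - x * y') * Wm a + kp (x' * z - x * z') * E a = 0.
Proof.
move=> e e'; have : kp x' * loops x y z - kp x * loops x' y' z' = 0.
  by rewrite e e' !mulr0 subrr.
rewrite !(loopsZ, loopsN, loopsD) => <-.
rewrite /loops (_ : x' * x + - (x * x') = 0); last by ring.
by rewrite rmorph0 mul0r add0r.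
Qed.

End Tridiagonal.

Lemma rmorph_cancel (L : comNzRingType) (A : pzRingType) (kp : {rmorphism L -> A})
  (d' d U : L) (x e : A) : d' * d = 1 ->
  kp d * x + kp (- (d * U)) * e = 0 -> x = kp U * e.
Proof.
move=> dd; rewrite rmorphN rmorphM mulNr -mulrA -mulrBr => /(congr1 ( *%R (kp d'))).
rewrite mulr0 mulrA -rmorphM dd rmorph1 mul1r => /eqP.
by rewrite subr_eq0 => /eqP.
Qed.

Lemma rmorph_subr0 (L : comNzRingType) (A : pzRingType) (kp : {rmorphism L -> A})
  (p p' : L) (e : A) : kp p * e = kp p' * e -> kp (p - p') * e = 0.
Proof. by move=> pp'; rewrite rmorphB mulrBl pp' subrr. Qed.

Lemma rmorph_kill_cancel (L : comNzRingType) (A : pzRingType) (kp : {rmorphism L -> A})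
  (d' d U : L) (e : A) : d' * d = 1 -> kp (d * U) * e = 0 -> kp U * e = 0.
Proof.
move=> dd; rewrite rmorphM -mulrA => /(congr1 ( *%R (kp d'))).
by rewrite mulr0 mulrA -rmorphM dd rmorph1 mul1r.
Qed.

(** As r(l) != 0, 1 is a combination of r and 'X - l. *)
Lemma rmorph_remove_root (K : fieldType) (A : pzRingType)
  (kp : {rmorphism {poly K} -> A}) (p r : {poly K}) (l : K) (y : A) :
  kp (p * ('X - l%:P)) * y = 0 -> kp r * y = 0 -> r.[l] != 0 -> kp p * y = 0.
Proof.
move=> py ry rl; have /factor_theorem[r' r'E] : root (r - r.[l]%:P) l.
  by rewrite rootE !hornerE subrr.
have pE : p = (r.[l]^-1)%:P * (p * r - r' * (p * ('X - l%:P))).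
  have -> : p * r - r' * (p * ('X - l%:P)) = r.[l]%:P * p.
    by rewrite mulrCA -r'E mulrBr opprB addrC subrK mulrC.
  by rewrite mulrA -polyCM mulVf // mul1r.
have e1 : kp (p * r) * y = 0 by rewrite rmorphM -mulrA ry mulr0.
have e2 : kp (r' * (p * ('X - l%:P))) * y = 0 by rewrite rmorphM -mulrA py mulr0.
by rewrite pE rmorphM -mulrA rmorphB mulrBl e1 e2 subrr mulr0.
Qed.

Lemma rmorph_poly_act (R : nzRingType) (A : pzRingType) (h : {rmorphism {poly R} -> A})
  (n : nat) (c : nat -> R) (y : A) : (forall p z, h p * z = z * h p) ->
  h (\poly_(i < n) c i) * y = \sum_(i < n) h (c i)%:P * (y * h 'X ^+ i).
Proof.
move=> hC; rewrite poly_def rmorph_sum mulr_suml; apply: eq_bigr => i _.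
by rewrite /= -mul_polyC rmorphM -mulrA (hC 'X^i) rmorphXn.
Qed.

(** Division by d reduces p to degree less than n. *)
Lemma rmorph_reduce (K : fieldType) (A : pzRingType) (kp : {rmorphism {poly K} -> A})
  (kpC : forall p y, kp p * y = y * kp p) (p d : {poly K}) (n : nat) (y : A) :
  size d = n.+1 -> kp d * y = 0 ->
  kp p * y = \sum_(i < n) kp ((p %% d)`_i)%:P * (y * kp 'X ^+ i).
Proof.
move=> dn dy; have rsz : (size (p %% d)%R <= n)%N.
  by rewrite -ltnS -dn ltn_modp -size_poly_gt0 dn.
rewrite {1}(divp_eq p d) rmorphD rmorphM mulrDl -mulrA dy mulr0 add0r.
have {1}-> : p %% d = \poly_(i < n) (p %% d)`_i.
  apply/polyP => i; rewrite coef_poly; case: ltnP => // ni.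
  by rewrite nth_default // (leq_trans rsz).
exact: rmorph_poly_act.
Qed.

(** * The weights of the loops *)

(** Here x, y and k stand for q^a, q^N and kappa: the coefficients of the two
    compressed relations, and the identities that solve them for the loops. *)
Section LoopIdentities.
Variables (K : fieldType) (q x y k : K).
Hypotheses (q0 : q != 0) (x0 : x != 0) (y0 : y != 0).
Let v (z : K) := z - z^-1.
Let c (z : K) := z + z^-1.

Lemma chi_sum_neq0 : c q + c (x * x * q) != 0 ->
  (q * q + 1) * (x * x) + (x * x * q * (x * x * q) + 1) != 0.
Proof.
have -> : c q + c (x * x * q) =
  ((q * q + 1) * (x * x) + (x * x * q * (x * x * q) + 1)) / (x * x * q).
  by rewrite /c; field; rewrite q0 x0.
by rewrite mulf_eq0 negb_or => /andP[].
Qed.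

Let Y := c (y * q).
Let th := c (x * x * q).
Let t := Y / (c q + th) * (k + Y).
Let hw := (q ^+ 2 - q ^- 2)^-1.
Let al := - (x * x * q * q).
Let ali := - (x * x * q * q)^-1.
Let be := - (x * x)^-1.
Let bei := - (x * x).
Let c1 := hw * q * al - hw * q^-1 * ali.
Let d1 := hw * q * be - hw * q^-1 * bei.
Let r1 := (hw * q - hw * q^-1) * t ^+ 2 + th - Y / (q + q^-1) * (k + Y).
Let c2 := - (q^-1 ^+ 2 + q ^+ 2) - q * th * al.
Let d2 := - (q^-1 ^+ 2 + q ^+ 2) - q * th * be.
Let r2 := Y * (k + Y) * (q * th + (q^-1 + q) * t) - q ^+ 2 * th ^+ 2
  - (q^-1 ^+ 2 + q ^+ 2 + q * th) * t ^+ 2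
  - (k * (k + Y ^+ 3) + (3 * Y ^+ 2 - c q ^+ 2)).
Let U := - (v (y / x) * v (y * x * q * q) /
   (v (x * x * q) * v (x * x * q * q * q) * c (x * q) ^+ 2))
  * ((k - c (y * x * x * q * q * q)) * (k - c (y / (x * x * q)))).
Let U' := - (v (y * q / x) * v (y * x * q) /
   (v (x * x / q) * v (x * x * q) * c x ^+ 2))
  * ((k - c (y * x * x * q)) * (k - c (y * q / (x * x)))).

Hypotheses (cq : c q != 0) (vqq : v (q * q) != 0) (vxxq : v (x * x * q) != 0)
  (cth : c q + th != 0) (vxxqqq : v (x * x * q * q * q) != 0) (cxq : c (x * q) != 0)
  (vxxVq : v (x * x / q) != 0) (cx : c x != 0).

Let side1 : (q * q) ^+ 2 - 1 != 0.
Proof. by rewrite expr2 sqr_neq1 // mulf_neq0. Qed.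
Let side2 : q * q + 1 != 0. Proof. exact: sqr_neqN1. Qed.
Let side3 : x * x * q * (x * x * q) - 1 != 0.
Proof. by rewrite sqr_neq1 // !mulf_neq0. Qed.
Let side4 := chi_sum_neq0 cth.
Let side5 : x * x * (x * x) + - q * q != 0.
Proof.
move: vxxVq; have -> : v (x * x / q) = (x * x * (x * x) + - q * q) / (x * x * q).
  by rewrite /v; field; rewrite q0 x0.
by rewrite mulf_eq0 negb_or => /andP[].
Qed.
Let side6 : x * q * (x * q) + 1 != 0.
Proof. by rewrite sqr_neqN1 // mulf_neq0. Qed.
Let side7 : x * x * q * q * q * (x * x * q * q * q) - 1 != 0.
Proof. by rewrite sqr_neq1 // !mulf_neq0. Qed.
Let side8 : x * x + 1 != 0. Proof. exact: sqr_neqN1. Qed.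

Lemma loop_up_identity : d2 * r1 - d1 * r2 = - ((d2 * c1 - d1 * c2) * U).
Proof.
rewrite /r1 /r2 /t /c1 /d1 /d2 /c2 /U /th /Y /hw /al /ali /be /bei /v /c.
by field; rewrite q0 x0 y0 side1 side2 side3 side4 side6 side7.
Qed.

Lemma loop_dn_identity : c2 * r1 - c1 * r2 = - ((c2 * d1 - c1 * d2) * U').
Proof.
rewrite /r1 /r2 /t /c1 /d1 /d2 /c2 /U' /th /Y /hw /al /ali /be /bei /v /c.
by field; rewrite q0 x0 y0 side1 side2 side3 side4 side5 side8.
Qed.

Lemma loop_det_neq0 : d2 * c1 - d1 * c2 != 0.
Proof.
have -> : d2 * c1 - d1 * c2 = - (hw * v (x * x * q * q * q) * v (x * x / q) * v (x * x * q)).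
  rewrite /c1 /d1 /d2 /c2 /th /hw /al /ali /be /bei /v /c.
  by field; rewrite q0 x0 side1.
rewrite oppr_eq0 !mulf_neq0 // invr_eq0.
move: vqq; rewrite /v (_ : q ^- 2 = (q * q)^-1) ?expr2 //.
Qed.

End LoopIdentities.

Section Loops.
Variables (K : fieldType) (q : K) (N : nat).
Hypothesis gq : generic q.
Let q0 : q != 0. Proof. by case: gq. Qed.
Local Notation c z := (z + z^-1).
Local Notation v z := (z - z^-1).
Local Notation qa a := (q ^ a%:Z).

Lemma th_qa a : th q a = c (qa a * qa a * q).
Proof.
by rewrite /th chi_co /co mul2n -addnn PoszD !(qzN, qzD gq, expr1z).
Qed.

Lemma chs_qa : chs q N = c (qa N * q).
Proof. by rewrite /chs chi_co /co !(qzN, qzD gq, expr1z). Qed.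

Lemma up_root_qa a : up_root q N a.+1 = c (qa N * qa a * qa a * q * q * q).
Proof.
rewrite /up_root chi_co /co !(qzN, qzD gq, expr1z) !(qaS gq).
have -> : qa N * (qa a * q) * (qa a * q) * q = qa N * qa a * qa a * q * q * q by ring.
by [].
Qed.

Lemma dn_root_qa a : dn_root q N a.+1 = c (qa N / (qa a * qa a * q)).
Proof.
rewrite /dn_root chi_co /co !(qzN, qzD gq, expr1z) !(qaS gq).
have -> : qa N / (qa a * q) / (qa a * q) * q = qa N / (qa a * qa a * q).
  by field; rewrite q0 (qz0 gq).
by [].
Qed.

Lemma ucst_qa a : ucst q N a = let x := qa a in let y := qa N in
  - (v (y / x) * v (y * x * q * q) /
   (v (x * x * q) * v (x * x * q * q * q) * c (x * q) ^+ 2)).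
Proof. by rewrite /ucst /br /co !(opprD, opprK, qzN, qzD gq, expr1z) !invfM ?invrK !mulrA. Qed.

Let al a : {poly K} := (- (qa a * qa a * q * q))%:P.
Let ali a : {poly K} := (- (qa a * qa a * q * q)^-1)%:P.
Let be a : {poly K} := (- (qa a * qa a)^-1)%:P.
Let bei a : {poly K} := (- (qa a * qa a))%:P.

Let hwq : {poly K} := (hw q * q)%:P.
Let hwV : {poly K} := (hw q * q^-1)%:P.

Definition omega : {poly K} := 'X * ('X + (chs q N ^+ 3)%:P)
  + (3 * chs q N ^+ 2 - chi q 0 ^+ 2)%:P.

Let C1 a := hwq * al a - hwV * ali a.
Let D1 a := hwq * be a - hwV * bei a.
Let R1 a := (hwq - hwV) * tpol q N a ^+ 2 + (th q a)%:P - zeta q N.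
Let C2 a := - ((q^-1)%:P ^+ 2 + q%:P ^+ 2) - q%:P * (th q a)%:P * al a.
Let D2 a := - ((q^-1)%:P ^+ 2 + q%:P ^+ 2) - q%:P * (th q a)%:P * be a.
Let R2 a := chs q N *: ('X + (chs q N)%:P) *
    (q%:P * (th q a)%:P + ((q^-1)%:P + q%:P) * tpol q N a)
  - q%:P ^+ 2 * (th q a)%:P ^+ 2
  - ((q^-1)%:P ^+ 2 + q%:P ^+ 2 + q%:P * (th q a)%:P) * tpol q N a ^+ 2 - omega.

Let v_br (n : int) z : q ^ n = z -> n != 0 -> v z != 0.
Proof. by move=> <- /(br_neq0 gq); rewrite /br qzN. Qed.
Let c_co (n : int) z : q ^ n = z -> c z != 0.
Proof. by move=> <-; have := co_neq0 gq n; rewrite /co qzN. Qed.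

Let cq : c q != 0. Proof. by apply: (@c_co 1); rewrite expr1z. Qed.
Let vqq : v (q * q) != 0.
Proof. by apply: (@v_br (1 + 1)); rewrite // (qzD gq) expr1z. Qed.
Let vxxq a : v (qa a * qa a * q) != 0.
Proof. by apply: (@v_br (a%:Z + a%:Z + 1)); rewrite ?(qzD gq) ?expr1z //; lia. Qed.
Let vxxqqq a : v (qa a * qa a * q * q * q) != 0.
Proof. by apply: (@v_br (a%:Z + a%:Z + 1 + 1 + 1)); rewrite ?(qzD gq) ?expr1z //; lia. Qed.
Let vxxVq a : v (qa a * qa a / q) != 0.
Proof. by apply: (@v_br (a%:Z + a%:Z - 1)); rewrite ?(qzD gq) ?qzN ?expr1z //; lia. Qed.
Let cxq a : c (qa a * q) != 0.
Proof. by apply: (@c_co (a%:Z + 1)); rewrite (qzD gq) expr1z. Qed.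
Let cx a : c (qa a) != 0. Proof. exact: c_co. Qed.
Let cth a : c q + c (qa a * qa a * q) != 0.
Proof. by rewrite -th_qa -chi0E th_chi0. Qed.

Lemma loop_det a : {d | d != 0 & D2 a * C1 a - D1 a * C2 a = d%:P}.
Proof.
have := loop_det_neq0 q0 (qz0 gq a%:Z) vqq (vxxq a) (vxxqqq a) (vxxVq a).
set d := (X in X != 0) => d0; exists d => //.
rewrite /d /C1 /D1 /C2 /D2 /hwq /hwV /al /be /ali /bei th_qa.
by rewrite !(polyCN, polyCD, polyCM, polyC_exp).
Qed.

Lemma loop_up_poly a : D2 a * R1 a - D1 a * R2 a =
  - ((D2 a * C1 a - D1 a * C2 a) * upol q N a).
Proof.
apply: (poly_ext gq) => k.
have := loop_up_identity k q0 (qz0 gq a%:Z) (qz0 gq N%:Z) cq vqq (vxxq a) (cth a)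
  (vxxqqq a) (cxq a).
rewrite /C1 /D1 /C2 /D2 /R1 /R2 /hwq /hwV /al /be /ali /bei /omega /upol /rpol /zeta /tpol.
rewrite !(hornerD, hornerN, hornerM, hornerC, hornerX, hornerZ, horner_exp).
by rewrite up_root_qa dn_root_qa ucst_qa th_qa chs_qa chi0E => ->.
Qed.

Lemma loop_dn_poly b : C2 b.+1 * R1 b.+1 - C1 b.+1 * R2 b.+1 =
  - ((C2 b.+1 * D1 b.+1 - C1 b.+1 * D2 b.+1) * upol q N b).
Proof.
set a := b.+1; apply: (poly_ext gq) => k.
have := loop_dn_identity k q0 (qz0 gq a%:Z) (qz0 gq N%:Z) cq vqq (vxxq a) (cth a)
  (vxxVq a) (cx a).
rewrite /C1 /D1 /C2 /D2 /R1 /R2 /hwq /hwV /al /be /ali /bei /omega /upol /rpol /zeta /tpol.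
rewrite !(hornerD, hornerN, hornerM, hornerC, hornerX, hornerZ, horner_exp).
rewrite up_root_qa dn_root_qa ucst_qa th_qa chs_qa chi0E => ->.
rewrite (qaS gq); have := qz0 gq b%:Z; have := qz0 gq N%:Z.
move: (qa b) (qa N) => x y y0 x0.
have -> : y * q / (x * q) = y / x by field; rewrite x0 q0.
have -> : y * q / (x * q * (x * q)) = y / (x * x * q) by field; rewrite x0 q0.
have -> : x * q * (x * q) / q = x * x * q by field.
have -> : y * (x * q) * q = y * x * q * q by ring.
have -> : x * q * (x * q) * q = x * x * q * q * q by ring.
have -> : y * (x * q) * (x * q) * q = y * x * x * q * q * q by ring.
by [].
Qed.

Lemma tpol0E : tpol q N 0 - (chi q N ^+ 2 / chi q 0)%:P =
  (chs q N / (chi q 0 + chi q 0)) *: ('X - (chi q N)%:P).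
Proof.
apply: (poly_ext gq) => k; rewrite /tpol /chs.
rewrite !(hornerD, hornerN, hornerM, hornerC, hornerX, hornerZ) -[th q 0]/(chi q 0).
have := chi_neq0 gq 0; move: (chi q 0) (chi q N) => x y x0.
have two0 : (2%:R : K) != 0 by case: gq.
have -> : x + x = 2%:R * x by ring.
by field; rewrite x0.
Qed.

Lemma tpol0_cst : chs q N / (chi q 0 + chi q 0) != 0.
Proof. by rewrite mulf_neq0 ?(chi_neq0 gq) // invr_eq0; exact: (th_chi0 gq 0). Qed.

Section InQuotient.
Variable S : set (freeAlg K bool).
Hypothesis rS : As_quotient q N S.
Local Notation A := (quotAlg S).
Local Notation s1 := (sigma1 S).
Local Notation g1 := (gelt q N s1).
Local Notation g2 := (gelt q N (sigma2 S)).
Local Notation g13 := (s1 * g2 * pzinv s1).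
Local Notation kap := (kappa q N S).
Local Notation E := (idem q N s1).
Local Notation kp := (evq kap).
Local Opaque gelt idem pzinv sigma1 sigma2 evq toQuot kappa qpar chi qp th tpol
  quot_mul quot_scale quot_one.

Lemma quot_tridiagonal : tridiagonal kp N E g2 (tpol q N).
Proof.
split; [exact: (kpC rS) | exact: (EE gq rS) | exact: (EE0 gq rS)
  | exact: (E_gt gq rS) | exact: (sumE gq rS) | exact: (G_far gq rS)
  | exact: (G_diag gq rS)].
Qed.

Local Notation tri := quot_tridiagonal.

Lemma scale_kp (k : K) (x : A) : k *: x = kp k%:P * x.
Proof. by rewrite evqC quotZl mul1r. Qed.

Lemma up13 a : E a.+1 * g13 * E a = kp (al a) * (E a.+1 * g2 * E a).
Proof. by rewrite -scale_kp -qp_ratio // (Eg13E gq rS). Qed.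

Lemma up13V a : E a * g13 * E a.+1 = kp (ali a) * (E a * g2 * E a.+1).
Proof. by rewrite -scale_kp -qp_ratioV // (Eg13E gq rS). Qed.

Lemma dn13 a : pr E a * g13 * E a = kp (be a) * (pr E a * g2 * E a).
Proof.
case: a => [|a] /=; first by rewrite !mul0r mulr0.
have -> : be a.+1 = ali a by rewrite /be (qaS gq); congr (- _^-1)%:P; ring.
exact: up13V.
Qed.

Lemma dn13V a : E a * g13 * pr E a = kp (bei a) * (E a * g2 * pr E a).
Proof.
case: a => [|a] /=; first by rewrite !mulr0.
have -> : bei a.+1 = al a by rewrite /bei (qaS gq); congr (- _)%:P; ring.
exact: up13.
Qed.

Lemma diag13 a : E a * g13 * E a = E a * g2 * E a.
Proof. by rewrite (Eg13E gq rS) mulfV ?(qp_neq0 gq) // scale1r. Qed.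

Lemma conj_gg a : E a * (s1 * g2 ^+ 2 * pzinv s1) * E a = E a * (g2 * g2) * E a.
Proof.
rewrite -expr2 !mulrA (Es1 gq rS) !quotZl -!mulrA (s1iE gq rS) !quotZr scalerA.
by rewrite mulfV ?(qp_neq0 gq) // scale1r.
Qed.

Lemma aw2_kp : kp hwq * (g2 * g13) - kp hwV * (g13 * g2) + g1 = kp (zeta q N).
Proof.
rewrite -(aw1E N gq S) (quot_aw12 rS) /aw2 /qcomm -/(hw q) scalerBr !scalerA.
by rewrite (scale_kp (hw q * q)) (scale_kp (hw q / q)).
Qed.

Lemma loops_aw a :
  loops kp E g2 a (hwq * al a - hwV * ali a) (hwq * be a - hwV * bei a)
    ((hwq - hwV) * tpol q N a ^+ 2 + (th q a)%:P - zeta q N) = 0.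
Proof.
apply: (loop_aw (th := fun a => (th q a)%:P) tri (dn13 a) (dn13V a)
  (up13 a) (up13V a) (diag13 a) _ aw2_kp).
by rewrite (Eg1 gq rS); exact: scale_kp.
Qed.

Lemma casimir_scale (x y s si : A) :
  kp (chs q N *: ('X + (chs q N)%:P)) *
   (kp q%:P * x + kp (q^-1)%:P * y + kp q%:P * (s * y * si))
  - kp (q%:P ^+ 2) * (x * x) - kp ((q^-1)%:P ^+ 2) * (y * y)
  - kp (q%:P ^+ 2) * (s * y ^+ 2 * si)
  - kp q%:P * (x * (y * (s * y * si))) =
  chs q N *: (kap + chs q N *: (1 : A)) * (q *: x + q^-1 *: y + q *: (s * y * si))
  - q ^+ 2 *: x ^+ 2 - q ^- 2 *: y ^+ 2 - q ^+ 2 *: (s * y ^+ 2 * si)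
  - q *: (x * y * s * y * si).
Proof.
have -> : x * (y * (s * y * si)) = x * y * s * y * si by rewrite !mulrA.
rewrite -!polyC_exp exprVn evqZ rmorphD /= evqX evqC.
rewrite (scale_kp q) (scale_kp q^-1) (scale_kp q (s * _ * _)) (scale_kp (q ^+ 2)).
rewrite (scale_kp (q ^- 2)) (scale_kp (q ^+ 2) (s * _ * _)) (scale_kp q (x * _ * _ * _ * _)).
by [].
Qed.

Lemma Omega_kp : kp (chs q N *: ('X + (chs q N)%:P)) *
   (kp q%:P * g1 + kp (q^-1)%:P * g2 + kp q%:P * g13)
  - kp (q%:P ^+ 2) * (g1 * g1) - kp ((q^-1)%:P ^+ 2) * (g2 * g2)
  - kp (q%:P ^+ 2) * (s1 * g2 ^+ 2 * pzinv s1)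
  - kp q%:P * (g1 * (g2 * g13)) = kp omega.
Proof.
have := quot_Omega rS; rewrite /= /Omega -/(chs q N) => e.
have -> : kp omega = kap * (kap + chs q N ^+ 3 *: (1 : A))
   + (3 * chs q N ^+ 2 - chi q 0 ^+ 2) *: (1 : A).
  by rewrite /omega rmorphD rmorphM rmorphD /= !evqX !evqC.
by rewrite -e; exact: casimir_scale.
Qed.

Lemma loops_casimir a :
  let y := (q^-1)%:P in let q' := q%:P in let th' := (th q a)%:P in
  loops kp E g2 a (- (y ^+ 2 + q' ^+ 2) - q' * th' * al a)
        (- (y ^+ 2 + q' ^+ 2) - q' * th' * be a)
        (chs q N *: ('X + (chs q N)%:P) * (q' * th' + (y + q') * tpol q N a)
         - q' ^+ 2 * th' ^+ 2
         - (y ^+ 2 + q' ^+ 2 + q' * th') * tpol q N a ^+ 2 - omega) = 0.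
Proof.
apply: (loop_casimir (th := fun a => (th q a)%:P) tri (dn13 a) (up13 a)
  (diag13 a) (conj_gg a) _ _ Omega_kp).
  by rewrite (g1E gq rS); exact: scale_kp.
by rewrite (Eg1 gq rS); exact: scale_kp.
Qed.

Lemma kp_cancel (d : K) (U : {poly K}) (W e : A) : d != 0 ->
  kp d%:P * W + kp (- (d%:P * U)) * e = 0 -> W = kp U * e.
Proof.
move=> d0; apply: (@rmorph_cancel _ _ kp (d^-1)%:P).
by rewrite -polyCM mulVf.
Qed.

(** The two equations at a determine both loops at a. The two loops along an edge
    turn out to have the same weight. *)
Lemma loop_up a : E a * g2 * E a.+1 * g2 * E a = kp (upol q N a) * E a.
Proof.
have := loops_elimWp (loops_aw a) (loops_casimir a).
have [d d0 dE] := loop_det a; have := loop_up_poly a.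
rewrite -/(C1 a) -/(C2 a) -/(D1 a) -/(D2 a) -/(R1 a) -/(R2 a) dE => ->.
by move/(kp_cancel d0).
Qed.

Lemma loop_dn a : E a.+1 * g2 * E a * g2 * E a.+1 = kp (upol q N a) * E a.+1.
Proof.
have := loops_elimWm (loops_aw a.+1) (loops_casimir a.+1).
have [d d0 dE] := loop_det a.+1; have := loop_dn_poly a.
rewrite -/(C1 _) -/(C2 _) -/(D1 _) -/(D2 _) -/(R1 _) -/(R2 _).
have -> : C2 a.+1 * D1 a.+1 - C1 a.+1 * D2 a.+1 = (- d)%:P by rewrite polyCN -dE; ring.
have nd0 : - d != 0 by rewrite oppr_eq0.
by move=> -> /(kp_cancel nd0).
Qed.

(** The last defining relation prescribes the diagonal entry of g2 at e_1^(0),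
    which is affine in kappa. *)
Lemma kappa_E0 : kp ('X - (chi q N)%:P) * E 0 = 0.
Proof.
have e : G q N S 0 0 = (chi q N ^+ 2 / chi q 0) *: E 0 := quot_idem rS.
move: e; rewrite (G_diag gq rS) scale_kp => e.
have e2 : kp (tpol q N 0 - (chi q N ^+ 2 / chi q 0)%:P) * E 0 = 0.
  exact: rmorph_subr0 e.
move: e2; rewrite tpol0E -mul_polyC; move: (chs q N / _) tpol0_cst => c c0.
by apply: (@rmorph_kill_cancel _ _ kp (c^-1)%:P); rewrite -polyCM mulVf.
Qed.

End InQuotient.

End Loops.

(** * Paths *)

Section ChainAlgebra.
Variables (L : comNzRingType) (A : pzRingType) (kp : {rmorphism L -> A}).
Variables (N : nat) (E : nat -> A) (g : A) (t U : nat -> L).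
Hypothesis tri : tridiagonal kp N E g t.
Hypothesis loopU : forall a, E a * g * E a.+1 * g * E a = kp (U a) * E a.
Hypothesis loopD : forall a, E a.+1 * g * E a * g * E a.+1 = kp (U a) * E a.+1.
Let EE := tri_idem tri.

Definition path_elt (a c : nat) : A := E a * g ^+ `|a - c|%N * E c.
Local Notation M := path_elt.

Lemma prE a x : pr E a * x = if a is b.+1 then E b * x else 0.
Proof. by case: a => //=; rewrite mul0r. Qed.

(** In k steps a tridiagonal element moves by at most k levels. *)
Lemma pow_far (a c k : nat) : (k < `|a - c|)%N -> E a * g ^+ k * E c = 0.
Proof.
elim: k a => [|k IH] a ac; first by rewrite mulr1 (tri_ortho tri) //; lia.
rewrite exprS mulrA (Eg_split tri) !mulrDl -!mulrA.
rewrite [E a * (g ^+ k * _)]mulrA IH; last by lia.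
rewrite [E a.+1 * _]mulrA IH; last by lia.
rewrite prE; case: a ac => [|a] ac; rewrite ?[E a * (_ * _)]mulrA ?IH ?mulr0 ?addr0 //.
lia.
Qed.

Lemma E_path a c : E a * M a c = M a c.
Proof. by rewrite /M !mulrA EE. Qed.

Lemma path_E a c : M a c * E c = M a c.
Proof. by rewrite /M -!mulrA EE. Qed.

Lemma E_path0 a b c : a <> b -> E a * M b c = 0.
Proof. by move=> ab; rewrite /M !mulrA (tri_ortho tri) // !mul0r. Qed.

Lemma M_diag a : M a a = E a.
Proof. by rewrite /M subrr mulr1 EE. Qed.

Lemma step_dn a y : E a.+1 * y = 0 -> E a.+2 * y = 0 ->
  E a.+1 * g * y = E a.+1 * g * E a * y.
Proof.
move=> y1 y2; rewrite {1}(Eg_split tri) /= !mulrDl.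
by rewrite -[X in _ + X + _]mulrA y1 -[X in _ + _ + X]mulrA y2 !mulr0 !addr0.
Qed.

Lemma step_up a y : pr E a * y = 0 -> E a * y = 0 ->
  E a * g * y = E a * g * E a.+1 * y.
Proof.
move=> y1 y2; rewrite {1}(Eg_split tri) /= !mulrDl.
by rewrite -[X in X + _ + _]mulrA y1 -[X in _ + X + _]mulrA y2 !mulr0 !add0r.
Qed.

Lemma path_dn a c : (c <= a)%N -> E a.+1 * g * M a c = M a.+1 c.
Proof.
move=> ca; rewrite /M (_ : `|a.+1 - c| = `|a - c|.+1)%N; last by lia.
have far b : (a < b)%N -> E b * (g ^+ `|a - c| * E c) = 0.
  by move=> ab; rewrite mulrA pow_far //; lia.
by rewrite exprS -!mulrA [RHS]mulrA (step_dn (far _ _) (far _ _)) // !mulrA.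
Qed.

Lemma path_up a c : (a < c)%N -> E a * g * M a.+1 c = M a c.
Proof.
move=> ac; rewrite /M (_ : `|a - c| = `|a.+1 - c|.+1)%N; last by lia.
have far b : (b <= a)%N -> E b * (g ^+ `|a.+1 - c| * E c) = 0.
  by move=> ab; rewrite mulrA pow_far //; lia.
have pr0 : pr E a * (g ^+ `|a.+1 - c| * E c) = 0.
  by case: a ac far => [|a] ac far /=; rewrite ?mul0r ?far.
by rewrite exprS -!mulrA [RHS]mulrA (step_up pr0 (far _ _)) // !mulrA.
Qed.

Lemma path_up_loop a c : (c <= a)%N -> E a * g * M a.+1 c = kp (U a) * M a c.
Proof. move=> ca; rewrite -path_dn //; move: (M a c) (E_path a c) => y yE.
by rewrite -{1}yE !mulrA loopU -mulrA yE. Qed.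

Lemma path_dn_loop a c : (a < c)%N -> E a.+1 * g * M a c = kp (U a) * M a.+1 c.
Proof. move=> ac; rewrite -path_up //; move: (M _ c) (E_path a.+1 c) => y yE.
by rewrite -{1}yE !mulrA loopD -mulrA yE. Qed.

Lemma path_upr a c : (a <= c)%N -> M a c * g * E c.+1 = M a c.+1.
Proof.
move=> ac; rewrite /M (_ : `|a - c.+1| = `|a - c|.+1)%N; last by lia.
have far b : (c < b)%N -> E a * g ^+ `|a - c| * E b = 0.
  by move=> cb; rewrite pow_far //; lia.
rewrite exprSr -[RHS]mulrA -[g ^+ _ * g * _]mulrA (gE_split tri c.+1) /= !mulrDr !mulrA.
by rewrite (far c.+1) // (far c.+2) // !mul0r !addr0.
Qed.

Lemma path_upr_loop a c : (a <= c)%N -> M a c.+1 * g * E c = kp (U c) * M a c.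
Proof.
move=> ac; rewrite -path_upr //; move: (M a c) (path_E a c) => y yE.
rewrite -yE -!mulrA (_ : E c * (g * (E c.+1 * (g * E c))) = kp (U c) * E c).
  by rewrite (kpR tri).
by rewrite -loopU !mulrA.
Qed.

Lemma path_mul_g a c : g * M a c =
  (if a is b.+1 then E b * g * M a c else 0) + kp (t a) * M a c + E a.+1 * g * M a c.
Proof.
move: (M a c) (E_path a c) => y yE.
rewrite -{1}yE mulrA (gE_split tri) !mulrDl (tri_diag tri) -!mulrA yE.
by case: a yE => [|a] yE /=; rewrite ?mul0r !mulrA.
Qed.

Definition path_span (x : A) : Prop :=
  exists P : nat -> nat -> L, x = \sum_(a < N.+1) \sum_(c < N.+1) kp (P a c) * M a c.

Lemma path_span0 : path_span 0.
Proof.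
exists (fun _ _ => 0); rewrite big1 // => a _; rewrite big1 // => c _.
by rewrite rmorph0 mul0r.
Qed.

Lemma path_spanD x y : path_span x -> path_span y -> path_span (x + y).
Proof.
move=> [P ->] [P' ->]; exists (fun a c => P a c + P' a c).
rewrite -big_split; apply: eq_bigr => a _ /=; rewrite -big_split.
by apply: eq_bigr => c _ /=; rewrite rmorphD mulrDl.
Qed.

Lemma path_spanZ p x : path_span x -> path_span (kp p * x).
Proof.
move=> [P ->]; exists (fun a c => p * P a c); rewrite mulr_sumr.
apply: eq_bigr => a _; rewrite mulr_sumr; apply: eq_bigr => c _.
by rewrite rmorphM mulrA.
Qed.

Lemma path_span_sum (I : Type) (r : seq I) (F : I -> A) :
  (forall i, path_span (F i)) -> path_span (\sum_(i <- r) F i).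
Proof. by move=> FS; apply: big_ind => //; [exact: path_span0|exact: path_spanD]. Qed.

Lemma path_spanM a c : path_span (M a c).
Proof.
have [aN|aN] := leqP a N; last by rewrite /M (tri_out tri aN) !mul0r; apply: path_span0.
have [cN|cN] := leqP c N; last by rewrite /M (tri_out tri cN) mulr0; apply: path_span0.
exists (fun b d => ((b == a) && (d == c))%:R).
have ai : (inord a : 'I_N.+1) = a :> nat by rewrite inordK.
have ci : (inord c : 'I_N.+1) = c :> nat by rewrite inordK.
rewrite (bigD1 (inord a)) //= (bigD1 (inord c)) //= ai ci !eqxx rmorph1 mul1r.
rewrite big1 ?addr0 => [|d dc].
  rewrite big1 ?addr0 // => b ba; rewrite big1 // => d _.
  rewrite (_ : nat_of_ord b == a = false) ?rmorph0 ?mul0r //.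
  by apply: contraNF ba => /eqP e; apply/eqP/val_inj; rewrite /= ai.
rewrite (_ : nat_of_ord d == c = false) ?rmorph0 ?mul0r //.
by apply: contraNF dc => /eqP e; apply/eqP/val_inj; rewrite /= ci.
Qed.

Lemma path_span_up a c : path_span (E a * g * M a.+1 c).
Proof.
have [ca|ac] := leqP c a; last by rewrite path_up //; exact: path_spanM.
by rewrite path_up_loop //; apply: path_spanZ; exact: path_spanM.
Qed.

Lemma path_span_dn a c : path_span (E a.+1 * g * M a c).
Proof.
have [ca|ac] := leqP c a; first by rewrite path_dn //; exact: path_spanM.
by rewrite path_dn_loop //; apply: path_spanZ; exact: path_spanM.
Qed.

Lemma path_span_mul z x : (forall a c, path_span (z * M a c)) ->
  path_span x -> path_span (z * x).
Proof.
move=> zM [P ->]; rewrite mulr_sumr; apply: path_span_sum => a.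
rewrite mulr_sumr; apply: path_span_sum => c.
by rewrite (kpR tri); apply: path_spanZ.
Qed.

Lemma path_span_g x : path_span x -> path_span (g * x).
Proof.
apply: path_span_mul => a c; rewrite path_mul_g; apply: path_spanD (path_span_dn a c).
apply: path_spanD; last by apply: path_spanZ; exact: path_spanM.
by case: a => [|a]; [exact: path_span0|exact: path_span_up].
Qed.

Lemma path_span_E b x : path_span x -> path_span (E b * x).
Proof.
apply: path_span_mul => a c; have [->|ba] := eqVneq b a.
  by rewrite E_path; exact: path_spanM.
by rewrite E_path0; [exact: path_span0|exact/eqP].
Qed.

Lemma path_span1 : path_span 1.
Proof.
by rewrite -(tri_sum tri); apply: path_span_sum => a; rewrite -M_diag; apply: path_spanM.
Qed.

Hypothesis generated : forall x, path_span x.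

Lemma corner_path x a c : exists p, E a * x * E c = kp p * M a c.
Proof.
have [P ->] := generated x.
have [aN|aN] := leqP a N; last first.
  by exists 0; rewrite (tri_out tri aN) !mul0r rmorph0 mul0r.
have [cN|cN] := leqP c N; last first.
  by exists 0; rewrite (tri_out tri cN) mulr0 rmorph0 mul0r.
have ai : (inord a : 'I_N.+1) = a :> nat by rewrite inordK.
have ci : (inord c : 'I_N.+1) = c :> nat by rewrite inordK.
exists (P a c); rewrite mulr_sumr mulr_suml (bigD1 (inord a)) //= ai.
rewrite [X in _ + X]big1 ?addr0 => [|b ba].
  rewrite mulr_sumr mulr_suml (bigD1 (inord c)) //= ci.
  rewrite [X in _ + X]big1 ?addr0 => [|d dc].
    by rewrite (kpR tri) E_path -mulrA path_E.
  rewrite (kpR tri) /M -!mulrA (tri_ortho tri) ?mulr0 //.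
  by move=> e; case/eqP: dc; apply: val_inj; rewrite /= ci.
rewrite mulr_sumr mulr_suml big1 // => d _.
rewrite (kpR tri) E_path0 ?mulr0 ?mul0r //.
by move=> e; case/eqP: ba; apply: val_inj; rewrite /= ai.
Qed.

Variable x : nat -> L.

(** With x the eigenvalues of g from the top level down, these are the products
    that kill the upper part of the spectrum. *)
Fixpoint shifted_prod (j : nat) : A :=
  if j is i.+1 then (g - kp (x i)) * shifted_prod i else 1.
Local Notation X := shifted_prod.

Lemma shifted_prod_far b j : (b + j < N)%N -> E b * (X j * E N) = 0.
Proof.
elim: j b => [|j IH] b bj.
  by rewrite mul1r (tri_ortho tri) //; lia.
have b0 : E b * (X j * E N) = 0 by apply: IH; lia.
have pr0 : pr E b * (X j * E N) = 0.
  by rewrite prE; case: (b) bj => // b' bj; apply: IH; lia.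
rewrite /= -mulrA mulrBl mulrBr (kpR tri) b0 mulr0 subr0.
by rewrite mulrA (step_up pr0 b0) -mulrA IH ?mulr0 //; lia.
Qed.

Lemma shifted_prod_top j : (j <= N)%N -> E (N - j) * (X j * E N) = M (N - j) N.
Proof.
elim: j => [|j IH] jN; first by rewrite mul1r subn0 EE M_diag.
have e : (N - j = (N - j.+1).+1)%N by lia.
have b0 : E (N - j.+1) * (X j * E N) = 0 by apply: shifted_prod_far; lia.
have pr0 : pr E (N - j.+1) * (X j * E N) = 0.
  by rewrite prE; case: (N - j.+1)%N e => // b e; apply: shifted_prod_far; lia.
rewrite /= -mulrA mulrBl mulrBr (kpR tri) b0 mulr0 subr0.
rewrite mulrA (step_up pr0 b0) -mulrA -e IH; last by lia.
rewrite -[M _ _ in LHS](E_path (N - j) N) !e.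
by rewrite E_path path_up //; lia.
Qed.

(** To descend j levels with j + 1 factors, a path stands still exactly once, at one
    of the levels passed; hence a sum of diagonal terms. *)
Lemma shifted_prod_trace j : (j <= N)%N -> E (N - j) * (X j.+1 * E N) =
  kp (\sum_(i < j.+1) (t (N - i) - x i)) * M (N - j) N.
Proof.
elim: j => [|j IH] jN.
  rewrite big_ord_recr big_ord0 /= add0r subn0 mulr1 mulrBl mulrBr !(kpR tri).
  by rewrite M_diag mulrA (tri_diag tri) EE rmorphB mulrBl.
have e : (N - j = (N - j.+1).+1)%N by lia.
rewrite big_ord_recr /= -mulrA mulrBl mulrBr (kpR tri) -[(g - _) * X j]/(X j.+1).
rewrite shifted_prod_top // rmorphD rmorphB mulrDl mulrBl addrA; congr (_ - _).
rewrite mulrA (Eg_split tri) !mulrDl -e.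
rewrite -[X in X + _ + _]mulrA -[X in _ + X + _]mulrA -[X in _ + _ + X]mulrA.
rewrite shifted_prod_top // IH; last by lia.
rewrite prE (_ : (if (N - j.+1)%N is b.+1 then _ else _) = 0); last first.
  by case: (N - j.+1)%N e => // b e; rewrite shifted_prod_far //; lia.
rewrite mulr0 add0r (kpR tri) addrC e path_up; last by lia.
by rewrite -(E_path _ N) mulrA (tri_diag tri) -mulrA E_path.
Qed.

(** This is where the conjugacy of sigma_1 and sigma_2 enters. *)
Hypothesis spectral : forall c z, (c <= N)%N ->
  (forall r y, (r < c)%N -> E r * y * z = 0) -> X (N - c).+1 * z = 0.

(** If p kills the paths from N to the levels below c, then shifted_prod annihilates
    kp p * E N; the component of the product at level c is a multiple of the path
    from N to c, the factor being the difference of the traces of g and of x. *)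
Lemma trace_step c p : (c <= N)%N -> (forall r, (r < c)%N -> kp p * M r N = 0) ->
  kp (p * \sum_(i < (N - c).+1) (t (N - i) - x i)) * M c N = 0.
Proof.
move=> cN p0; have := @spectral c (kp p * E N) cN; rewrite (kpR tri) => h.
rewrite rmorphM -mulrA.
have e : (N - (N - c) = c)%N by lia.
have := @shifted_prod_trace (N - c) (leq_subr _ _); rewrite e => <-.
rewrite -(kpR tri) h ?mulr0 // => r y rc.
by rewrite (kpR tri); have [p' ->] := corner_path y r N; rewrite (kpR tri) p0 // mulr0.
Qed.

Variables (R V : nat -> L).
Hypotheses
  (traceR : forall c, (c <= N)%N -> exists u, u * \sum_(i < (N - c).+1) (t (N - i) - x i) = R c)
  (loopV : forall a, (a < N)%N -> exists u, u * U a = V a)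
  (bottom : kp (R 0%N) * E 0 = 0).

Lemma kill_scale u p y : kp p * y = 0 -> kp (u * p) * y = 0.
Proof. by move=> py; rewrite rmorphM -mulrA py mulr0. Qed.

Lemma kill_from_top c b : (b <= c)%N -> (c <= N)%N ->
  kp (\prod_(i < c.+1) R i) * M b N = 0.
Proof.
elim: c b => [|c IH] b bc cN.
  have [u uE] := traceR cN; rewrite big_ord_recr big_ord0 /= mul1r -uE.
  have := @trace_step 0 1 cN; rewrite mul1r (eqP (_ : b == 0%N)); last by lia.
  by move=> h; apply: kill_scale; apply: h.
have [->|bc'] := eqVneq b c.+1; last first.
  by rewrite big_ord_recr /= mulrC; apply/kill_scale/IH; lia.
have [u uE] := traceR cN; rewrite big_ord_recr /= -uE mulrCA.
by apply/kill_scale/trace_step => // r rc; apply: IH; lia.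
Qed.

(** A path from N to a followed back from N ends in a loop at a; each edge
    contributes its weight. *)
Lemma kill_E_above a : (a <= N)%N ->
  kp ((\prod_(i < a.+1) R i) * \prod_(a <= b < N) V b) * E a = 0.
Proof.
move=> aN; rewrite -M_diag.
suff: forall k, (k <= N - a)%N ->
    kp ((\prod_(i < a.+1) R i) * \prod_(N - k <= b < N) V b) * M a (N - k) = 0.
  by move/(_ (N - a)%N (leqnn _)); rewrite subKn.
elim=> [|k IH] ka.
  by rewrite subn0 big_geq // mulr1; apply: kill_from_top.
have e : (N - k = (N - k.+1).+1)%N by lia.
rewrite big_ltn; last by lia.
have [|u uE] := @loopV (N - k.+1); first by lia.
rewrite -e -uE mulrCA -[u * _ * _]mulrA; apply: kill_scale.
rewrite [U _ * _]mulrC rmorphM -mulrA -path_upr_loop; last by lia.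
by rewrite -e -[M _ _ * g * _]mulrA mulrA IH ?mul0r //; lia.
Qed.

(** The edges from 0 up to c contribute their weights. *)
Lemma kill_E_below c : (c <= N)%N -> kp (R 0%N * \prod_(b < c) V b) * E c = 0.
Proof.
elim: c => [|c IH] cN; first by rewrite big_ord0 mulr1.
have [u uE] := loopV cN.
rewrite big_ord_recr /= -uE mulrA mulrCA; apply: kill_scale.
rewrite rmorphM -mulrA -loopD -!mulrA -(kpR tri) -(kpR tri).
by rewrite [kp _ * (E c * _)]mulrA IH ?mul0r ?mulr0 //; lia.
Qed.

End ChainAlgebra.

(** * Spanning *)

Section Spanning.
Variables (K : fieldType) (q : K) (N : nat).
Hypothesis gq : generic q.
Let q0 : q != 0. Proof. by case: gq. Qed.
Local Notation qa a := (q ^ a%:Z).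

Lemma ucst_neq0 a : (a < N)%N -> ucst q N a != 0.
Proof.
move=> aN; rewrite /ucst oppr_eq0 mulf_neq0 ?invr_eq0 //.
  by rewrite mulf_neq0 // (br_neq0 gq) //; lia.
by rewrite !mulf_neq0 ?expf_neq0 ?(co_neq0 gq) // (br_neq0 gq) //; lia.
Qed.

Definition trace_cst (c : nat) : K := br q (N%:Z + 1 - c%:Z) / (br q 1 * co q c%:Z).

Lemma trace_cst_neq0 c : (c <= N)%N -> trace_cst c != 0.
Proof.
move=> cN; rewrite /trace_cst mulf_neq0 ?invr_eq0 ?mulf_neq0 ?(co_neq0 gq) //.
all: by apply: (br_neq0 gq); lia.
Qed.

(** The trace difference over the k upper levels telescopes to a single root. *)
Lemma trace_sum k : (k <= N.+1)%N ->
  \sum_(i < k) (tpol q N (N - i) - (th q (N - i))%:P) =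
  (br q k%:Z / (br q 1 * co q (N%:Z + 1 - k%:Z))) *:
    ('X - (chi q (N%:Z + (N%:Z + 1 - k%:Z) + (N%:Z + 1 - k%:Z)))%:P).
Proof.
elim: k => [|k IH] kN.
  by rewrite big_ord0 /br subrr mul0r scale0r.
rewrite big_ord_recr /= IH; last by lia.
have [c cE] : exists c, (N - k)%N = c by eexists.
have -> : k%:Z = N%:Z - c%:Z by lia.
rewrite cE (_ : k.+1%:Z = N%:Z + 1 - c%:Z); last by lia.
rewrite (_ : N%:Z + 1 - (N%:Z - c%:Z) = c%:Z + 1); last by ring.
rewrite (_ : N%:Z + 1 - (N%:Z + 1 - c%:Z) = c%:Z); last by ring.
apply: (poly_ext gq) => x; rewrite /tpol.
rewrite !(hornerD, hornerN, hornerM, hornerC, hornerX, hornerZ).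
rewrite th_qa // chs_qa // chi0E // !chi_co /br /co.
rewrite !(opprD, opprK, qzN, qzD gq, expr1z).
have := qz0 gq c%:Z; have := qz0 gq N%:Z.
have := co_neq0 gq c%:Z; have := co_neq0 gq (c%:Z + 1); rewrite /co !(opprD, qzN, qzD gq, expr1z).
have := th_chi0 gq c; rewrite th_qa // chi0E //.
move: (qa c) (qa N) => z y h1 h2 h3 y0 z0.
have s1 := sqr_neqN1 z0 h3.
have s2 := sqr_neqN1 (mulf_neq0 z0 q0) h2.
have s3 : q * q - 1 != 0.
  by apply: sqr_neq1 => //; have := br_neq0 gq (oner_neq0 int); rewrite /br qzN expr1z.
have s4 := chi_sum_neq0 q0 z0 h1.
by field; rewrite s1 s2 s3 s4 q0 y0 z0.
Qed.

Lemma toQuot_gen (S : set (freeAlg K bool)) i :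
  toQuot S (gen K i) = if i then sigma2 S else sigma1 S.
Proof. by case: i. Qed.

Section InQuotient.
Variable S : set (freeAlg K bool).
Hypothesis rS : As_quotient q N S.
Local Notation A := (quotAlg S).
Local Notation s1 := (sigma1 S).
Local Notation s2 := (sigma2 S).
Local Notation g2 := (gelt q N s2).
Local Notation kap := (kappa q N S).
Local Notation E := (idem q N s1).
Local Notation kp := (evq kap).
Local Opaque gelt idem pzinv sigma1 sigma2 evq toQuot kappa qpar chi qp th tpol
  quot_mul quot_scale quot_one.

Let tri := quot_tridiagonal gq rS.
Let lpU := loop_up gq rS.
Let lpD := loop_dn gq rS.
Local Notation span := (path_span kp N E g2).

Lemma span_scale k (x : A) : span x -> span (k *: x).
Proof. by rewrite (scale_kp q N); apply: path_spanZ. Qed.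

Lemma span_evq_g f (x : A) : span x -> span (evq g2 f * x).
Proof.
move=> Sx; elim/poly_ind: f => [|f k IH].
  by rewrite rmorph0 mul0r; apply: path_span0.
rewrite rmorphD rmorphM /= evqX evqC mulrDl quotZl mul1r.
apply: path_spanD (span_scale k Sx).
have -> : evq g2 f * g2 = g2 * evq g2 f by apply: evq_comm.
by rewrite -mulrA; apply: (path_span_g tri lpU lpD).
Qed.

Lemma sigma2_of_g2 : s2 = evq g2 (sum_lag N (th q) (qp q)).
Proof.
rewrite geltE evq_comp -[LHS](evqX s2).
apply: (evq_qp gq (nodal_s2 (quot_B3 rS))) => p pN.
by rewrite hornerX horner_comp !(sum_lagE _ (qp_inj gq)) // (sum_lagE _ (th_inj gq)).
Qed.

Lemma sigma1_mul (y : A) : s1 * y = \sum_(a < N.+1) qp q a *: (E a * y).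
Proof.
rewrite -[y in LHS]mul1r -(sumE gq rS) mulr_suml mulr_sumr.
by apply: eq_bigr => a _; rewrite mulrA (s1E gq rS) quotZl.
Qed.

(** The span of the paths contains 1 and is stable under left multiplication by
    sigma_1, which is diagonal, and by sigma_2, which is a polynomial in g2. *)
Lemma span_all (x : A) : span x.
Proof.
rewrite -[x]ofQuotK; elim/free_ind: (ofQuot x) => {x} [|x y Sx Sy|k x Sx|i x Sx].
- by rewrite (rmorph1 (@toQuot K bool S)); exact: (path_span1 tri).
- by rewrite (rmorphD (@toQuot K bool S)); apply: path_spanD.
- by rewrite toQuotZE; apply: span_scale.
rewrite (rmorphM (@toQuot K bool S)) /= toQuot_gen; case: i.
  by have := span_evq_g (sum_lag N (th q) (qp q)) Sx; rewrite -sigma2_of_g2.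
rewrite sigma1_mul; apply: path_span_sum => a.
by apply/span_scale/(path_span_E tri).
Qed.

Local Notation e2 := (idem q N s2).
Local Notation w := (s1 * s2).
Let wi := evq s2 (iota_poly q N) * evq s1 (iota_poly q N).

Let w_wi : w * wi = 1.
Proof.
rewrite /wi mulrA -[w * _]mulrA (mul_inv gq (nodal_s2 (quot_B3 rS))) mulr1.
exact: (mul_inv gq (nodal_s1 (quot_B3 rS))).
Qed.

(** By the braid relation, sigma_1 sigma_2 conjugates sigma_1 into sigma_2. *)
Lemma idem2_conj r : e2 r = w * E r * wi.
Proof.
have ww : w * s1 = s2 * w by rewrite (braid (quot_B3 rS)) mulrA.
by rewrite !idemE (evq_intertwine _ ww) -mulrA w_wi mulr1.
Qed.

Lemma evq_g2 f : evq g2 f = \sum_(r < N.+1) f.[th q r] *: e2 r.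
Proof.
rewrite geltE evq_comp.
transitivity (evq s2 (\sum_(r < N.+1) f.[th q r] *: lag N (qp q) r)).
  apply: (evq_qp gq (nodal_s2 (quot_B3 rS))) => p pN.
  rewrite horner_comp (sum_lagE _ (qp_inj gq)) //.
  exact/esym/(sum_lagE (fun r => f.[th q r]) (qp_inj gq)).
rewrite rmorph_sum; apply: eq_bigr => r _; rewrite /= evqZ.
by rewrite idemE.
Qed.

Local Notation lev := (fun i => (th q (N - i))%:P).

Definition level_poly (j : nat) : {poly K} := \prod_(i < j) ('X - (th q (N - i))%:P).

Lemma level_polyE j : shifted_prod kp g2 lev j = evq g2 (level_poly j).
Proof.
elim: j => [|j IH]; first by rewrite /level_poly big_ord0 rmorph1.
rewrite /= IH /level_poly big_ord_recr /= mulrC rmorphM rmorphB /= evqX.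
by rewrite !evqC.
Qed.

Lemma spectral_kill c (z : A) : (c <= N)%N ->
  (forall r y, (r < c)%N -> E r * y * z = 0) -> shifted_prod kp g2 lev (N - c).+1 * z = 0.
Proof.
move=> cN Ez; rewrite level_polyE evq_g2 mulr_suml big1 // => r _.
rewrite quotZl; have [rc|cr] := ltnP r c.
  by rewrite idem2_conj -[w * E r * wi]mulrA -[w * _ * z]mulrA Ez // mulr0 scaler0.
rewrite (_ : (level_poly _).[_] = 0) ?scale0r // /level_poly horner_prod.
have rN : (N - r < (N - c).+1)%N by lia.
rewrite (bigD1 (Ordinal rN)) //= subKn; last by rewrite -ltnS.
by rewrite !hornerE subrr mul0r.
Qed.

Let Rt b : {poly K} := 'X - (up_root q N b)%:P.
Let Vt b : {poly K} := rpol q N b.+1.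

Lemma trace_unit c : (c <= N)%N ->
  exists u, u * \sum_(i < (N - c).+1) (tpol q N (N - i) - lev i) = Rt c.
Proof.
move=> cN; exists ((trace_cst c)^-1)%:P; rewrite trace_sum; last by lia.
rewrite (_ : N%:Z + 1 - _ = c%:Z); last by lia.
rewrite (_ : (N - c).+1%:Z = N%:Z + 1 - c%:Z); last by lia.
by rewrite mul_polyC scalerA mulVf ?trace_cst_neq0 // scale1r.
Qed.

Lemma loop_unit a : (a < N)%N -> exists u, u * upol q N a = Vt a.
Proof.
move=> aN; exists ((ucst q N a)^-1)%:P.
by rewrite mul_polyC scalerA mulVf ?ucst_neq0 // scale1r.
Qed.

Lemma bottomR : kp (Rt 0) * E 0 = 0.
Proof. by rewrite /Rt /up_root !addr0; apply: (kappa_E0 gq rS). Qed.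

Lemma E_killed_above a : (a <= N)%N ->
  kp ((\prod_(i < a.+1) Rt i) * \prod_(a <= b < N) Vt b) * E a = 0.
Proof.
exact: (kill_E_above tri lpU span_all spectral_kill trace_unit loop_unit).
Qed.

Lemma E_killed_below c : (c <= N)%N -> kp (Rt 0 * \prod_(b < c) Vt b) * E c = 0.
Proof.
exact: (kill_E_below tri lpD loop_unit bottomR).
Qed.

Let Dt b : {poly K} := 'X - (dn_root q N b.+1)%:P.

Definition path_poly (lo k : nat) : {poly K} :=
  Rt 0 * \prod_(b < lo) Rt b.+1 * \prod_(b < k) Dt b.

(** Of degree maxpow + 1; Rt is the factor of an up_root, Dt that of a dn_root. *)
Definition path_killer (a c : nat) : {poly K} :=
  path_poly (minn a c) (minn (minn a c) (N - maxn a c)).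

(** dn_root b and dn_root b' agree for b + b' = N + 1, so the polynomial killing
    from above shares with the one killing from below the dn_root b.+1 with
    b < N - hi, and no other. *)
Lemma above_root b lo hi : (N - hi <= b)%N -> (b < lo)%N -> (lo <= hi)%N -> (hi <= N)%N ->
  ((\prod_(i < hi.+1) Rt i) * \prod_(hi <= i < N) Vt i).[dn_root q N b.+1] != 0.
Proof.
move=> Nb blo lohi hiN; rewrite hornerM mulf_neq0 //.
  rewrite horner_prod; apply/prodf_neq0 => i _.
  rewrite !hornerE; have iN := ltn_ord i.
  by rewrite (chi_neq gq) //; lia.
rewrite horner_prod prodf_seq_neq0; apply/allP => i; rewrite mem_index_iota /= => iN.
rewrite /Vt /rpol hornerM mulf_neq0 // !hornerE (chi_neq gq) //; lia.
Qed.

(** From the polynomial that kills from below, the roots not shared with the one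
    that kills from above can be removed one at a time. *)
Lemma path_poly_kill (y : A) lo hi k : (lo <= hi)%N -> (hi <= N)%N ->
  (minn lo (N - hi) <= k)%N -> (k <= lo)%N ->
  kp (path_poly lo lo) * y = 0 ->
  kp ((\prod_(i < hi.+1) Rt i) * \prod_(hi <= i < N) Vt i) * y = 0 ->
  kp (path_poly lo k) * y = 0.
Proof.
move=> lohi hiN; move e : (lo - k)%N => d; elim: d k e => [|d IH] k e kmin klo y1 y2.
  by rewrite (_ : k = lo) //; lia.
apply: (@rmorph_remove_root _ _ kp _ _ (dn_root q N k.+1) _ _ y2); last first.
  by apply: (@above_root k lo hi); lia.
rewrite (_ : _ * _ = path_poly lo k.+1); last by rewrite /path_poly big_ord_recr mulrA.
by apply: IH => //; lia.
Qed.

Local Notation M := (path_elt E g2).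

Lemma killed_below_poly c : path_poly c c = Rt 0 * \prod_(b < c) Vt b.
Proof. by rewrite /path_poly -mulrA -big_split. Qed.

Lemma kill_l p a (y : A) : kp p * E a = 0 -> kp p * (E a * y) = 0.
Proof. by move=> pE; rewrite mulrA pE mul0r. Qed.

Lemma kill_r p c (y : A) : kp p * E c = 0 -> kp p * (y * E c) = 0.
Proof. by move=> pE; rewrite -(kpR tri) pE mulr0. Qed.

Lemma path_killed a c : (a <= N)%N -> (c <= N)%N -> kp (path_killer a c) * M a c = 0.
Proof.
move=> aN cN; rewrite /path_killer; have [ac|ca] := leqP a c.
  apply: (path_poly_kill ac cN) => //; first exact: geq_minl.
    rewrite killed_below_poly /path_elt -mulrA; apply: kill_l; exact: E_killed_below.
  rewrite /path_elt; apply: kill_r; exact: E_killed_above.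
have ca' := ltnW ca.
apply: (path_poly_kill ca' aN) => //; first exact: geq_minl.
  rewrite killed_below_poly /path_elt; apply: kill_r; exact: E_killed_below.
rewrite /path_elt -mulrA; apply: kill_l; exact: E_killed_above.
Qed.

Lemma path_poly_size lo k : size (path_poly lo k) = (lo + k).+2.
Proof.
have m1 : \prod_(b < lo) Rt b.+1 \is monic.
  by apply: rpred_prod => i _; apply: monicXsubC.
have m2 : \prod_(b < k) Dt b \is monic.
  by apply: rpred_prod => i _; apply: monicXsubC.
have sz n : size (index_enum 'I_n) = n by rewrite [index_enum _]unlock -enumT -cardE card_ord.
rewrite /path_poly size_Mmonic ?mulf_neq0 ?monic_neq0 ?monicXsubC //.
rewrite size_Mmonic ?monic_neq0 ?monicXsubC // size_XsubC.
by rewrite !size_prod_XsubC !sz /=; lia.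
Qed.

Lemma path_killer_size a c : (a <= N)%N -> (c <= N)%N ->
  size (path_killer a c) = (maxpow N a c).+2.
Proof.
by move=> aN cN; rewrite path_poly_size /maxpow; congr _.+2; case: ifP; lia.
Qed.

Lemma path_reduce p a c : (a <= N)%N -> (c <= N)%N -> exists r : nat -> K,
  kp p * M a c = \sum_(i < (maxpow N a c).+1) r i *: (M a c * kap ^+ i).
Proof.
move=> aN cN; exists (fun i => (p %% path_killer a c)`_i).
rewrite (rmorph_reduce (kpC rS) p (path_killer_size aN cN) (path_killed aN cN)).
by apply: eq_bigr => i _; rewrite /= evqX (scale_kp q N).
Qed.

Lemma basis_spans (y : A) : exists c : basis_index N -> K,
  y = \sum_i c i *: (M (tag i).1 (tag i).2 * kap ^+ (tagged i : nat)).
Proof.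
have [P ->] := span_all y.
have /fin_all_exists[r rE] : forall ac : 'I_N.+1 * 'I_N.+1, exists r : nat -> K,
  kp (P ac.1 ac.2) * M ac.1 ac.2 =
    \sum_(i < (maxpow N ac.1 ac.2).+1) r i *: (M ac.1 ac.2 * kap ^+ i).
  by move=> [a c]; apply: path_reduce; rewrite -ltnS.
exists (fun i : basis_index N => r (tag i) (nat_of_ord (tagged i))).
rewrite pair_big /= (eq_bigr _ (fun ac _ => rE ac)).
by rewrite sig_big_dep.
Qed.

End InQuotient.
End Spanning.

(** * Representations from Askey-Wilson triples *)

Lemma horner_algZ (K : fieldType) (T : algType K) (x : T) c p :
  horner_alg x (c *: p) = c *: horner_alg x p.
Proof. by rewrite -mul_polyC rmorphM /= horner_algC -scalerAl mul1r. Qed.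

Lemma rmorph_braid (A B : pzRingType) (f : {rmorphism A -> B}) x y :
  f (x * y * x - y * x * y) = f x * f y * f x - f y * f x * f y.
Proof. by rewrite rmorphB !rmorphM. Qed.

Section Evaluation.
Variables (K : fieldType) (N : nat) (T : algType K).
Variables (lam : nat -> K) (X : T).
Hypothesis lam_inj : forall a c, (a <= N)%N -> (c <= N)%N -> lam a = lam c -> a = c.
Hypothesis X0 : horner_alg X (nodal N lam) = 0.

Lemma horner_agree (f f' : {poly K}) :
  (forall p, (p <= N)%N -> f.[lam p] = f'.[lam p]) -> horner_alg X f = horner_alg X f'.
Proof.
move=> ff'; apply/eqP; rewrite -subr_eq0 -rmorphB; apply/eqP.
have /dvdpP[h ->] : nodal N lam %| f - f'.
  by apply: nodal_dvd => // p pN; rewrite hornerD hornerN ff' // subrr.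
by rewrite rmorphM /= X0 mulr0.
Qed.

Definition eproj (r : nat) : T := horner_alg X (lag N lam r).

Lemma eproj_poly f a : horner_alg X f * eproj a = f.[lam a] *: eproj a.
Proof.
rewrite /eproj -rmorphM -horner_algZ; apply: horner_agree => p pN.
rewrite hornerM hornerZ (lagE lam_inj) //.
by case: eqP => [->|_]; rewrite ?mulr1 ?mulr0.
Qed.

Lemma poly_eproj f a : eproj a * horner_alg X f = f.[lam a] *: eproj a.
Proof. by rewrite -eproj_poly /eproj -!rmorphM mulrC. Qed.

Lemma X_eproj a : X * eproj a = lam a *: eproj a.
Proof. by have := eproj_poly 'X a; rewrite horner_algX hornerX. Qed.

Lemma eproj_X a : eproj a * X = lam a *: eproj a.
Proof. by have := poly_eproj 'X a; rewrite horner_algX hornerX. Qed.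

Lemma eproj_idem a : eproj a * eproj a = eproj a.
Proof.
rewrite /eproj -rmorphM; apply: horner_agree => p pN.
by rewrite hornerM !(lagE lam_inj) //; case: eqP; rewrite ?mulr1 ?mulr0.
Qed.

Lemma eproj_ortho a c : a <> c -> eproj a * eproj c = 0.
Proof.
move=> ac; rewrite /eproj -rmorphM -(rmorph0 (horner_alg X)); apply: horner_agree => p pN.
rewrite hornerM !(lagE lam_inj) // horner0.
by case: eqP => [->|_]; rewrite ?mul0r //; case: eqP => // _; rewrite mulr0.
Qed.

Lemma eproj_sum : \sum_(a < N.+1) eproj a = 1.
Proof.
rewrite /eproj -rmorph_sum -(rmorph1 (horner_alg X)); apply: horner_agree => p pN.
have := @sum_lagE _ N lam (fun=> 1) p lam_inj pN.
rewrite /sum_lag !horner_sum hornerC => <-.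
by apply: eq_bigr => i _; rewrite scale1r.
Qed.

Lemma eproj_eq (x y : T) :
  (forall a c, eproj a * x * eproj c = eproj a * y * eproj c) -> x = y.
Proof.
move=> xy; rewrite -[x]mul1r -[y]mul1r -[1 * x]mulr1 -[1 * y]mulr1 -eproj_sum.
rewrite !mulr_suml; apply: eq_bigr => a _; rewrite !mulr_sumr.
by apply: eq_bigr => c _; apply: xy.
Qed.

End Evaluation.

Section AskeyWilson.
Variables (K : fieldType) (q : K) (N : nat).
Hypothesis gq : generic q.
Let q0 : q != 0. Proof. by case: gq. Qed.
Variable T : algType K.

(** The polynomial in g_i whose value is sigma_i. *)
Definition sigma_poly := sum_lag N (th q) (qp q).

Definition aw_comm (x y : T) : T := hw q *: (q *: (x * y) - q^-1 *: (y * x)).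

(** The values qp of sigma are tuned to the eigenvalues th of g: the ratio at
    neighbouring levels is the one that the relations force. *)
Lemma neighbour_ratio a : qp q a.+1 + hw q * (q * th q a.+1 - q^-1 * th q a) * qp q a = 0.
Proof.
have r : qp q a.+1 = - (q ^ a%:Z * q ^ a%:Z * q * q) * qp q a.
  by rewrite -qp_ratio // divfK // qp_neq0.
rewrite r -mulrDl !th_qa // qaS // /hw; have x0 := qz0 gq a%:Z.
have := q2q2 gq; rewrite (_ : q ^+ 2 - q ^- 2 = (q ^+ 4 - 1) / q ^+ 2); last by field.
rewrite mulf_eq0 negb_or => /andP[s _].
move: (q ^ a%:Z) x0 => x x0; rewrite [X in X * _](_ : _ = 0) ?mul0r //.
by field; rewrite x0 q0 s.
Qed.

Lemma neighbour_ratioV a : qp q a + hw q * (q * th q a - q^-1 * th q a.+1) * qp q a.+1 = 0.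
Proof.
have r : qp q a.+1 = - (q ^ a%:Z * q ^ a%:Z * q * q) * qp q a.
  by rewrite -qp_ratio // divfK // qp_neq0.
rewrite r mulrA -[X in X + _]mul1r -mulrDl !th_qa // qaS // /hw; have x0 := qz0 gq a%:Z.
have := q2q2 gq; rewrite (_ : q ^+ 2 - q ^- 2 = (q ^+ 4 - 1) / q ^+ 2); last by field.
rewrite mulf_eq0 negb_or => /andP[s _].
move: (q ^ a%:Z) x0 => x x0; rewrite [X in X * _](_ : _ = 0) ?mul0r //.
by field; rewrite x0 q0 s.
Qed.

Variables (X Y Y' : T) (Z : K).
Hypothesis X0 : horner_alg X (nodal N (th q)) = 0.
Hypotheses (aw_Y' : aw_comm X Y + Y' = Z%:A) (aw_Y : aw_comm Y' X + Y = Z%:A).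
Local Notation e := (eproj N (th q) X).
Hypothesis e0 : e 0 * Y * e 0 = (Z / 2%:R) *: e 0.
Let tinj := @th_inj K q N gq.

Let sand_XY a c (x : T) : e a * (X * x) * e c = th q a *: (e a * x * e c).
Proof. by rewrite mulrA eproj_X // !scalerAl. Qed.
Let sand_YX a c (x : T) : e a * (x * X) * e c = th q c *: (e a * x * e c).
Proof. by rewrite -!mulrA X_eproj // !scalerAr. Qed.

Let eq1 a c : (hw q * (q * th q a - q^-1 * th q c)) *: (e a * Y * e c) + e a * Y' * e c
  = Z *: (e a * e c).
Proof.
have := congr1 (fun x => e a * x * e c) aw_Y'; rewrite /aw_comm.
rewrite mulrDr mulrDl -scalerAr -scalerAl mulrBr mulrBl -!scalerAr -!scalerAl.
rewrite sand_XY sand_YX mulr1 !scalerA -scalerBl scalerA => <-.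
by [].
Qed.

Let eq2 a c : (hw q * (q * th q c - q^-1 * th q a)) *: (e a * Y' * e c) + e a * Y * e c
  = Z *: (e a * e c).
Proof.
have := congr1 (fun x => e a * x * e c) aw_Y; rewrite /aw_comm.
rewrite mulrDr mulrDl -scalerAr -scalerAl mulrBr mulrBl -!scalerAr -!scalerAl.
rewrite sand_XY sand_YX mulr1 !scalerA -scalerBl scalerA => <-.
by [].
Qed.

Lemma aw_far a c : (a.+1 < c)%N || (c.+1 < a)%N -> e a * Y * e c = 0.
Proof.
move=> far; have ac : a <> c by lia.
have := eq1 a c; have := eq2 a c; rewrite eproj_ortho // scaler0.
move=> h2 /eqP; rewrite addrC addr_eq0 => /eqP h1.
move: h2; rewrite h1 scalerN scalerA -[X in _ + X]scale1r -scaleNr -scalerDl.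
set d := - _ + 1 => h; have d0 : d != 0.
  have hw0 : hw q != 0 by rewrite invr_eq0 q2q2.
  have -> : d = - (hw q ^+ 2) * ((q * th q a - q^-1 * th q c) * (q * th q c - q^-1 * th q a)
    - (q ^+ 2 - q ^- 2) ^+ 2).
    rewrite /d /hw; have := q2q2 gq; move: (q ^+ 2 - q ^- 2) => v v0.
    by field; rewrite v0 q0.
  rewrite mulf_neq0 ?oppr_eq0 ?expf_neq0 //.
  have := w_det gq a%:Z c%:Z; rewrite -!PoszD !addnn -!mul2n -/(th q a) -/(th q c) => ->.
  by rewrite oppr_eq0 !mulf_neq0 // (br_neq0 gq) //; lia.
by move/eqP: h; rewrite scaler_eq0 (negPf d0) => /eqP.
Qed.

(** The two relations give (1 - th a / chi_0) (y' - y) = 0 for the diagonal corners,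
    which settles a > 0; at a = 0, where th 0 = chi_0, hypothesis e0 is what is
    missing. *)
Lemma aw_diag a : e a * Y' * e a = e a * Y * e a.
Proof.
have := eq1 a a; have := eq2 a a; rewrite eproj_idem //.
have u0 := qq0 gq.
have -> : hw q * (q * th q a - q^-1 * th q a) = th q a / (q + q^-1).
  have v0 : q - q^-1 != 0 by have := br_neq0 gq (oner_neq0 int); rewrite /br qzN expr1z.
  rewrite /hw (_ : q ^+ 2 - q ^- 2 = (q - q^-1) * (q + q^-1)); last by field.
  have -> : q * th q a - q^-1 * th q a = (q - q^-1) * th q a by ring.
  by move: (q - q^-1) (q + q^-1) u0 v0 => v u u0 v0; field; rewrite u0 v0.
have [->|a0] := eqVneq a 0%N.
  rewrite e0 -[th q 0]/(chi q 0) chi0E // mulfV // scale1r => _.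
  have two0 : (2%:R : K) != 0 by case: gq.
  rewrite scale1r => h1; apply: (addrI ((Z / 2%:R) *: e 0)); rewrite h1 -scalerDl.
  by congr (_ *: _); field.
move=> h2 h1; have d0 : 1 - th q a / (q + q^-1) != 0.
  rewrite -chi0E // subr_eq0 eq_sym; apply/eqP => h.
  have := @th_neq _ _ gq a 0; rewrite -[th q 0]/(chi q 0) subr_eq0.
  move=> /(_ _)/eqP; apply; first by apply/eqP.
  by rewrite -[chi q 0]mul1r -h divfK ?(chi_neq0 gq).
move: (e a * Y * e a) (e a * Y' * e a) (th q a / _) h1 h2 d0 => y y' r h1 h2 d0.
have : (1 - r) *: (y' - y) = 0.
  by rewrite scalerBl scale1r scalerBr opprB addrACA
    [y' + _]addrC [- y - _]addrC -opprD h1 h2 subrr.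
by move/eqP; rewrite scaler_eq0 (negPf d0) subr_eq0 => /eqP.
Qed.

(** If X, Y and Y' satisfy two of the three Askey-Wilson relations, the
    interpolating polynomial in X that plays the role of sigma conjugates Y into Y':
    the corners of Y' are those of Y multiplied by the ratios of the qp. *)
Lemma aw_sigma : horner_alg X sigma_poly * Y = Y' * horner_alg X sigma_poly.
Proof.
apply: (eproj_eq tinj X0) => a c.
have [aN|aN] := leqP a N; last first.
  have -> : e a = 0; last by rewrite !mul0r.
  rewrite /eproj -(rmorph0 (horner_alg X)); apply: (horner_agree tinj X0) => p pN.
  by rewrite (lagE tinj) // horner0; case: eqP => // pa; move: pN; rewrite pa leqNgt aN.
have [cN|cN] := leqP c N; last first.
  have -> : e c = 0; last by rewrite !mulr0.
  rewrite /eproj -(rmorph0 (horner_alg X)); apply: (horner_agree tinj X0) => p pN.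
  by rewrite (lagE tinj) // horner0; case: eqP => // pa; move: pN; rewrite pa leqNgt cN.
rewrite [e a * (_ * Y)]mulrA (poly_eproj tinj X0) -!scalerAl.
rewrite -[e a * (Y' * _) * _]mulrA -[Y' * _ * _]mulrA (eproj_poly tinj X0) -!scalerAr.
rewrite !(sum_lagE _ tinj) // [e a * (Y' * _)]mulrA.
have [<-|ac] := eqVneq a c; first by rewrite aw_diag.
have := eq1 a c; rewrite (eproj_ortho tinj X0); last exact/eqP.
rewrite scaler0 addrC => /eqP; rewrite addr_eq0 => /eqP ->.
have [far|near] := boolP ((a.+1 < c)%N || (c.+1 < a)%N).
  by rewrite aw_far // !(scaler0, oppr0).
rewrite scalerN scalerA -scaleNr; congr (_ *: _); apply/eqP; rewrite -addr_eq0; apply/eqP.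
have [->|->] : a = c.+1 \/ c = a.+1 by move/eqP: ac; lia.
  by rewrite mulrC; have := neighbour_ratio c; rewrite [_ * qp q c]mulrC.
by have := neighbour_ratioV a; rewrite [_ * qp q a.+1]mulrC.
Qed.

End AskeyWilson.

(** A triple of elements satisfying the Askey-Wilson relations, with kappa
    acting by a scalar k, gives a representation of As: the generators sigma_1 and
    sigma_2 are interpolating polynomials in G1 and G2. *)
Section Representation.
Variables (K : fieldType) (q : K) (N : nat).
Hypothesis gq : generic q.
Let q0 : q != 0. Proof. by case: gq. Qed.
Variable T : algType K.
Variables (G1 G2 G3 : T) (k : K).
Let Z := chs q N / chi q 0 * (k + chs q N).
Local Notation sigma f := (horner_alg f (sigma_poly q N)).
Local Notation S1 := (sigma G1).
Local Notation S2 := (sigma G2).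

Record aw_triple : Prop := AWTriple {
  aw_G1 : horner_alg G1 (nodal N (th q)) = 0;
  aw_G2 : horner_alg G2 (nodal N (th q)) = 0;
  aw_12 : aw_comm q G1 G2 + G3 = Z%:A;
  aw_23 : aw_comm q G2 G3 + G1 = Z%:A;
  aw_31 : aw_comm q G3 G1 + G2 = Z%:A;
  aw_casimir : (chs q N * (k + chs q N)) *: (q *: G1 + q^-1 *: G2 + q *: G3)
    - q ^+ 2 *: G1 ^+ 2 - q ^- 2 *: G2 ^+ 2 - q ^+ 2 *: G3 ^+ 2 - q *: (G1 * (G2 * G3))
    = (k * (k + chs q N ^+ 3) + (3 * chs q N ^+ 2 - chi q 0 ^+ 2))%:A;
  aw_bottom1 : let e := eproj N (th q) G1 0 in e * G2 * e = (Z / 2%:R) *: e;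
  aw_bottom2 : let e := eproj N (th q) G2 0 in e * G1 * e = (Z / 2%:R) *: e;
  aw_bottom : let e := eproj N (th q) G1 0 in e * G2 * e = (chs q N ^+ 2 / chi q 0) *: e }.

Hypothesis H : aw_triple.
Let tinj := @th_inj K q N gq.

Lemma rep_S1G2 : S1 * G2 = G3 * S1.
Proof. exact: (aw_sigma gq (aw_G1 H) (aw_12 H) (aw_31 H) (aw_bottom1 H)). Qed.

Local Notation e := (eproj N (th q) G2 0).

Lemma bottom23 : e * G3 * e = (Z / 2%:R) *: e.
Proof.
have b : e * G1 * e = (Z / 2%:R) *: e := aw_bottom2 H.
have := congr1 (fun x => e * x * e) (aw_23 H); rewrite /aw_comm.
rewrite mulrDr mulrDl b -scalerAr -scalerAl mulrBr mulrBl -!scalerAr -!scalerAl mulr1.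
rewrite [e * (G2 * _)]mulrA -[e * (G3 * G2) * e]mulrA -[G3 * G2 * e]mulrA.
rewrite (X_eproj tinj (aw_G2 H)) (eproj_X tinj (aw_G2 H)) -!scalerAr -!scalerAl.
have eA : e * (G3 * e) = e * G3 * e by rewrite mulrA.
rewrite eA (eproj_idem tinj (aw_G2 H)) -[th q 0]/(chi q 0) !scalerA -scalerBl scalerA.
have u0 := qq0 gq; have v0 : q - q^-1 != 0.
  by have := br_neq0 gq (oner_neq0 int); rewrite /br qzN expr1z.
have -> : hw q * (q * chi q 0 - q^-1 * chi q 0) = 1.
  rewrite /hw chi0E // (_ : q ^+ 2 - q ^- 2 = (q - q^-1) * (q + q^-1)); last by field.
  rewrite -mulrBl; move: (q - q^-1) (q + q^-1) u0 v0 => v u u0 v0; field; rewrite u0 v0.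
  by [].
rewrite scale1r => h; apply: (addIr ((Z / 2%:R) *: e)); rewrite h -scalerDl.
have two0 : (2%:R : K) != 0 by case: gq.
by congr (_ *: _); field.
Qed.

Lemma rep_S2G3 : S2 * G3 = G1 * S2.
Proof. exact: (aw_sigma gq (aw_G2 H) (aw_23 H) (aw_12 H) bottom23). Qed.

Lemma horner_intertwine (w x y : T) p :
  w * x = y * w -> w * horner_alg x p = horner_alg y p * w.
Proof.
move=> wx; elim/poly_ind: p => [|p c IH]; first by rewrite !rmorph0 mul0r mulr0.
rewrite !rmorphD !rmorphM /= !horner_algX !horner_algC mulrDr mulrDl.
by rewrite mulrA IH -!mulrA wx -scalerAl -scalerAr mul1r mulr1.
Qed.

(** sigma G1 conjugates G2 into G3, and sigma G2 conjugates G3 into G1. *)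
Lemma rep_braid : S1 * S2 * S1 = S2 * S1 * S2.
Proof.
have e1 : S1 * S2 = sigma G3 * S1 := horner_intertwine _ rep_S1G2.
have e2 : S2 * sigma G3 = S1 * S2 := horner_intertwine _ rep_S2G3.
by rewrite -[RHS]mulrA e1 [RHS]mulrA e2 -e1.
Qed.

Lemma horner_comp_alg (x : T) p p' :
  horner_alg (horner_alg x p) p' = horner_alg x (p' \Po p).
Proof.
elim/poly_ind: p' => [|p' c IH]; first by rewrite comp_poly0 !rmorph0.
by rewrite rmorphD rmorphM /= horner_algX horner_algC IH comp_polyD comp_polyM comp_polyX
   comp_polyC rmorphD rmorphM /= horner_algC.
Qed.

Lemma nodal0 lam p : (p <= N)%N -> (nodal N lam).[lam p] = 0 :> K.
Proof.
move=> pN; rewrite /nodal horner_prod.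
have pE : (inord p : 'I_N.+1) = p :> nat by rewrite inordK.
by rewrite (bigD1 (inord p)) //= pE !hornerE subrr mul0r.
Qed.

Let sigma_at p : (p <= N)%N -> (sigma_poly q N).[th q p] = qp q p.
Proof. by move=> pN; rewrite (sum_lagE _ tinj). Qed.

Lemma sigma_nodal (G : T) : horner_alg G (nodal N (th q)) = 0 ->
  horner_alg (sigma G) (nodal N (qp q)) = 0.
Proof.
move=> G0; rewrite horner_comp_alg -(rmorph0 (horner_alg G)).
by apply: (horner_agree tinj G0) => p pN; rewrite horner_comp sigma_at // nodal0 ?horner0.
Qed.

Lemma sigma_th (G : T) : horner_alg G (nodal N (th q)) = 0 ->
  horner_alg (sigma G) (sum_lag N (qp q) (th q)) = G.
Proof.
move=> G0; rewrite horner_comp_alg -[RHS]horner_algX.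
apply: (horner_agree tinj G0) => p pN.
by rewrite horner_comp sigma_at // (sum_lagE _ (qp_inj gq)) // hornerX.
Qed.

Lemma sigma_proj (G : T) r : horner_alg G (nodal N (th q)) = 0 ->
  horner_alg (sigma G) (lag N (qp q) r) = eproj N (th q) G r.
Proof.
move=> G0; rewrite horner_comp_alg; apply: (horner_agree tinj G0) => p pN.
by rewrite horner_comp sigma_at // (lagE (qp_inj gq)) // (lagE tinj).
Qed.

Definition rep0 : freeAlg K bool -> T := freeval (fun b : bool => if b then S2 else S1).
HB.instance Definition _ := GRing.RMorphism.on rep0.

Lemma rep0_gen b : rep0 (gen K b) = if b then S2 else S1.
Proof. exact: freeval_gen. Qed.

Lemma rep0_nodal b : rep0 (\prod_(p < N.+1) (gen K b - qp q p *: (1 : freeAlg K bool))) = 0.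
Proof.
rewrite rmorph_prod /=.
transitivity (horner_alg (if b then S2 else S1) (nodal N (qp q))).
  rewrite /nodal rmorph_prod /=; apply: eq_bigr => p _.
  rewrite !rmorphB /= horner_algX horner_algC rep0_gen; congr (_ - _).
  by rewrite /rep0 freevalZ rmorph1.
by case: b; apply: sigma_nodal; [exact: aw_G2 H|exact: aw_G1 H].
Qed.

Lemma rep0_B3 x : B3_presentation q N x -> rep0 x = 0.
Proof.
case=> ->; [|exact: rep0_nodal|exact: rep0_nodal].
apply: (etrans (rmorph_braid rep0 _ _)).
by rewrite /= !rep0_gen rep_braid subrr.
Qed.

Section OnQuotient.
Variable S : set (freeAlg K bool).
Hypotheses (BS : forall x, B3_presentation q N x -> S x) (S0 : forall x, S x -> rep0 x = 0).

(** Parametrised by S, so that it serves for B3, AWB3 and As in turn: the relations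
    of each algebra are verified on the representation of the one before. *)
Definition rep : quotAlg S -> T := qlift rep0.
HB.instance Definition _ := GRing.isZmodMorphism.Build (quotAlg S) T
  rep (qlift_is_zmod_morphism S0).
HB.instance Definition _ := GRing.isMonoidMorphism.Build (quotAlg S) T
  rep (qlift_is_monoid_morphism S0).

Lemma repE x : rep (toQuot S x) = rep0 x.
Proof. exact: (qliftE S0). Qed.

Lemma repD x y : rep (x + y) = rep x + rep y. Proof. exact: rmorphD. Qed.
Lemma repM x y : rep (x * y) = rep x * rep y. Proof. exact: rmorphM. Qed.

Lemma repZ c x : rep (c *: x) = c *: rep x.
Proof. by rewrite -[x]ofQuotK -toQuotZE !repE /rep0 freevalZ. Qed.

Lemma rep_evq x p : rep (evq x p) = horner_alg (rep x) p.
Proof.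
elim/poly_ind: p => [|p c IH]; first by rewrite !rmorph0.
by rewrite !rmorphD !rmorphM /= evqX evqC IH horner_algX horner_algC repZ rmorph1.
Qed.

Lemma rep_sigma1 : rep (sigma1 S) = S1.
Proof. by rewrite /sigma1 repE rep0_gen. Qed.
Lemma rep_sigma2 : rep (sigma2 S) = S2.
Proof. by rewrite /sigma2 repE rep0_gen. Qed.

Lemma rep_g1 : rep (gelt q N (sigma1 S)) = G1.
Proof. by rewrite geltE rep_evq rep_sigma1 sigma_th //; exact: aw_G1 H. Qed.
Lemma rep_g2 : rep (gelt q N (sigma2 S)) = G2.
Proof. by rewrite geltE rep_evq rep_sigma2 sigma_th //; exact: aw_G2 H. Qed.

Lemma rep_idem r : rep (idem q N (sigma1 S) r) = eproj N (th q) G1 r.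
Proof. by rewrite idemE rep_evq rep_sigma1 sigma_proj //; exact: aw_G1 H. Qed.

Lemma rep_conj x y : S1 * x = y * S1 -> S1 * x * rep (pzinv (sigma1 S)) = y.
Proof.
move=> ->; rewrite -mulrA -rep_sigma1 -rmorphM.
by rewrite (pzinv_s gq (nodal_s1 BS)) (mul_inv gq (nodal_s1 BS)) rmorph1 mulr1.
Qed.

Lemma rep_g13 :
  rep (sigma1 S * gelt q N (sigma2 S) * pzinv (sigma1 S)) = G3.
Proof. rewrite !rmorphM /= rep_sigma1 rep_g2; exact: rep_conj rep_S1G2. Qed.

Lemma rep_aw_comm x y : hw q *: rep (qcomm q x y) = aw_comm q (rep x) (rep y).
Proof. by rewrite /qcomm rmorphB /= !repZ !rmorphM. Qed.

Lemma rep_aw1 : rep (aw1 q N S) = Z%:A.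
Proof. by rewrite /aw1 rmorphD /= repZ rep_aw_comm rep_g13 rep_g1 rep_g2 (aw_12 H). Qed.
Lemma rep_aw2 : rep (aw2 q N S) = Z%:A.
Proof. by rewrite /aw2 rmorphD /= repZ rep_aw_comm rep_g13 rep_g1 rep_g2 (aw_23 H). Qed.
Lemma rep_aw3 : rep (aw3 q N S) = Z%:A.
Proof. by rewrite /aw3 rmorphD /= repZ rep_aw_comm rep_g13 rep_g1 rep_g2 (aw_31 H). Qed.

Lemma rep_kappa : rep (kappa q N S) = k%:A.
Proof.
rewrite /kappa rmorphB /= !repZ rep_aw1 rmorph1 scalerA -scalerBl; congr (_ *: _).
rewrite /Z -chi0E // -/(chs q N); have := chs0 N gq; have := chi_neq0 gq 0.
by move: (chs q N) (chi q 0) => x y y0 x0; field; rewrite x0 y0.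
Qed.

Lemma rep_Omega : rep (Omega q N S) =
  (k * (k + chs q N ^+ 3) + (3 * chs q N ^+ 2 - chi q 0 ^+ 2))%:A.
Proof.
rewrite -(aw_casimir H) /Omega -/(chs q N).
have -> : gelt q N (sigma1 S) * gelt q N (sigma2 S) * sigma1 S * gelt q N (sigma2 S)
    * pzinv (sigma1 S) = gelt q N (sigma1 S) * (gelt q N (sigma2 S) *
    (sigma1 S * gelt q N (sigma2 S) * pzinv (sigma1 S))) by rewrite !mulrA.
rewrite !rmorphB /= !repZ [rep (_ * (_ + _ + _))]rmorphM /= !repZ.
rewrite [rep (_ + (chs q N) *: _)]rmorphD /= repZ rep_kappa rmorph1.
have gX (x : quotAlg S) y : rep x = y -> rep (x ^+ 2) = y ^+ 2.
  by move=> <-; rewrite rmorphXn.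
rewrite (gX _ _ rep_g1) (gX _ _ rep_g2).
have -> : rep (sigma1 S * gelt q N (sigma2 S) ^+ 2 * pzinv (sigma1 S)) = G3 ^+ 2.
  rewrite !rmorphM /= rep_sigma1 rep_g2; apply: rep_conj.
  by rewrite expr2 mulrA rep_S1G2 -mulrA rep_S1G2 mulrA.
rewrite 2!repD !repZ rep_g13 rep_g1 rep_g2 repM repM rep_g13 rep_g1 rep_g2.
by rewrite -scalerDl scalerA -scalerAl mul1r.
Qed.

End OnQuotient.

Lemma rep0_AWB3 x : AWB3_presentation q N x -> rep0 x = 0.
Proof.
case=> [/rep0_B3 //|]; rewrite /preimage /= -(repE rep0_B3).
have repB (u v : quotAlg (B3_presentation q N)) : rep (u - v) = rep u - rep v.
  exact: (qlift_is_zmod_morphism rep0_B3).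
have a1 := rep_aw1 (fun=> id) rep0_B3.
case=> [->|->|[y ->]]; rewrite repB.
- by rewrite a1 (rep_aw2 (fun=> id) rep0_B3) subrr.
- by rewrite a1 (rep_aw3 (fun=> id) rep0_B3) subrr.
by rewrite !(repM rep0_B3) a1 -scalerAl -scalerAr mul1r mulr1 subrr.
Qed.

Lemma rep0_As x : As_presentation q N x -> rep0 x = 0.
Proof.
case=> [/rep0_AWB3 //|]; rewrite /preimage /= -(repE rep0_AWB3).
have repB (u v : quotAlg (AWB3_presentation q N)) : rep (u - v) = rep u - rep v.
  exact: (qlift_is_zmod_morphism rep0_AWB3).
have rep1 : rep (1 : quotAlg (AWB3_presentation q N)) = 1.
  exact: (qlift_is_monoid_morphism rep0_AWB3).1.
case=> ->; rewrite repB.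
  rewrite (rep_Omega (@B3_AWB3 _ _ _) rep0_AWB3) (repD rep0_AWB3) (repM rep0_AWB3).
  rewrite (repD rep0_AWB3) !(repZ rep0_AWB3) rep1 (rep_kappa (@B3_AWB3 _ _ _) rep0_AWB3).
  by rewrite -/(chs q N) -!scalerDl -scalerAl mul1r scalerA -scalerDl subrr.
rewrite !(repM rep0_AWB3) !(repZ rep0_AWB3) (rep_idem rep0_AWB3) (rep_g2 rep0_AWB3).
by rewrite (aw_bottom H) subrr.
Qed.

End Representation.

(** * Split matrices *)

(** The matrices of the representations are truncations of difference operators
    on sequences over the integers, where x i = q^i is invertible and each relation
    becomes one identity between rational functions in q, A, B and x. *)
Section Operators.
Variables (K : fieldType) (q A B : K).
Hypotheses (q0 : q != 0) (A0 : A != 0) (B0 : B != 0)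
  (q4 : (q * q) ^+ 2 - 1 != 0) (qq1 : q * q + 1 != 0).
Local Notation v z := (z - z^-1).
Local Notation c z := (z + z^-1).
Let x (i : int) := q ^ i.

Definition desc (i : int) : K := c (B * B / (x i * x i * q)).
Definition asc (i : int) : K := c (A * A * x i * x i * q).
(** It vanishes at i = 0 and at the end of the chain, so that the operators may be
    truncated; as op1 is lower and op2 upper bidiagonal, their spectra are visible. *)
Definition split_coef (i : int) : K :=
  v (x i) * v (B / (A * x i)) * v (A * x i) * v (B / x i).
Definition awZ : K := c A * c B * c (A * B) / c q.

Definition op1 (f : int -> K) i := desc i * f i + f (i - 1).
Definition op2 (f : int -> K) i := asc i * f i + split_coef (i + 1) * f (i + 1).
Definition op_comm (g h : (int -> K) -> int -> K) f i :=
  hw q * (q * g (h f) i - q^-1 * h (g f) i).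
(** Defined by the first relation. *)
Definition op3 f i := awZ * f i - op_comm op1 op2 f i.

Let xD i : x (i + 1) = x i * q. Proof. by rewrite /x expfzDr // expr1z. Qed.
Let xB i : x (i - 1) = x i / q. Proof. by rewrite /x expfzDr. Qed.

Lemma op3E f i : op3 f i = - (A * A * x i * x i)^-1 * f (i - 1)
  + (awZ - hw q * ((q - q^-1) * desc i * asc i + q * split_coef i
       - q^-1 * split_coef (i + 1))) * f i
  - split_coef (i + 1) * B * B / (x i * x i * q * q) * f (i + 1).
Proof.
rewrite /op3 /op_comm /op1 /op2 !(addrK, subrK).
move: (split_coef i) (split_coef (i + 1)) awZ => p p' z.
rewrite /desc /asc /hw !(xD, xB).
have := expfz_neq0 i q0; rewrite -/(x i); move: (x i) => y y0.
by field; rewrite A0 B0 q0 y0 q4.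
Qed.

Lemma op_aw23 f i : op_comm op2 op3 f i + op1 f i = awZ * f i.
Proof.
rewrite /op_comm !op3E /op2 !op3E /op1 !(addrK, subrK).
rewrite /awZ /split_coef /desc /asc /hw !(xD, xB).
have := expfz_neq0 i q0; rewrite -/(x i); move: (x i) => y y0.
by field; rewrite A0 B0 q0 y0 q4 qq1.
Qed.

Lemma op_aw31 f i : op_comm op3 op1 f i + op2 f i = awZ * f i.
Proof.
rewrite /op_comm !op3E /op1 !op3E /op2 !(addrK, subrK).
rewrite /awZ /split_coef /desc /asc /hw !(xD, xB).
have := expfz_neq0 i q0; rewrite -/(x i); move: (x i) => y y0.
by field; rewrite A0 B0 q0 y0 q4 qq1.
Qed.

Lemma op_casimir f i :
  c q * awZ * (q * op1 f i + q^-1 * op2 f i + q * op3 f i)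
  - q ^+ 2 * op1 (op1 f) i - q ^- 2 * op2 (op2 f) i - q ^+ 2 * op3 (op3 f) i
  - q * op1 (op2 (op3 f)) i =
  (let k := c (B * A * A) in let s := c B in
   k * (k + s ^+ 3) + (3 * s ^+ 2 - c q ^+ 2)) * f i.
Proof.
rewrite /op1 /op2 !op3E !(addrK, subrK).
rewrite /awZ /split_coef /desc /asc /hw !(xD, xB).
have := expfz_neq0 i q0; rewrite -/(x i); move: (x i) => y y0.
by field; rewrite A0 B0 q0 y0 q4 qq1.
Qed.

End Operators.

Section SplitMatrices.
Variables (K : fieldType) (q : K) (m M : nat).
Hypotheses (gq : generic q) (mM : (m <= M)%N).
Let q0 : q != 0. Proof. by case: gq. Qed.
Let d := (M - m)%N.
Let A := q ^ m%:Z.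
Let B := q ^ (M%:Z + 1).
Local Notation T := 'M[K]_d.+1.
Local Notation phi := (split_coef q A B).

Definition splitG1 : T :=
  \matrix_(i, j) ((th q (M - i)) *+ (i == j) + ((j.+1 == i)%N)%:R).
Definition splitG2 : T :=
  \matrix_(i, j) ((th q (m + i)) *+ (i == j) + phi j%:Z *+ (i.+1 == j)%N).
Definition splitG3 : T := (awZ q A B)%:A - aw_comm q splitG1 splitG2.

Lemma desc_th (i : nat) : (i <= M)%N -> desc q B i%:Z = th q (M - i).
Proof.
move=> iM; rewrite th_qa // /desc /B !(qzD gq) expr1z.
have -> : q ^ (M - i)%N%:Z = q ^ M%:Z / q ^ i%:Z by rewrite -qzN -qzD //; congr (q ^ _); lia.
have := qz0 gq M%:Z; have := qz0 gq i%:Z; move: (q ^ i%:Z) (q ^ M%:Z) => x y x0 y0.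
by have -> : y * q * (y * q) / (x * x * q) = y / x * (y / x) * q by field; rewrite q0 x0.
Qed.

Lemma asc_th (i : nat) : asc q A i%:Z = th q (m + i).
Proof.
rewrite th_qa // /asc /A PoszD (qzD gq).
move: (q ^ i%:Z) (q ^ m%:Z) => x y.
by have -> : y * y * x * x * q = y * x * (y * x) * q by ring.
Qed.

(** The sequence is arbitrary beyond the last entry, which op2 multiplies by 0;
    below the first one it vanishes, which op1 needs. *)
Definition truncates (v : 'cV[K]_d.+1) (f : int -> K) : Prop :=
  (forall i : 'I_d.+1, v i 0 = f i%:Z) /\ (forall i : int, i < 0 -> f i = 0).

(** Extension by zero on both sides. *)
Definition extension (v : 'cV[K]_d.+1) (i : int) : K :=
  if i is Posz k then (if insub k is Some o then v o 0 else 0) else 0.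

Lemma extensionP v : truncates v (extension v).
Proof.
split; last by case.
by move=> o; rewrite /extension insubT //= => lt; congr (v _ _); apply/val_inj.
Qed.

Definition follows (G : T) (g : (int -> K) -> int -> K) : Prop :=
  forall v f, truncates v f -> truncates (G *m v) (g f).

Lemma follows_mul G H g h : follows G g -> follows H h ->
  follows (G * H) (fun f => g (h f)).
Proof. by move=> Gg Hh v f vf; rewrite -mulmxA; apply/Gg/Hh. Qed.

Lemma follows_add G H g h : follows G g -> follows H h ->
  follows (G + H) (fun f i => g f i + h f i).
Proof.
move=> Gg Hh v f vf; have [g1 g2] := Gg _ _ vf; have [h1 h2] := Hh _ _ vf.
by rewrite mulmxDl; split=> i => [|i0]; [rewrite mxE g1 h1|rewrite g2 // h2 // addr0].
Qed.

Lemma follows_scale k G g : follows G g -> follows (k *: G) (fun f i => k * g f i).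
Proof.
move=> Gg v f vf; have [g1 g2] := Gg _ _ vf.
by rewrite -scalemxAl; split=> i => [|i0]; [rewrite mxE g1|rewrite g2 // mulr0].
Qed.

Lemma follows_opp G g : follows G g -> follows (- G) (fun f i => - g f i).
Proof.
move=> Gg v f vf; have [g1 g2] := Gg _ _ vf.
by rewrite mulNmx; split=> i => [|i0]; [rewrite mxE g1|rewrite g2 // oppr0].
Qed.

Lemma follows_scalar k : follows k%:A (fun f i => k * f i).
Proof.
move=> v f [v1 v2]; rewrite -scalemxAl mul1mx.
by split=> i => [|i0]; [rewrite mxE v1|rewrite v2 // mulr0].
Qed.

(** This transfers identities between operators to the matrices. *)
Lemma follows_eq G H g h : follows G g -> follows H h ->
  (forall f i, g f i = h f i) -> G = H.
Proof.
move=> Gg Hh gh; apply/matrixP => i j.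
pose v : 'cV[K]_d.+1 := delta_mx j 0.
have vf := extensionP v.
have [e1 _] := Gg _ _ vf; have [e2 _] := Hh _ _ vf.
by have := e1 i; rewrite gh -e2 /v -!colE !mxE.
Qed.

Lemma sum_ord_at n (g : nat -> K) k :
  \sum_(j < n) g j *+ (nat_of_ord j == k) = if (k < n)%N then g k else 0.
Proof.
case: ltnP => [kn|nk]; last first.
  by rewrite big1 // => j _; have := ltn_ord j; case: eqP => [->|//]; rewrite ltnNge nk.
rewrite (bigD1 (Ordinal kn)) //= eqxx big1 ?addr0 // => j jk.
by case: eqP => // e; case/eqP: jk; apply: val_inj.
Qed.

Lemma follows1 : follows splitG1 (op1 q B).
Proof.
move=> v f [v1 v2]; split=> [i|i i0]; last by rewrite /op1 !v2 ?mulr0 ?addr0 //; lia.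
have iM : (i <= M)%N by have := ltn_ord i; lia.
rewrite mxE /op1 desc_th //.
transitivity (\sum_(j < d.+1) (th q (M - i) * f j%:Z) *+ (nat_of_ord j == i)
  + \sum_(j < d.+1) f j%:Z *+ (nat_of_ord j == i.-1) *+ (0 < i)%N).
  rewrite -big_split; apply: eq_bigr => j _; rewrite /= mxE v1 mulrDl !mulrnAl mul1r.
  rewrite -val_eqE /= [in LHS](eq_sym (nat_of_ord i)); congr (_ + _).
  by case: (nat_of_ord i) => [|i'] /=; rewrite ?mulr0n // eqSS mulr1n.
rewrite (sum_ord_at _ (fun j => th q (M - i) * f j%:Z)) ltn_ord; congr (_ + _).
rewrite sumrMnl (sum_ord_at _ (fun j => f j%:Z)).
case: i iM => [[|i] ii] /= iM; first by rewrite mulr0n v2.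
by rewrite (ltn_trans _ ii) // mulr1n; congr (f _); lia.
Qed.

Lemma split_coef0 : phi 0 = 0.
Proof. by rewrite /split_coef expr0z invr1 subrr !mul0r. Qed.

Lemma split_coef_end : phi (d%:Z + 1) = 0.
Proof.
rewrite /split_coef (_ : B / (A * q ^ (d%:Z + 1)) = 1); first by rewrite invr1 subrr mulr0 !mul0r.
rewrite /A /B -qzD // (_ : m%:Z + (d%:Z + 1) = M%:Z + 1) ?mulfV ?(qz0 gq) //.
by rewrite /d; lia.
Qed.

Lemma follows2 : follows splitG2 (op2 q A B).
Proof.
move=> v f [v1 v2]; split=> [i|i i0]; last first.
  rewrite /op2 v2 // mulr0 add0r; have [->|i1] := eqVneq i (-1).
    by rewrite addNr split_coef0 mul0r.
  by rewrite v2 ?mulr0 //; lia.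
rewrite mxE /op2 asc_th.
transitivity (\sum_(j < d.+1) (th q (m + i) * f j%:Z) *+ (nat_of_ord j == i)
  + \sum_(j < d.+1) (phi j%:Z * f j%:Z) *+ (nat_of_ord j == i.+1)).
  rewrite -big_split; apply: eq_bigr => j _; rewrite /= mxE v1 mulrDl !mulrnAl.
  by rewrite -val_eqE /= (eq_sym (nat_of_ord i)) (eq_sym i.+1).
rewrite (sum_ord_at _ (fun j => th q (m + i) * f j%:Z)) ltn_ord; congr (_ + _).
rewrite (sum_ord_at _ (fun j => phi j%:Z * f j%:Z)).
have e : i.+1%:Z = i%:Z + 1 by lia.
case: ltnP => di; rewrite -?e //.
have -> : i.+1 = d.+1 by apply/eqP; rewrite eqn_leq di ltn_ord.
by rewrite (_ : d.+1%:Z = d%:Z + 1) ?split_coef_end ?mul0r //; lia.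
Qed.

Lemma follows_comm G H g h : follows G g -> follows H h ->
  follows (aw_comm q G H) (op_comm q g h).
Proof.
move=> Gg Hh; apply: follows_scale.
exact: (follows_add (follows_scale q (follows_mul Gg Hh))
  (follows_opp (follows_scale q^-1 (follows_mul Hh Gg)))).
Qed.

Lemma follows3 : follows splitG3 (op3 q A B).
Proof.
exact: follows_add (follows_scalar _) (follows_opp (follows_comm follows1 follows2)).
Qed.

Let A0 : A != 0. Proof. exact: qz0. Qed.
Let B0 : B != 0. Proof. exact: qz0. Qed.
Let qq1 : q * q + 1 != 0.
Proof.
have := qq0 gq; rewrite (_ : q + q^-1 = (q * q + 1) / q); last by field.
by rewrite mulf_eq0 negb_or => /andP[].
Qed.
Let q4 : (q * q) ^+ 2 - 1 != 0.
Proof.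
have := q2q2 gq; rewrite (_ : q ^+ 2 - q ^- 2 = ((q * q) ^+ 2 - 1) / q ^+ 2); last by field.
by rewrite mulf_eq0 negb_or => /andP[].
Qed.

Local Notation Z := (awZ q A B).

Lemma split_aw12 : aw_comm q splitG1 splitG2 + splitG3 = Z%:A.
Proof. by rewrite addrCA subrr addr0. Qed.

Lemma split_aw23 : aw_comm q splitG2 splitG3 + splitG1 = Z%:A.
Proof.
apply: follows_eq (follows_add (follows_comm follows2 follows3) follows1) (follows_scalar _) _.
by move=> f i; apply: op_aw23.
Qed.

Lemma split_aw31 : aw_comm q splitG3 splitG1 + splitG2 = Z%:A.
Proof.
apply: follows_eq (follows_add (follows_comm follows3 follows1) follows2) (follows_scalar _) _.
by move=> f i; apply: op_aw31.
Qed.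

Local Notation c z := (z + z^-1).

Lemma split_casimir :
  (c q * Z) *: (q *: splitG1 + q^-1 *: splitG2 + q *: splitG3)
  - q ^+ 2 *: splitG1 ^+ 2 - q ^- 2 *: splitG2 ^+ 2 - q ^+ 2 *: splitG3 ^+ 2
  - q *: (splitG1 * (splitG2 * splitG3)) =
  (let k := c (B * A * A) in let s := c B in
   k * (k + s ^+ 3) + (3 * s ^+ 2 - c q ^+ 2))%:A.
Proof.
have f1 := follows1; have f2 := follows2; have f3 := follows3; rewrite !expr2.
apply: follows_eq (follows_scalar _) _; last first.
  by move=> f i; exact: (op_casimir q0 A0 B0 q4 qq1 f i).
apply: follows_add; last exact/follows_opp/follows_scale/(follows_mul f1 (follows_mul f2 f3)).
apply: follows_add; last exact/follows_opp/follows_scale/(follows_mul f3 f3).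
apply: follows_add; last exact/follows_opp/follows_scale/(follows_mul f2 f2).
apply: follows_add; last exact/follows_opp/follows_scale/(follows_mul f1 f1).
apply: follows_scale; apply: follows_add; last exact: follows_scale.
by apply: follows_add; exact: follows_scale.
Qed.

End SplitMatrices.

(** * Spectra of the split matrices *)

Section Triangular.
Variables (K : fieldType) (d : nat).
Local Notation T := 'M[K]_d.+1.

Lemma horner_alg_mx (G : T) p : horner_alg G p = horner_mx G p.
Proof.
elim/poly_ind: p => [|p c IH]; first by rewrite !rmorph0.
by rewrite !rmorphD !rmorphM /= horner_algX horner_algC horner_mx_X horner_mx_C IH scalemx1.
Qed.

Lemma char_poly_tr (G : T) : char_poly G^T = char_poly G.
Proof.
rewrite /char_poly -det_tr; congr (\det _).
by rewrite /char_poly_mx linearB /= tr_scalar_mx map_trmx trmxK.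
Qed.

(** Cayley-Hamilton, the characteristic polynomial having simple roots. *)
Lemma spectrum_vanish (G : T) (g : nat -> K) (p : {poly K}) :
  char_poly G = \prod_(i < d.+1) ('X - (g i)%:P) ->
  {in [pred i | (i < d.+1)%N] &, injective g} ->
  (forall i, (i < d.+1)%N -> p.[g i] = 0) -> horner_alg G p = 0.
Proof.
move=> cG ginj p0; have : char_poly G %| p.
  rewrite cG -(big_mkord xpredT (fun i => 'X - (g i)%:P)) -(big_map g xpredT (fun z => 'X - z%:P)).
  apply: uniq_roots_dvdp.
    apply/allP => z zg; have [i i0 ->] := seq.mapP zg.
    by move: i0; rewrite mem_index_iota => /= i0; rewrite rootE p0.
  rewrite uniq_rootsE map_inj_in_uniq ?iota_uniq // => i j.
  by rewrite !mem_index_iota => /= i0 j0; apply: ginj.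
case/dvdpP => h ->; rewrite rmorphM /= [horner_alg G (char_poly G)]horner_alg_mx.
by rewrite Cayley_Hamilton mulr0.
Qed.

Lemma horner_eigen (G : T) (v : 'cV[K]_d.+1) l p :
  G *m v = l *: v -> horner_alg G p *m v = p.[l] *: v.
Proof.
move=> Gv; elim/poly_ind: p => [|p c IH]; first by rewrite rmorph0 mul0mx horner0 scale0r.
rewrite rmorphD rmorphM /= horner_algX horner_algC mulmxDl -mulmxA Gv -scalemxAr IH.
by rewrite -scalemxAl mul1mx scalerA -scalerDl !hornerE mulrC.
Qed.

Lemma spectrum_proj (G : T) N lam l :
  (forall a c, (a <= N)%N -> (c <= N)%N -> lam a = lam c -> a = c) ->
  (l <= N)%N -> root (char_poly G) (lam l) -> eproj N lam G l != 0.
Proof.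
move=> laminj lN; rewrite -char_poly_tr -eigenvalue_root_char => /eigenvalueP[v vG v0].
have Gv : G *m v^T = lam l *: v^T by rewrite -[G]trmxK -trmx_mul vG linearZ.
have := horner_eigen (lag N lam l) Gv; rewrite (lagE laminj) // eqxx scale1r -/(eproj _ _ _ _).
move=> ev; apply: contraNneq v0 => e0; move: ev; rewrite e0 mul0mx => /esym/eqP.
by rewrite trmx_eq0.
Qed.

End Triangular.

Section SplitSpectrum.
Variables (K : fieldType) (q : K) (m M : nat).
Hypotheses (gq : generic q) (mM : (m <= M)%N).
Local Notation d := (M - m)%N.
Local Notation A := (q ^ m%:Z).
Local Notation B := (q ^ (M%:Z + 1)).
Local Notation G1 := (splitG1 q m M).
Local Notation G2 := (splitG2 q m M).

Lemma th_inj' a c : th q a = th q c -> a = c.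
Proof. by apply/contra_eq => /eqP ac; rewrite -subr_eq0 th_neq. Qed.

Lemma char_split1 : char_poly G1 = \prod_(i < d.+1) ('X - (th q (M - i))%:P).
Proof.
rewrite char_poly_trig; last first.
  apply/is_trig_mxP => i j ij; rewrite mxE -val_eqE /=.
  by rewrite (ltn_eqF ij) gtn_eqF ?mulr0n ?addr0 // ltnW.
by apply: eq_bigr => i _; rewrite mxE eqxx gtn_eqF // addr0 mulr1n.
Qed.

Lemma char_split2 : char_poly G2 = \prod_(i < d.+1) ('X - (th q (m + i))%:P).
Proof.
rewrite -char_poly_tr char_poly_trig; last first.
  apply/is_trig_mxP => i j ij; rewrite !mxE -val_eqE /=.
  by rewrite (gtn_eqF ij) gtn_eqF ?mulr0n ?addr0 // ltnS ltnW.
by apply: eq_bigr => i _; rewrite !mxE eqxx gtn_eqF // mulr0n addr0 mulr1n.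
Qed.

Lemma split1_vanish (p : {poly K}) :
  (forall r, (m <= r)%N -> (r <= M)%N -> p.[th q r] = 0) -> horner_alg G1 p = 0.
Proof.
move=> p0.
apply: (spectrum_vanish (g := fun i => th q (M - i)) char_split1) => [i j|i] id.
  by rewrite !inE in id *; move=> jd /th_inj'; lia.
by apply: p0; lia.
Qed.

Lemma split2_vanish (p : {poly K}) :
  (forall r, (m <= r)%N -> (r <= M)%N -> p.[th q r] = 0) -> horner_alg G2 p = 0.
Proof.
move=> p0.
apply: (spectrum_vanish (g := fun i => th q (m + i)) char_split2) => [i j|i] id.
  by rewrite !inE in id *; move=> jd /th_inj'; lia.
by apply: p0; lia.
Qed.

Variables (N : nat) (MN : (M <= N)%N).
Local Notation e1 := (eproj N (th q) G1).
Local Notation e2 := (eproj N (th q) G2).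
Let tinj := @th_inj K q N gq.

Lemma split1_nodal : horner_alg G1 (nodal N (th q)) = 0.
Proof. by apply: split1_vanish => r _ rM; apply: nodal0; lia. Qed.
Lemma split2_nodal : horner_alg G2 (nodal N (th q)) = 0.
Proof. by apply: split2_vanish => r _ rM; apply: nodal0; lia. Qed.

Lemma split1_proj_neq0 a : (m <= a)%N -> (a <= M)%N -> e1 a != 0.
Proof.
move=> ma aM; apply: (spectrum_proj tinj); first by lia.
have ad : (M - a < d.+1)%N by lia.
rewrite char_split1 rootE horner_prod (bigD1 (Ordinal ad)) //= subKn //.
by rewrite !hornerE subrr mul0r.
Qed.

Lemma split1_proj_out a : (a < m)%N -> e1 a = 0.
Proof.
move=> am; apply: split1_vanish => r mr rM; rewrite (lagE tinj); last by lia.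
by case: eqP => // ra; lia.
Qed.
Lemma split2_proj_out a : (a < m)%N -> e2 a = 0.
Proof.
move=> am; apply: split2_vanish => r mr rM; rewrite (lagE tinj); last by lia.
by case: eqP => // ra; lia.
Qed.

End SplitSpectrum.

(** The corner of G2 at the lowest eigenvalue of G1, and conversely, for the chains
    that contain level 0. *)
Section SplitBottom.
Variables (K : fieldType) (q : K) (M : nat).
Hypotheses (gq : generic q) (M_gt0 : (0 < M)%N).
Local Notation d := (M - 0)%N.
Local Notation A := (q ^ 0%:Z).
Local Notation B := (q ^ (M%:Z + 1)).
Local Notation G1 := (splitG1 q 0 M).
Local Notation G2 := (splitG2 q 0 M).
Local Notation phi := (split_coef q A B).
Local Notation T := 'M[K]_d.+1.
Let f1 : follows G1 (op1 q B) := @follows1 K q 0 M gq (leq0n M).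
Let f2 : follows G2 (op2 q A B) := @follows2 K q 0 M gq (leq0n M).

Lemma extension_eq0 (v : 'cV[K]_d.+1) (i : 'I_d.+1) : extension v i%:Z = 0 -> v i 0 = 0.
Proof. by have [-> _] := extensionP v. Qed.

Lemma eigen_rec1 (v : 'cV[K]_d.+1) (i : nat) : G1 *m v = th q 0 *: v -> (i <= M)%N ->
  (th q 0 - th q (M - i)) * extension v i%:Z = extension v (i%:Z - 1).
Proof.
move=> Gv iM; have vf := extensionP v; have id : (i < d.+1)%N by lia.
have [e _] := f1 vf; have := e (Ordinal id); rewrite Gv mxE vf.1 /= /op1 (desc_th gq (leq0n M) iM).
by rewrite mulrBl => ->; rewrite addrAC subrr add0r.
Qed.

Lemma eigen_support1 (v : 'cV[K]_d.+1) (i : 'I_d.+1) :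
  G1 *m v = th q 0 *: v -> (i < M)%N -> v i 0 = 0.
Proof.
move=> Gv iM; apply: extension_eq0; move: (nat_of_ord i) iM => {}i.
have step j : (j < M)%N -> extension v (j%:Z - 1) = 0 -> extension v j%:Z = 0.
  move=> jM e; have := eigen_rec1 Gv (ltnW jM); rewrite e => /eqP.
  by rewrite mulf_eq0 (negPf (th_neq gq _)) //=; [move/eqP | lia].
elim: i => [|i IH] iM; first by apply: step.
apply: step => //; rewrite (_ : i.+1%:Z - 1 = i%:Z); last by lia.
by apply: IH; lia.
Qed.

Lemma eigen_rec2 (v : 'cV[K]_d.+1) (i : nat) : G2 *m v = th q 0 *: v -> (i <= M)%N ->
  (th q 0 - th q i) * extension v i%:Z = phi (i%:Z + 1) * extension v (i%:Z + 1).
Proof.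
move=> Gv iM; have vf := extensionP v; have id : (i < d.+1)%N by lia.
have [e _] := f2 vf; have := e (Ordinal id); rewrite Gv mxE vf.1 /= /op2 asc_th // add0n.
by rewrite mulrBl => ->; rewrite addrAC subrr add0r.
Qed.

Lemma eigen_support2 (v : 'cV[K]_d.+1) (i : 'I_d.+1) :
  G2 *m v = th q 0 *: v -> (0 < i)%N -> v i 0 = 0.
Proof.
move=> Gv i0; apply: extension_eq0.
have : (i <= M)%N by have := ltn_ord i; lia.
move: (nat_of_ord i) i0 => {}i i0 iM; move e : (M - i)%N => j.
elim: j i e i0 iM => [|j IH] i e i0 iM; have := eigen_rec2 Gv iM.
  rewrite (_ : i%:Z + 1 = d%:Z + 1); last by lia.
  rewrite split_coef_end // mul0r => /eqP.
  by rewrite mulf_eq0 (negPf (th_neq gq _)) //=; [move/eqP | lia].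
rewrite (_ : i%:Z + 1 = i.+1%:Z); last by lia.
rewrite (IH i.+1) ?mulr0; try lia.
by move/eqP; rewrite mulf_eq0 (negPf (th_neq gq _)) //=; [move/eqP | lia].
Qed.

Local Notation delta k := (delta_mx k 0 : 'cV[K]_d.+1).

Lemma rank_one_corner (e G : T) (k : 'I_d.+1) s :
  (forall i j, i != k -> e i j = 0) -> e *m G *m delta k = s *: delta k ->
  e * G * e = s *: e.
Proof.
move=> ek eG; have er : e = delta k *m row k e.
  apply/matrixP => i j; rewrite mxE big_ord1 !mxE eqxx andbT.
  by have [->|ik] := eqVneq i k; rewrite ?mul1r // ek ?mul0r.
have -> : e * G * e = e *m G *m (delta k *m row k e) by rewrite -er.
by rewrite mulmxA eG -scalemxAl -er.
Qed.

Lemma delta_truncates (k : 'I_d.+1) : truncates (delta k) (fun i => (i == k%:Z)%:R).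
Proof. by split=> [i|i i0]; rewrite ?mxE ?eqxx ?andbT //; case: eqP => // e; lia. Qed.

(** As e X = th 0 e, applying e to (X - th 1) Y delta gives (th 0 - th 1) e Y delta. *)
Lemma corner_value (X Y : T) (k : 'I_d.+1) l :
  X *m delta k = th q 0 *: delta k ->
  horner_alg X (nodal M (th q)) = 0 ->
  (X *m (Y *m delta k)) - th q 1 *: (Y *m delta k) = l *: delta k ->
  let e := eproj M (th q) X 0 in
  e *m Y *m delta k = (l / (th q 0 - th q 1)) *: delta k.
Proof.
move=> Xd X0 XY e; have tinj := @th_inj K q M gq.
have ed : e *m delta k = delta k.
  by have := horner_eigen (lag M (th q) 0) Xd; rewrite (lagE tinj) // eqxx scale1r.
have h0 : th q 0 - th q 1 != 0 by apply: th_neq.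
have : (th q 0 - th q 1) *: (e *m Y *m delta k) = l *: delta k.
  have eX : e *m X = th q 0 *: e := eproj_X tinj X0 0.
  rewrite -[in RHS]ed [RHS]scalemxAr -XY mulmxBr -[e *m Y *m _]mulmxA.
  by rewrite [e *m (X *m _)]mulmxA eX -scalemxAl -[e *m (th q 1 *: _)]scalemxAr -scalerBl.
by move/(congr1 ( *:%R (th q 0 - th q 1)^-1)); rewrite !scalerA mulVf // scale1r mulrC.
Qed.

(** The range of e is the eigenline of G1 for th 0, which is spanned by the last
    basis vector. *)
Lemma bottom_corner1 : let e := eproj M (th q) G1 0 in
  e * G2 * e = ((asc q A M%:Z * (th q 0 - th q 1) + phi M%:Z) / (th q 0 - th q 1)) *: e.
Proof.
move=> e; have tinj := @th_inj K q M gq.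
have X0 := split1_nodal gq (leq0n M) (leqnn M).
have kE : (ord_max : 'I_d.+1) = M :> nat by rewrite /= subn0.
have [dt1 dt2] := delta_truncates ord_max; rewrite kE in dt1 dt2.
have vd := delta_truncates ord_max; rewrite kE in vd.
apply: (@rank_one_corner _ _ ord_max).
  move=> i j ik; have Ge : G1 *m col j e = th q 0 *: col j e.
    have GE : G1 *m e = th q 0 *: e := X_eproj tinj X0 0.
    by rewrite !colE mulmxA GE -scalemxAl.
  have := eigen_support1 (i := i) Ge; rewrite mxE; apply.
  have : nat_of_ord i <> M by move=> e'; case/eqP: ik; apply/val_inj/(etrans e')/esym.
  by have := ltn_ord i; lia.
apply: corner_value => //.
  apply/matrixP => i j; rewrite ord1; have [-> _] := f1 vd.
  rewrite mxE dt1 /op1; have iM : (i <= M)%N by have := ltn_ord i; lia.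
  rewrite (desc_th gq (leq0n M) iM).
  have -> : (i%:Z - 1 == M%:Z) = false by apply/eqP; lia.
  by rewrite addr0; case: eqP => [[->]|_]; rewrite ?subnn ?mulr0 ?mulr1.
have [e12 _] := f1 (f2 vd); have [e2 _] := f2 vd.
apply/matrixP => i j; rewrite ord1 [LHS]mxE e12 [X in _ + X]mxE [X in - X]mxE e2.
rewrite [RHS]mxE dt1 /op1 /op2 subrK.
have iM : (i <= M)%N by have := ltn_ord i; lia.
rewrite (desc_th gq (leq0n M) iM); move: (nat_of_ord i) iM => {}i iM.
have eqf (x y : int) : x <> y -> (x == y) = false by move/eqP/negPf.
have [i_eq|i_ne] := eqVneq i M.
  rewrite !i_eq eqxx subnn (eqf (M%:Z - 1)) ?(eqf (M%:Z + 1)); try lia.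
  by rewrite !mulr1 !mulr0 !addr0 add0r; ring.
have iM2 : (i%:Z - 1 == M%:Z) = false by apply: eqf => e3; lia.
have iM0 : (i%:Z == M%:Z) = false by apply: eqf => -[]; apply/eqP.
rewrite iM0 iM2 !(mulr0, addr0, add0r).
have [i1|iM1] := eqVneq (i%:Z + 1) M%:Z; last by rewrite !mulr0 subrr.
by rewrite (_ : (M - i)%N = 1%N) ?subrr //; lia.
Qed.

(** Here the eigenline is spanned by the first basis vector. *)
Lemma bottom_corner2 : let e := eproj M (th q) G2 0 in
  e * G1 * e = ((desc q B 0 * (th q 0 - th q 1) + phi 1) / (th q 0 - th q 1)) *: e.
Proof.
move=> e; have tinj := @th_inj K q M gq.
have X0 := split2_nodal gq (leq0n M) (leqnn M).
have vd : truncates (delta ord0) (fun i => (i == 0)%:R) := delta_truncates ord0.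
have [dt1 dt2] := vd.
apply: (@rank_one_corner _ _ ord0).
  move=> i j ik; have Ge : G2 *m col j e = th q 0 *: col j e.
    have GE : G2 *m e = th q 0 *: e := X_eproj tinj X0 0.
    by rewrite !colE mulmxA GE -scalemxAl.
  by have := eigen_support2 (i := i) Ge; rewrite mxE; apply; rewrite lt0n.
have eqf (x y : int) : x <> y -> (x == y) = false by move/eqP/negPf.
have [e21 _] := f2 (f1 vd); have [e1 _] := f1 vd; have [e2 _] := f2 vd.
apply: corner_value => //.
  apply/matrixP => i j; rewrite ord1 e2.
  rewrite mxE dt1 /op2 asc_th // add0n (eqf (i%:Z + 1) 0) ?mulr0 ?addr0; last by lia.
  by case: (nat_of_ord i) => [|n]; rewrite ?(eqf n.+1%:Z 0) ?mulr0 ?mulr1.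
apply/matrixP => i j; rewrite ord1 [LHS]mxE e21 [X in _ + X]mxE [X in - X]mxE e1.
rewrite [RHS]mxE dt1 /op1 /op2 addrK asc_th // add0n; move: (nat_of_ord i) => {}i.
have [i_eq|i_ne] := eqVneq i 0%N.
  rewrite !i_eq add0r eqxx (eqf (0 - 1)) ?(eqf 1) //.
  by rewrite !(mulr1, mulr0, addr0) (add0r (_%:R)) mulr1 addrAC -mulrBl mulrC.
have i0 : (i%:Z == 0) = false by apply: eqf => -[]; apply/eqP.
have i2 : (i%:Z + 1 == 0) = false by apply: eqf => e3; lia.
rewrite i0 i2 !(mulr0, addr0, add0r).
have [i1|i1] := eqVneq (i%:Z - 1) 0; last by rewrite !mulr0 subrr.
by rewrite (_ : i = 1%N) ?subrr //; lia.
Qed.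
End SplitBottom.

(** * Two families of representations *)

Section SplitTriples.
Variables (K : fieldType) (q : K) (N : nat).
Hypotheses (gq : generic q) (N_gt0 : (0 < N)%N).
Let q0 : q != 0. Proof. by case: gq. Qed.
Let two0 : (2%:R : K) != 0. Proof. by case: gq. Qed.
Local Notation c z := (z + z^-1).
Local Notation qa a := (q ^ a%:Z).
Local Notation B M := (q ^ (M%:Z + 1)).

(** For m > 0 the level 0 does not occur and the conditions on the lowest
    idempotents are void; for m = 0 they hold when the chain reaches N and k = chi_s. *)
Lemma split_aw_triple m M k : (m <= M)%N -> (M <= N)%N ->
  awZ q (qa m) (B M) = chs q N / chi q 0 * (k + chs q N) ->
  (let k' := c (B M * qa m * qa m) in let s := c (B M) in
    k' * (k' + s ^+ 3) + (3 * s ^+ 2 - c q ^+ 2) =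
    k * (k + chs q N ^+ 3) + (3 * chs q N ^+ 2 - chi q 0 ^+ 2)) ->
  (m = 0%N -> M = N /\ k = chs q N) ->
  aw_triple q N (splitG1 q m M) (splitG2 q m M) (splitG3 q m M) k.
Proof.
move=> mM MN ZE oE bE; have ZE' : c q * awZ q (qa m) (B M) = chs q N * (k + chs q N).
  by rewrite ZE -chi0E // mulrA [chi q 0 * _]mulrCA mulfV ?mulr1 // chi_neq0.
have bottom : let e1 := eproj N (th q) (splitG1 q m M) 0 in
    let e2 := eproj N (th q) (splitG2 q m M) 0 in
    e1 * splitG2 q m M * e1 = (chs q N ^+ 2 / chi q 0) *: e1 /\
    e2 * splitG1 q m M * e2 = (chs q N ^+ 2 / chi q 0) *: e2 /\
    (chs q N / chi q 0 * (k + chs q N) / 2%:R) *: e1 = (chs q N ^+ 2 / chi q 0) *: e1 /\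
    (chs q N / chi q 0 * (k + chs q N) / 2%:R) *: e2 = (chs q N ^+ 2 / chi q 0) *: e2.
  move=> e1 e2; have [m0|m0] := posnP m; last first.
    have -> : e1 = 0 by apply: split1_proj_out.
    have -> : e2 = 0 by apply: split2_proj_out.
    by rewrite !mulr0 !scaler0; do !split.
  have [MN' kE] := bE m0; rewrite /e1 /e2 m0 MN' bottom_corner1 // bottom_corner2 //.
  have h01 : th q 0 - th q 1 != 0 by apply: th_neq.
  have cc : (c q) != 0 by apply: qq0.
  have -> : desc q (B N) 0 = th q N by rewrite (desc_th gq (leq0n N)) ?subn0.
  rewrite asc_th // add0n kE.
  have -> : chs q N / chi q 0 * (chs q N + chs q N) / 2%:R = chs q N ^+ 2 / chi q 0.
    by rewrite chi0E //; move: cc; move: (c q) => u u0; field; rewrite u0 two0.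
  have s1 : q * q - 1 != 0.
    by apply: sqr_neq1 => //; have := br_neq0 gq (oner_neq0 int); rewrite /br qzN expr1z.
  have th01 : th q 0 - th q 1 = - ((q * q) ^+ 2 - 1) * (q * q - 1) / (q * q * q).
    by rewrite !th_qa // (qaS gq) expr0z; field; rewrite q0.
  rewrite th01 chs_qa // chi0E // th_qa // /split_coef expr0z !(qzD gq) expr1z.
  have s2 : (q * q) ^+ 2 - 1 != 0.
    have := h01; rewrite th01 !mulf_eq0 oppr_eq0 !negb_or => /andP[/andP[]//].
  have s3 : q * q + 1 != 0 by apply: sqr_neqN1.
  have := qz0 gq N%:Z; move: (qa N) => x x0.
  by split; last split => //; congr (_ *: _); field; rewrite q0 s3 x0 s1 oppr_eq0 s2.
have [b1 [b2 [z1 z2]]] := bottom.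
split; [exact: split1_nodal | exact: split2_nodal | rewrite -ZE; exact: split_aw12
  | rewrite -ZE; exact: split_aw23 | rewrite -ZE; exact: split_aw31 | | | | exact: b1].
- by rewrite -ZE' -oE; exact: split_casimir.
- by rewrite /= z1; exact: b1.
- by rewrite /= z2; exact: b2.
Qed.

(** Chains from m up to N. *)
Lemma up_triple m : (m <= N)%N ->
  aw_triple q N (splitG1 q m N) (splitG2 q m N) (splitG3 q m N) (up_root q N m).
Proof.
move=> mN; have kE : up_root q N m = c (B N * qa m * qa m).
  by rewrite /up_root chi_co /co !(qzN, qzD gq) expr1z; congr (_ + _); [|congr _^-1]; ring.
have sE : chs q N = c (B N) by rewrite chs_qa // (qzD gq) expr1z.
apply: split_aw_triple => //.
- rewrite kE sE /awZ chi0E //; have := qz0 gq m%:Z; have := qz0 gq (N%:Z + 1).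
  move: (qa m) (B N) => x y y0 x0; have := qq0 gq; move: (c q) => u u0.
  by field; rewrite x0 y0 u0.
- by rewrite kE sE chi0E.
by move=> ->; split=> //; rewrite /up_root !addr0.
Qed.

(** Chains from m up to N - m. The scalars in the relations, as functions of A and
    B, are the same for chi_s = c B and kappa = c (B A A), as above, and for
    chi_s = c (B A) and kappa = c (B / A), as here. *)
Lemma dn_triple m : (0 < m)%N -> (m + m <= N)%N ->
  aw_triple q N (splitG1 q m (N - m)) (splitG2 q m (N - m)) (splitG3 q m (N - m))
    (dn_root q N m).
Proof.
move=> m0 mN; have NE : N%:Z + 1 = ((N - m)%N%:Z + 1) + m%:Z by lia.
have sE : chs q N = c (B (N - m)%N * qa m) by rewrite /chs chi_co /co qzN NE (qzD gq).
have kE : dn_root q N m = c (B (N - m)%N / qa m).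
  rewrite /dn_root chi_co /co qzN (_ : _ + 1 = (N - m)%N%:Z + 1 - m%:Z); last by lia.
  by rewrite (qzD gq) qzN.
apply: split_aw_triple => //; try lia.
- rewrite kE sE /awZ chi0E //; have := qz0 gq m%:Z; have := qz0 gq ((N - m)%N%:Z + 1).
  move: (qa m) (B _) => x y y0 x0; have := qq0 gq; move: (c q) => u u0.
  by field; rewrite x0 y0 u0.
rewrite kE sE chi0E //; have := qz0 gq m%:Z; have := qz0 gq ((N - m)%N%:Z + 1).
move: (qa m) (B _) => x y y0 x0 /=; move: (c q) => u.
by field; rewrite x0 y0.
Qed.
End SplitTriples.

(** * Independence *)

Section Detection.
Variables (L : comNzRingType) (A : pzRingType) (kp : {rmorphism L -> A}).
Variables (N : nat) (E : nat -> A) (g : A) (t U : nat -> L).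
Hypothesis tri : tridiagonal kp N E g t.
Hypothesis loopU : forall a, E a * g * E a.+1 * g * E a = kp (U a) * E a.
Local Notation M := (path_elt E g).

Lemma path_E0 a b c : b <> c -> M a b * E c = 0.
Proof. by move=> bc; rewrite /path_elt -!mulrA (tri_ortho tri) // !mulr0. Qed.

Lemma corner_extract (P : 'I_N.+1 * 'I_N.+1 -> L) ac :
  \sum_bd kp (P bd) * M bd.1 bd.2 = 0 -> kp (P ac) * M ac.1 ac.2 = 0.
Proof.
move/(congr1 (fun x => E ac.1 * x * E ac.2)); rewrite mulr0 mul0r mulr_sumr mulr_suml.
rewrite (bigD1 ac) //= big1 => [|[b d] bd] /=.
  by rewrite (kpR tri) -mulrA (E_path tri) (path_E tri) addr0.
rewrite (kpR tri) -mulrA; have [e|ba] := eqVneq b ac.1; last first.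
  by rewrite (E_path0 tri) ?mul0r ?mulr0 // => /val_inj e; case/eqP: ba.
have [e'|dc] := eqVneq d ac.2; first by case/eqP: bd; rewrite e e' -surjective_pairing.
by rewrite e (E_path tri) path_E0 ?mulr0 // => /val_inj e'; case/eqP: dc.
Qed.

(** Multiplying a path backwards, edge by edge, turns it into a product of loops
    at its lower end. *)
Lemma corner_unwind p a c : kp p * M a c = 0 ->
  kp (p * \prod_(minn a c <= b < maxn a c) U b) * E (minn a c) = 0.
Proof.
have [ac|ca] := leqP a c.
  move e : (c - a)%N => d; elim: d c p e ac => [|d IH] c p e ac pM.
    have ca : c = a by lia.
    by rewrite ca big_geq // mulr1 -(M_diag tri) -{2}ca.
  case: c e ac pM => [|c] e ac pM; first by lia.
  rewrite big_nat_recr /=; last by lia.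
  rewrite [_ * U c]mulrC mulrA; apply: IH; try lia.
  rewrite rmorphM -mulrA -(path_upr_loop tri loopU); last by lia.
  by rewrite -[M a c.+1 * g * _]mulrA mulrA pM mul0r.
move e : (a - c)%N => d; elim: d a p e ca => [|d IH] a p e ca pM; first by lia.
case: a e ca pM => [|a] e ca pM; first by lia.
have pM' : kp (p * U a) * M a c = 0.
  have ca' : (c <= a)%N by lia.
  by rewrite rmorphM -mulrA -(path_up_loop tri loopU ca') -(kpR tri) pM mulr0.
rewrite big_nat_recr /=; last by lia.
rewrite [_ * U a]mulrC mulrA; have [ac|ca'] := leqP a c; last by apply: IH => //; lia.
have ac' : a = c by lia.
by move: pM'; rewrite ac' big_geq // mulr1 (M_diag tri).
Qed.

End Detection.

Section Independence.
Variables (K : fieldType) (q : K) (N : nat).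
Hypotheses (gq : generic q) (N_gt0 : (0 < N)%N).

Lemma up_root_upol m b : (m <= b)%N -> (b < N)%N -> (upol q N b).[up_root q N m] != 0.
Proof.
move=> mb bN; rewrite hornerZ mulf_neq0 ?ucst_neq0 // hornerM mulf_neq0 // !hornerE.
  by apply: chi_neq => //; lia.
by apply: chi_neq => //; lia.
Qed.

Lemma dn_root_upol m b : (0 < m)%N -> (m <= b)%N -> (b < N - m)%N ->
  (upol q N b).[dn_root q N m] != 0.
Proof.
move=> m0 mb bN; have bN2 : (b < N)%N by lia.
rewrite hornerZ mulf_neq0 ?ucst_neq0 //.
by rewrite hornerM mulf_neq0 // !hornerE; apply: (chi_neq gq); lia.
Qed.

(** For a path between levels lo and hi, the scalars by which kappa acts in those
    representations that contain both levels; k = min lo (N - hi). *)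
Definition kappa_values (lo k : nat) : seq K :=
  [seq up_root q N m | m <- iota 0 lo.+1] ++ [seq dn_root q N m | m <- iota 1 k].

Lemma kappa_values_uniq lo k : (k + k <= N)%N -> uniq (kappa_values lo k).
Proof.
move=> kN; rewrite cat_uniq; apply/and3P; split.
- rewrite map_inj_in_uniq ?iota_uniq // => i j _ _.
  by move/(chi_eq gq) => [|]; lia.
- apply/hasPn => _ /mapP[i ii ->]; apply/mapP => -[j jj].
  by move/(chi_eq gq); move: ii jj; rewrite !mem_iota => ? ? [|]; lia.
rewrite map_inj_in_uniq ?iota_uniq // => i j; rewrite !mem_iota => ii jj.
by move/(chi_eq gq) => [|]; lia.
Qed.

Local Notation S := (As_presentation q N).
Local Notation A := (quotAlg S).
Local Notation g2 := (gelt q N (sigma2 S)).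
Local Notation kap := (kappa q N S).
Local Notation E := (idem q N (sigma1 S)).
Local Notation kp := (evq kap).
Local Notation M := (path_elt E g2).
Local Opaque gelt idem pzinv sigma1 sigma2 evq toQuot kappa qpar chi qp th tpol
  quot_mul quot_scale quot_one.

Let rS := As_is_quotient N gq.
Let tri := quot_tridiagonal gq rS.
Let lpU := loop_up gq rS.

Lemma horner_alg_scalar (T : algType K) (k : K) p : horner_alg (k%:A : T) p = (p.[k])%:A.
Proof.
elim/poly_ind: p => [|p x IH]; first by rewrite rmorph0 horner0 scale0r.
rewrite rmorphD rmorphM /= horner_algX horner_algC IH -scalerAr mulr1 scalerA.
by rewrite -scalerDl !hornerE mulrC.
Qed.

Lemma rep_detects m (M' : nat) k p a : (m <= M')%N -> (M' <= N)%N ->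
  aw_triple q N (splitG1 q m M') (splitG2 q m M') (splitG3 q m M') k ->
  (m <= a)%N -> (a <= M')%N -> kp p * E a = 0 -> p.[k] = 0.
Proof.
move=> mM MN H ma aM pE; have S0 := fun x => @rep0_As _ _ _ gq _ _ _ _ _ H x.
have := congr1 (rep q N (splitG1 q m M') (splitG2 q m M') (S:=S)) pE.
rewrite (repM S0) (rep_evq S0) (rep_kappa gq H (@B3_As _ _ _) S0) (rep_idem gq H S0).
rewrite -[in RHS](scale0r 0) (repZ S0) scale0r horner_alg_scalar -scalerAl mul1r => /eqP.
by rewrite scaler_eq0 => /orP[/eqP //|]; rewrite (negPf (split1_proj_neq0 _ _ _ _ _)).
Qed.

(** Each representation containing the levels a and c sees the path, hence forces
    a root on p; there are maxpow + 1 of them with distinct values of kappa. *)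
Lemma corner_faithful (p : {poly K}) (a c : nat) : (a <= N)%N -> (c <= N)%N ->
  (size p <= (maxpow N a c).+1)%N -> kp p * M a c = 0 -> p = 0.
Proof.
move=> aN cN ps pM; have pU := corner_unwind tri lpU pM.
have mE : maxpow N a c = (minn a c + minn (minn a c) (N - maxn a c))%N.
  by rewrite /maxpow; case: ifP; lia.
have lohi : (minn a c <= maxn a c)%N by lia.
have hiN : (maxn a c <= N)%N by lia.
move: (minn a c) (maxn a c) lohi hiN mE pU => lo hi lohi hiN mE pU.
have split_root k : (p * \prod_(lo <= b < hi) upol q N b).[k] = 0 ->
    (forall b, (lo <= b)%N -> (b < hi)%N -> (upol q N b).[k] != 0) -> p.[k] = 0.
  rewrite hornerM => /eqP; rewrite mulf_eq0 => /orP[/eqP //|] + nz.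
  rewrite horner_prod prodf_seq_eq0 => /hasP[b]; rewrite mem_index_iota /= => /andP[lb bh].
  by rewrite (negPf (nz b lb bh)).
apply/eqP/negPn/negP => p0.
suff: (size (kappa_values lo (minn lo (N - hi))) < size p)%N.
  by rewrite size_cat !size_map !size_iota; lia.
apply: max_poly_roots => //; last by apply: kappa_values_uniq; lia.
apply/allP => z; rewrite mem_cat => /orP[] /mapP[m]; rewrite mem_iota => mlo ->; rewrite rootE.
  apply/eqP/split_root => [|b lb bh]; last by apply: up_root_upol; lia.
  have mN : (m <= N)%N by lia.
  by apply: (rep_detects mN (leqnn N) (up_triple gq N_gt0 mN) _ _ pU); lia.
apply/eqP/split_root => [|b lb bh]; last by apply: dn_root_upol; lia.
have m0 : (0 < m)%N by lia.
have mN : (m + m <= N)%N by lia.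
have mN' : (m <= N - m)%N by lia.
by apply: (rep_detects mN' (leq_subr _ _) (dn_triple gq N_gt0 m0 mN) _ _ pU); lia.
Qed.

Lemma basis_free (c : basis_index N -> K) :
  \sum_i c i *: (M (tag i).1 (tag i).2 * kap ^+ (tagged i : nat)) = 0 -> forall i, c i = 0.
Proof.
pose P (ac : 'I_N.+1 * 'I_N.+1) : {poly K} :=
  \poly_(i < (maxpow N ac.1 ac.2).+1) c (Tagged _ (inord i : 'I_(maxpow N ac.1 ac.2).+1)).
have PE ac : kp (P ac) * M ac.1 ac.2 =
    \sum_(i < (maxpow N ac.1 ac.2).+1) c (Tagged _ i) *: (M ac.1 ac.2 * kap ^+ i).
  rewrite /P (@rmorph_poly_act _ _ _ _ _ _ (kpC rS)); apply: eq_bigr => i _.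
  by rewrite inord_val /= evqX (scale_kp q N).
rewrite (_ : \sum_i _ = \sum_ac kp (P ac) * M ac.1 ac.2); last first.
  by rewrite (eq_bigr _ (fun ac _ => PE ac)) sig_big_dep; apply: eq_bigr => -[].
move=> P0 [ac i]; have := corner_extract tri ac P0.
have a1 : (ac.1 <= N)%N by rewrite -ltnS.
have a2 : (ac.2 <= N)%N by rewrite -ltnS.
move/(corner_faithful a1 a2 (size_poly _ _))/(congr1 (fun p : {poly K} => p`_i)).
by rewrite coef_poly ltn_ord inord_val coef0.
Qed.

Theorem As_basis : is_basis (@basis_elt K q N).
Proof. by split; [exact: basis_free | exact: (basis_spans gq rS)]. Qed.

End Independence.

Lemma qvar_generic (R : realType) : generic (qvar R).
Proof.
have inj := @tofrac_eq {poly R[i]}.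
split; first by rewrite tofrac_eq0 polyX_eq0.
  move=> n n0; rewrite /qvar -rmorphXn -(rmorph1 (@tofrac _)) inj.
  apply/eqP => /(congr1 (fun p : {poly _} => size p)).
  by rewrite size_polyXn size_polyC oner_eq0; lia.
rewrite -(rmorph_nat (@tofrac {poly R[i]})) tofrac_eq0 -polyC1 -polyCMn polyC_eq0.
by rewrite Num.Theory.pnatr_eq0.
Qed.

Theorem mainTheorem2 (R : realType) (N : nat) (N_gt0 : (0 < N)%N) :
  is_basis (@basis_elt (Cq R) (qvar R) N).
Proof. exact: As_basis (qvar_generic R) N_gt0. Qed.
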